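(* Suppose $G_\rho=G\ltimes_\rho\mathbb{R}^N$ is simply connected. Then $G_\rho$ admits a non-trivial perfect Lie central extension if and only if $G_\rho$ has a symplectic contribution.
   Context: $G$ is a connected semisimple Lie group of $\mathbb{R}$-rank $\ge 2$ without compact factors and with finite center; $\rho:G\to SL(N,\mathbb{R})$ is a representation whose decomposition into irreducible subrepresentations does not contain the trivial representation. $G_\rho=G\ltimes_\rho\mathbb{R}^N$ is $G\times\mathbb{R}^N$ with multiplication $(g_1,x_1)(g_2,x_2)=(g_1g_2,\rho(g_2^{-1})x_1+x_2)$. $G_\rho$ has a symplectic contribution if there is a nonzero antisymmetric bilinear form $\omega$ on $\mathbb{R}^N$ with $\omega(\rho(g)w_1,\rho(g)w_2)=\omega(w_1,w_2)$ for all $g\in G$ and $w_1,w_2\in\mathbb{R}^N$. A central extension of a group $S$ is a pair $(\theta,S')$ with $\theta:S'\to S$ a surjective homomorphism and $\ker\theta\subset Z(S')$. A perfect Lie central extension of $G_\rho$ is a central extension $(\theta,H)$ where $H$ is a Lie group with $[H,H]=H$ and $\theta$ is a Lie group homomorphism; it is non-trivial if $\ker\theta$ is non-trivial. *)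

(* Defs.v *)
From HB Require Import structures.
From mathcomp Require Import all_boot all_order perm all_algebra.
From mathcomp Require Import all_classical all_reals all_analysis.

Set Implicit Arguments.
Unset Strict Implicit.
Unset Printing Implicit Defensive.

Import Order.TTheory GRing.Theory Num.Theory.
Import numFieldNormedType.Exports.

Local Open Scope classical_set_scope.
Local Open Scope ring_scope.

(* [Ck k U f] is meant for [U] open in a finite-dimensional [V]; the values of
   [f] outside [U] are then irrelevant. *)
Fixpoint Ck (R : realType) (V W : normedModType R) (k : nat) (U : set V)
    (f : V -> W) : Prop :=
  if k is k'.+1 then
    (forall x, U x -> differentiable f x) /\ (forall v, Ck k' U ('D_v f))
  else forall x, U x -> {for x, continuous f}.

Definition smooth_on (R : realType) (V W : normedModType R) (U : set V)
  (f : V -> W) : Prop := forall k, Ck k U f.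

(* The functions are total; only their restrictions to [cdom] and [ccod]
   matter. *)
Record chart (R : realType) (n : nat) (T : topologicalType) := Chart {
  cdom : set T ;
  ccod : set 'cV[R]_n ;
  cfun :> T -> 'cV[R]_n ;
  cinv : 'cV[R]_n -> T ;
  cdom_open : open cdom ;
  ccod_open : open ccod ;
  cfun_cod : forall x, cdom x -> ccod (cfun x) ;
  cinv_dom : forall y, ccod y -> cdom (cinv y) ;
  cfunK : forall x, cdom x -> cinv (cfun x) = x ;
  cinvK : forall y, ccod y -> cfun (cinv y) = y ;
  cfun_continuous : forall x, cdom x -> {for x, continuous cfun} ;
  cinv_continuous : forall y, ccod y -> {for y, continuous cinv} }.

(* Second countability matters: without it every uncountable discrete group
   would be a Lie group. *)
HB.mixin Record Topological_isManifold (R : realType) (n : nat) T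
    of Topological T := {
  atlas : set (chart R n T) ;
  atlas_cover : forall x : T, exists2 c, atlas c & cdom c x ;
  atlas_smooth : forall c d : chart R n T, atlas c -> atlas d ->
    smooth_on (ccod c `&` cinv c @^-1` cdom d) (d \o cinv c) ;
  manifold_hausdorff : hausdorff_space T ;
  manifold_second_countable : @second_countable T }.

#[short(type="manifoldType")]
HB.structure Definition Manifold (R : realType) (n : nat) :=
  { T of Topological T & Topological_isManifold R n T }.

Section CkTheory.
Context {R : realType}.
Implicit Types U V W : normedModType R.

Lemma near_eq_diff V W (f g : V -> W) (x : V) :
  (\forall y \near x, f y = g y) -> differentiable f x -> differentiable g x.
Proof.
move=> fg df; have cf := diff_continuous df; have fgx := nbhs_singleton fg.
have go : g \o shift x = cst (g x) + 'd f x +o_ 0 id.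
  apply/eqaddoP => e e0.
  have /eqaddoP/(_ e e0) := diff_locally df.
  have fg0 : \forall h \near (0 : V), f (h + x) = g (h + x).
    by move: fg; rewrite (near_shift 0 x) /= => fg; near=> h;
       rewrite -[x in h + x]subr0; near: h.
  by apply: filter_app; near=> h; rewrite !fctE /= -fgx (near fg0 h).
apply/diff_locallyP; have dE := diff_unique cf go.
by rewrite dE.
Unshelve. all: by end_near. Qed.

Lemma Ck_eq V W k (A : set V) (f g : V -> W) : open A ->
  (forall x, A x -> f x = g x) -> Ck k A f -> Ck k A g.
Proof.
move=> oA; elim: k f g => [|k IHk] f g fg /=.
  move=> Cf x Ax; have fgx : \near x, f x = g x.
    by near=> y; apply: fg; near: y; exact: open_nbhs_nbhs.
  rewrite /prop_for /continuous_at -(fg _ Ax).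
  by apply: cvg_trans (Cf x Ax); exact: near_eq_cvg.
move=> [df Cf]; split=> [x Ax|v].
  apply: near_eq_diff (df x Ax).
  by near=> y; apply: fg; near: y; exact: open_nbhs_nbhs.
apply: IHk (Cf v) => x Ax; have [->|v0] := eqVneq v 0; first by rewrite !derive0.
by apply: near_eq_derive => //; near=> y; apply: fg; near: y; exact: open_nbhs_nbhs.
Unshelve. all: by end_near. Qed.

Lemma Ck_pair U V W k (A : set U) (f : U -> V) (g : U -> W) : open A ->
  Ck k A f -> Ck k A g -> Ck k A (fun x => (f x, g x)).
Proof.
move=> oA; elim: k f g => [|k IHk] f g /=.
  by move=> Cf Cg x Ax; apply: cvg_pair; [exact: Cf|exact: Cg].
move=> [df Cf] [dg Cg]; split=> [x Ax|v].
  by apply: differentiable_pair; [exact: df|exact: dg].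
apply: Ck_eq (IHk _ _ (Cf v) (Cg v)) => // x Ax /=.
have dfx := df x Ax; have dgx := dg x Ax.
have dp := differentiable_pair dfx dgx.
by rewrite !deriveE // diff_pair.
Qed.

Lemma Ck_postlin U V W k (A : set U) (f : U -> V) (L : {linear V -> W}) :
  open A -> continuous L -> Ck k A f -> Ck k A (L \o f).
Proof.
move=> oA cL; elim: k f => [|k IHk] f /=.
  by move=> Cf x Ax; apply: continuous_comp; [exact: Cf|exact: cL].
move=> [df Cf]; have dL y : differentiable L y by exact: linear_differentiable.
have dLf x : A x -> differentiable (L \o f) x.
  by move=> Ax; apply: differentiable_comp; [exact: df|exact: dL].
split=> // v; apply: Ck_eq (IHk _ (Cf v)) => // x Ax /=.
rewrite (deriveE _ (dLf _ Ax)) (deriveE _ (df _ Ax)).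
by rewrite (diff_comp (df _ Ax) (dL _)) /= (diff_lin (f x) cL).
Qed.

Lemma Ck_prelin U V W k (A : set V) (f : V -> W) (L : {linear U -> V}) :
  open A -> continuous L -> Ck k A f -> Ck k (L @^-1` A) (f \o L).
Proof.
move=> oA cL; have oLA : open (L @^-1` A) by apply: open_comp => // x _; exact: cL.
elim: k f => [|k IHk] f /=.
  by move=> Cf x Ax; apply: continuous_comp; [exact: cL|exact: Cf].
move=> [df Cf]; have dL y : differentiable L y by exact: linear_differentiable.
have dLf x : A (L x) -> differentiable (f \o L) x.
  by move=> Ax; apply: differentiable_comp; [exact: dL|exact: df].
split=> // v; apply: Ck_eq (IHk _ (Cf (L v))) => // x Ax /=.
rewrite (deriveE _ (dLf _ Ax)) (deriveE _ (df _ Ax)).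
by rewrite (diff_comp (dL _) (df _ Ax)) /= (diff_lin x cL).
Qed.

Lemma Ck_sub V W k (A B : set V) (f : V -> W) : A `<=` B -> Ck k B f -> Ck k A f.
Proof.
move=> AB; elim: k f => [|k IHk] f /=; first by move=> Cf x /AB; exact: Cf.
by move=> [df Cf]; split=> [x /AB|v]; [exact: df|exact: IHk].
Qed.

Lemma smooth_on_cst V W (A : set V) (w : W) : smooth_on A (cst w).
Proof.
move=> k; elim: k w => [|k IHk] w /=; first by move=> x _; exact: cst_continuous.
split=> [x _|v]; first exact: differentiable_cst.
suff -> : 'D_v (cst w : V -> W) = cst 0 by exact: IHk.
by apply/funext => x; rewrite derive_cst.
Qed.

Lemma smooth_on_id V (A : set V) : smooth_on A (@id V).
Proof.
case=> [|k] /=; first by move=> x _ B.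
split=> [x _|v]; first exact: (@ex_diff _ _ _ _ _ _ _ (is_diff_id x)).
suff -> : 'D_v (@id V) = cst v by exact: smooth_on_cst.
by apply/funext => x; rewrite derive_id.
Qed.

End CkTheory.

Section matrix_space.
Context {R : realType}.

Lemma usubmx_continuous m n :
  continuous (usubmx : 'cV[R]_(m + n) -> 'cV[R]_m).
Proof.
move=> x A [P Px PA]; exists (fun i j =>
  match fintype.split i with inl i' => P i' j | inr _ => setT end).
  move=> i j; case: splitP => i' ii'; last exact: filterT.
  by have := Px i' j; rewrite mxE; congr (nbhs (x _ _) _); exact: val_inj.
move=> y yP; apply: PA => i j; rewrite mxE.
by have := yP (lshift n i) j; rewrite -[lshift n i]/(unsplit (inl i)) unsplitK.
Qed.

Lemma dsubmx_continuous m n :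
  continuous (dsubmx : 'cV[R]_(m + n) -> 'cV[R]_n).
Proof.
move=> x A [P Px PA]; exists (fun i j =>
  match fintype.split i with inr i' => P i' j | inl _ => setT end).
  move=> i j; case: splitP => i' ii'; first exact: filterT.
  by have := Px i' j; rewrite mxE; congr (nbhs (x _ _) _); exact: val_inj.
move=> y yP; apply: PA => i j; rewrite mxE.
by have := yP (rshift m i) j; rewrite -[rshift m i]/(unsplit (inr i)) unsplitK.
Qed.

Definition col_pair m n (p : 'cV[R]_m * 'cV[R]_n) : 'cV[R]_(m + n) :=
  col_mx p.1 p.2.

Fact col_pair_is_linear m n : linear (@col_pair m n).
Proof. by move=> a p q; rewrite /col_pair scale_col_mx add_col_mx. Qed.
HB.instance Definition _ m n :=
  GRing.isLinear.Build R _ _ _ (@col_pair m n) (@col_pair_is_linear m n).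

Lemma col_pair_continuous m n : continuous (@col_pair m n).
Proof.
move=> [x y] A [P Pxy PA].
exists ([set u : 'cV_m | forall i j, P (lshift n i) j (u i j)],
        [set v : 'cV_n | forall i j, P (rshift m i) j (v i j)]).
  split=> /=; [exists (fun i j => P (lshift n i) j) |
               exists (fun i j => P (rshift m i) j)] => //= i j.
    by have := Pxy (lshift n i) j; rewrite /col_pair col_mxEu.
  by have := Pxy (rshift m i) j; rewrite /col_pair col_mxEd.
move=> [u v] [/= Pu Pv]; apply: PA => i j.
by rewrite /col_pair /=; case: (split_ordP i) => k ->;
  rewrite ?col_mxEu ?col_mxEd.
Qed.

Lemma cV_hausdorff n : hausdorff_space 'cV[R]_n.
Proof. exact: norm_hausdorff. Qed.

Lemma cV_second_countable n : @second_countable 'cV[R]_n.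
Proof.
pose box (q : 'cV[rat]_n * nat) : set 'cV[R]_n :=
  [set x | forall i j, ball (ratr (q.1 i j) : R) (q.2.+1%:R^-1) (x i j)].
exists (range box).
  by apply: card_le_trans (card_image_le _ _) _; exact: countableP.
split=> [_ [q _ <-]|x A].
  rewrite openE => x qx; exists (fun i j => ball (ratr (q.1 i j) : R) q.2.+1%:R^-1).
    by move=> i j; apply: open_nbhs_nbhs; split; [exact: ball_open|exact: qx].
  by [].
move=> /nbhs_ballP[e /= e0 eA].
have e20 : 0 < e / 2 by rewrite divr_gt0.
have [k] := ltr_add_invr e20; rewrite add0r => ke.
have qx i j : exists q : rat, ball (x i j) k.+1%:R^-1 (ratr q : R).
  have [] := @dense_rat R (ball (x i j) k.+1%:R^-1).
  - by exists (x i j); apply: ballxx; rewrite invr_gt0.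
  - exact: ball_open.
  - by move=> y [xy [q _ qy]]; exists q; rewrite qy.
pose q : 'cV[rat]_n := \matrix_(i, j) projT1 (cid (qx i j)).
exists (box (q, k)).
  split; first by exists (q, k).
  by move=> i j; rewrite mxE /=; apply: ball_sym; case: cid.
move=> y qy; apply: eA; split=> // i j.
rewrite (splitr e); apply: (@ball_triangle _ R (ratr (q i j) : R)).
  by apply: le_ball (ltW ke) _ _; rewrite mxE; case: cid.
by apply: le_ball (ltW ke) _ (qy i j).
Qed.


Definition cV_chart n : chart R n 'cV[R]_n.
Proof.
by refine (@Chart R n _ setT setT id id openT openT _ _ _ _ _ _) => // x _ B.
Defined.

Fact cV_atlas_cover n (x : 'cV[R]_n) :
  exists2 c, [set cV_chart n] c & cdom c x.
Proof. by exists (cV_chart n). Qed.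

Fact cV_atlas_smooth n (c d : chart R n 'cV[R]_n) :
  [set cV_chart n] c -> [set cV_chart n] d ->
  smooth_on (ccod c `&` cinv c @^-1` cdom d) (d \o cinv c).
Proof. by move=> -> ->; exact: smooth_on_id. Qed.

HB.instance Definition _ n := Topological_isManifold.Build R n 'cV[R]_n
  (@cV_atlas_cover n) (@cV_atlas_smooth n)
  (@cV_hausdorff n) (@cV_second_countable n).

End matrix_space.

Lemma prod_hausdorff (S T : topologicalType) : hausdorff_space S ->
  hausdorff_space T -> hausdorff_space (S * T)%type.
Proof.
move=> hS hT [a b] [a' b'] clab; congr (_, _).
  apply: hS => A B aA bB.
  have [] := clab (A `*` setT) (B `*` setT).
  - by exists (A, setT) => //=; split=> //; exact: filterT.
  - by exists (B, setT) => //=; split=> //; exact: filterT.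
  by move=> [x y] [[Ax _] [Bx _]]; exists x.
apply: hT => A B aA bB.
have [] := clab (setT `*` A) (setT `*` B).
- by exists (setT, A) => //=; split=> //; exact: filterT.
- by exists (setT, B) => //=; split=> //; exact: filterT.
by move=> [x y] [[_ Ay] [_ By]]; exists y.
Qed.

Lemma prod_second_countable (S T : topologicalType) : @second_countable S ->
  @second_countable T -> @second_countable (S * T)%type.
Proof.
move=> [B cB [oB bB]] [C cC [oC bC]].
exists [set p.1 `*` p.2 | p in B `*` C].
  by apply: card_le_trans (card_image_le _ _) _; exact: countableX.
split=> [_ [[b c] [/= /oB ob /oC oc] <-]|[x y] A [[P Q] [/= xP yQ] PQA]].
  rewrite openE => -[x y] [/= bx cy]; exists (b, c) => //=.
  by split; apply: open_nbhs_nbhs.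
have [b [Bb bx] bP] := bB x P xP; have [c [Cc cy] cQ] := bC y Q yQ.
exists (b `*` c); first by split=> //; exists (b, c).
by move=> [u v] [/= bu cv]; apply: PQA; split; [exact: bP|exact: cQ].
Qed.

Section prod_manifold.
Context {R : realType} (m n : nat).

Section prod_chart.
Variables (S T : topologicalType) (c : chart R m S) (d : chart R n T).

Definition prod_chart : chart R (m + n)%N (S * T)%type.
Proof.
refine (@Chart R (m + n)%N _ (cdom c `*` cdom d)
  ((usubmx @^-1` ccod c) `&` (dsubmx @^-1` ccod d))
  (fun p => col_pair (c p.1, d p.2))
  (fun y => (cinv c (usubmx y), cinv d (dsubmx y))) _ _ _ _ _ _ _ _).
- rewrite openE => -[x y] [/= cx dy]; exists (cdom c, cdom d) => //=.
  by split; apply: open_nbhs_nbhs; split=> //; exact: cdom_open.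
- apply: openI; apply: open_comp => [x _|]; [exact: usubmx_continuous|
    exact: ccod_open|exact: dsubmx_continuous|exact: ccod_open].
- move=> [x y] [/= cx dy]; rewrite /col_pair /= col_mxKu col_mxKd.
  by split; exact: cfun_cod.
- by move=> y [/= cy dy]; split; exact: cinv_dom.
- by move=> [x y] [/= cx dy]; rewrite /col_pair /= col_mxKu col_mxKd !cfunK.
- by move=> y [/= cy dy]; rewrite /col_pair /= !cinvK // vsubmxK.
- move=> [x y] [/= cx dy]; apply: continuous_comp; last exact: col_pair_continuous.
  have c1 : {for (x, y), continuous (c \o fst : S * T -> _)}.
    by apply: continuous_comp; [exact: cvg_fst|exact: cfun_continuous].
  have d2 : {for (x, y), continuous (d \o snd : S * T -> _)}.
    by apply: continuous_comp; [exact: cvg_snd|exact: cfun_continuous].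
  exact: cvg_pair c1 d2.
- move=> y [/= cy dy].
  have c1 : {for y, continuous (cinv c \o usubmx)}.
    by apply: continuous_comp; [exact: usubmx_continuous|exact: cinv_continuous].
  have d2 : {for y, continuous (cinv d \o dsubmx)}.
    by apply: continuous_comp; [exact: dsubmx_continuous|exact: cinv_continuous].
  exact: cvg_pair c1 d2.
Defined.

End prod_chart.

Variables (M : manifoldType R m) (N : manifoldType R n).

Definition prod_atlas : set (chart R (m + n)%N (M * N)%type) :=
  [set prod_chart p.1 p.2 | p in @atlas R m M `*` @atlas R n N].

Fact prod_atlas_cover (p : M * N) : exists2 c, prod_atlas c & cdom c p.
Proof.
have [c ac cx] := @atlas_cover R m M p.1.
have [d ad dy] := @atlas_cover R n N p.2.
by exists (prod_chart c d); first by exists (c, d).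
Qed.

Lemma transition_open (T : topologicalType) k (c d : chart R k T) :
  open (ccod c `&` cinv c @^-1` cdom d).
Proof.
rewrite openE => y [cy dy]; apply: filterI.
  by apply: open_nbhs_nbhs; split=> //; exact: ccod_open.
apply: (cinv_continuous cy); apply: open_nbhs_nbhs.
by split=> //; exact: cdom_open.
Qed.

Fact prod_atlas_smooth (c d : chart R (m + n)%N (M * N)%type) :
  prod_atlas c -> prod_atlas d ->
  smooth_on (ccod c `&` cinv c @^-1` cdom d) (d \o cinv c).
Proof.
move=> [[c1 c2] [/= ac1 ac2] <-] [[d1 d2] [/= ad1 ad2] <-] k.
have o1 := @transition_open _ _ c1 d1; have o2 := @transition_open _ _ c2 d2.
set A := (X in Ck k X _).
have oA : open A by exact: (@transition_open _ _ (prod_chart c1 c2) (prod_chart d1 d2)).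
apply: (Ck_postlin (f := fun y => ((d1 \o cinv c1) (usubmx y),
  (d2 \o cinv c2) (dsubmx y))) oA (@col_pair_continuous R m n)).
apply: Ck_pair => //.
  apply: Ck_sub (Ck_prelin o1 (@usubmx_continuous R m n) (@atlas_smooth R m M _ _ ac1 ad1 k)).
  by move=> y [[/= ? ?] [/= ? ?]].
apply: Ck_sub (Ck_prelin o2 (@dsubmx_continuous R m n) (@atlas_smooth R n N _ _ ac2 ad2 k)).
by move=> y [[/= ? ?] [/= ? ?]].
Qed.

HB.instance Definition _ := Topological_isManifold.Build R (m + n)%N (M * N)%type
  prod_atlas_cover prod_atlas_smooth
  (prod_hausdorff (@manifold_hausdorff R m M) (@manifold_hausdorff R n N))
  (prod_second_countable (@manifold_second_countable R m M)
     (@manifold_second_countable R n N)).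

End prod_manifold.

Definition smooth_map (R : realType) (m n : nat) (M : manifoldType R m)
    (N : manifoldType R n) (f : M -> N) : Prop :=
  continuous f /\
  forall (c : chart R m M) (d : chart R n N), atlas c -> atlas d ->
    smooth_on (ccod c `&` cinv c @^-1` (f @^-1` cdom d)) (d \o f \o cinv c).

HB.mixin Record Manifold_Group_isLieGroup (R : realType) (n : nat) G
    of Manifold R n G & Group G := {
  mulg_smooth : smooth_map (fun p : G * G => (p.1 * p.2)%g) ;
  invg_smooth : smooth_map (fun x : G => x^-1%g) }.

#[short(type="lieGroupType")]
HB.structure Definition LieGroup (R : realType) (n : nat) :=
  { G of Manifold R n G & Group G & Manifold_Group_isLieGroup R n G }.

Record sl_rep (R : realType) (n N : nat) (G : lieGroupType R n) := SLRep {
  sl_rep_fun :> G -> 'M[R]_N ;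
  sl_rep_det : forall g, \det (sl_rep_fun g) = 1 ;
  sl_repM : forall g h, sl_rep_fun (g * h)%g = sl_rep_fun g *m sl_rep_fun h ;
  sl_rep_smooth : forall c : chart R n G, atlas c ->
    smooth_on (ccod c) (sl_rep_fun \o cinv c) }.

Section CkMatrix.
Context {R : realType}.
Implicit Types U V W : normedModType R.

Lemma Ck_weaken V W k (A : set V) (f : V -> W) : Ck k.+1 A f -> Ck k A f.
Proof.
elim: k f => [|k IHk] f.
  by move=> [df _] x Ax; apply: differentiable_continuous; exact: df.
by move=> [df Cf]; split=> // v; apply: IHk; exact: Cf.
Qed.

Lemma Ck_add V W k (A : set V) (f g : V -> W) : open A ->
  Ck k A f -> Ck k A g -> Ck k A (f + g).
Proof.
move=> oA; elim: k f g => [|k IHk] f g.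
  by move=> Cf Cg x Ax; apply: cvgD; [exact: Cf|exact: Cg].
move=> [df Cf] [dg Cg]; split=> [x Ax|v].
  by apply: differentiableD; [exact: df|exact: dg].
apply: Ck_eq (IHk _ _ (Cf v) (Cg v)) => // x Ax.
by rewrite deriveD //; apply: diff_derivable; [exact: df|exact: dg].
Qed.

Lemma Ck_sum V W k (A : set V) (I : finType) (f : I -> V -> W) : open A ->
  (forall i, Ck k A (f i)) -> Ck k A (\sum_i f i).
Proof.
move=> oA Cf; elim/big_ind: _ => [|g h Cg Ch|i _]; last exact: Cf.
  exact: (smooth_on_cst A (0 : W)).
exact: Ck_add.
Qed.

Lemma Ck_mul V k (A : set V) (f g : V -> R) : open A ->
  Ck k A f -> Ck k A g -> Ck k A (f * g).
Proof.
move=> oA; elim: k f g => [|k IHk] f g.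
  by move=> Cf Cg x Ax; apply: cvgM; [exact: Cf|exact: Cg].
move=> Cf1 Cg1; have Cf0 := Ck_weaken Cf1; have Cg0 := Ck_weaken Cg1.
move: Cf1 Cg1 => [df Cf] [dg Cg]; split=> [x Ax|v].
  by apply: differentiableM; [exact: df|exact: dg].
apply: Ck_eq (Ck_add oA (IHk _ _ Cf0 (Cg v)) (IHk _ _ Cg0 (Cf v))) => // x Ax.
by rewrite deriveM //; apply: diff_derivable; [exact: df|exact: dg].
Qed.

Lemma Ck_prod V k (A : set V) (I : finType) (f : I -> V -> R) : open A ->
  (forall i, Ck k A (f i)) -> Ck k A (\prod_i f i).
Proof.
move=> oA Cf; elim/big_ind: _ => [|g h Cg Ch|i _]; last exact: Cf.
  exact: (smooth_on_cst A (1 : R)).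
exact: Ck_mul.
Qed.

Lemma Ck_entry V k (A : set V) m n (F : V -> 'M[R]_(m, n)) i j : open A ->
  Ck k A F -> Ck k A (fun x => F x i j).
Proof.
move=> oA CF; pose L (M : 'M[R]_(m, n)) := M i j.
have Llin : linear L by move=> a M N; rewrite /L !mxE.
pose lM := GRing.isLinear.Build _ _ _ _ _ Llin.
pose Ll : {linear 'M[R]_(m, n) -> R} := HB.pack L lM.
exact: (@Ck_postlin _ _ _ _ _ _ _ Ll oA (@coord_continuous R m n i j) CF).
Qed.

Lemma Ck_matrix V k (A : set V) m n (F : V -> 'M[R]_(m, n)) : open A ->
  (forall i j, Ck k A (fun x => F x i j)) -> Ck k A F.
Proof.
move=> oA CF.
have -> : F = \sum_i \sum_j (fun x => F x i j *: delta_mx i j).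
  apply/funext => x; rewrite [LHS]matrix_sum_delta fct_sumE.
  by apply: eq_bigr => i _; rewrite fct_sumE.
apply: Ck_sum => // i; apply: Ck_sum => // j.
pose L (a : R) : 'M[R]_(m, n) := a *: delta_mx i j.
have Llin : linear L by move=> a b c; rewrite /L scalerDl scalerA.
pose lM := GRing.isLinear.Build _ _ _ _ _ Llin.
pose Ll : {linear R -> 'M[R]_(m, n)} := HB.pack L lM.
apply: (@Ck_postlin _ _ _ _ _ _ _ Ll oA _ (CF i j)).
exact: scalel_continuous.
Qed.

Lemma Ck_mulmx V k (A : set V) m n p (F : V -> 'M[R]_(m, n))
    (G : V -> 'M[R]_(n, p)) : open A ->
  Ck k A F -> Ck k A G -> Ck k A (fun x => F x *m G x).
Proof.
move=> oA CF CG; apply: Ck_matrix => // i j.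
have -> : (fun x => (F x *m G x) i j) =
    \sum_l ((fun x => F x i l) * (fun x => G x l j)).
  by apply/funext => x; rewrite mxE fct_sumE.
apply: Ck_sum => // l; apply: Ck_mul => //; exact: Ck_entry.
Qed.

Lemma Ck_det V k (A : set V) n (F : V -> 'M[R]_n) : open A ->
  Ck k A F -> Ck k A (fun x => \det (F x)).
Proof.
move=> oA CF.
have -> : (fun x => \det (F x)) =
    \sum_(s : {perm 'I_n}) (cst ((-1) ^+ s) * \prod_i (fun x => F x i (s i))).
  apply/funext => x; rewrite fct_sumE; apply: eq_bigr => s _.
  by rewrite !fctE /= fct_prodE.
apply: Ck_sum => // s; apply: Ck_mul => //; first exact: smooth_on_cst.
by apply: Ck_prod => // i; exact: Ck_entry.
Qed.

Lemma Ck_adj V k (A : set V) n (F : V -> 'M[R]_n) : open A ->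
  Ck k A F -> Ck k A (fun x => \adj (F x)).
Proof.
move=> oA CF; apply: Ck_matrix => // i j.
have -> : (fun x => (\adj (F x)) i j) =
    (cst ((-1) ^+ (j + i)) * (fun x => \det (row' j (col' i (F x))))).
  by apply/funext => x; rewrite mxE.
apply: Ck_mul => //; first exact: smooth_on_cst.
apply: Ck_det => //; apply: Ck_matrix => // a b.
have -> : (fun x => row' j (col' i (F x)) a b) =
  (fun x => F x (lift j a) (lift i b)) by apply/funext => x; rewrite !mxE.
exact: Ck_entry.
Qed.

Lemma continuous_mxP (T : topologicalType) m n (F : T -> 'M[R]_(m, n)) x :
  (forall i j, {for x, continuous (fun y => F y i j)}) -> {for x, continuous F}.
Proof.
move=> cF A [P PF PA].
have : \forall y \near x, forall i j, P i j (F y i j).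
  apply: filter_forall => i; apply: filter_forall => j.
  exact: (cF i j _ (PF i j)).
by apply: filterS => y yP; exact: PA.
Qed.

Lemma continuous_mulmx (T : topologicalType) m n p (F : T -> 'M[R]_(m, n))
    (G : T -> 'M[R]_(n, p)) x : {for x, continuous F} ->
  {for x, continuous G} -> {for x, continuous (fun y => F y *m G y)}.
Proof.
move=> cF cG; apply: continuous_mxP => i j.
have -> : (fun y => (F y *m G y) i j) =
    \sum_l ((fun y => F y i l) * (fun y => G y l j)).
  by apply/funext => y; rewrite mxE fct_sumE.
have cE (a b c : nat) (H : T -> 'M[R]_(a, b)) s t : {for x, continuous H} ->
    {for x, continuous (fun y => H y s t)}.
  move=> cH; apply: (@continuous_comp _ _ _ H (fun M : 'M[R]_(a, b) => M s t)) => //.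
  exact: coord_continuous.
elim/big_ind: _ => [|f g cf cg|l _]; first exact: cst_continuous.
  by apply: cvgD.
by apply: cvgM; apply: cE.
Qed.

End CkMatrix.

Section sl_rep_theory.
Context {R : realType} (n N : nat) (G : lieGroupType R n) (rho : sl_rep N G).

Lemma sl_rep_unit g : rho g \in unitmx.
Proof. by rewrite unitmxE sl_rep_det unitr1. Qed.

Lemma sl_rep1 : rho 1%g = 1%:M.
Proof.
by apply: (can_inj (mulKmx (sl_rep_unit 1%g))); rewrite -sl_repM mulg1 mulmx1.
Qed.

Lemma sl_repVK g : rho g *m rho g^-1%g = 1%:M.
Proof. by rewrite -sl_repM mulgV sl_rep1. Qed.

Lemma sl_repKV g : rho g^-1%g *m rho g = 1%:M.
Proof. by rewrite -sl_repM mulVg sl_rep1. Qed.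

Lemma sl_repV g : rho g^-1%g = \adj (rho g).
Proof.
rewrite -[LHS]mulmx1 -[1%:M](_ : \det (rho g) *: 1%:M = _); last first.
  by rewrite sl_rep_det scale1r.
by rewrite scalemx1 -mul_mx_adj mulmxA sl_repKV mul1mx.
Qed.

Lemma sl_rep_continuous : continuous rho.
Proof.
move=> g; have [c ac cg] := @atlas_cover R n G g.
have Cc : {for g, continuous ((rho \o cinv c) \o c)}.
  apply: continuous_comp; first exact: cfun_continuous.
  by have := @sl_rep_smooth _ _ _ _ rho c ac 0%N; apply; exact: cfun_cod.
rewrite /prop_for /continuous_at -[in X in _ --> X](cfunK cg).
apply: cvg_trans Cc; apply: near_eq_cvg.
have : \forall h \near g, cdom c h.
  by apply: open_nbhs_nbhs; split=> //; exact: cdom_open.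
by apply: filterS => h ch /=; rewrite cfunK.
Qed.

End sl_rep_theory.

(* The group law makes [semidirect rho] depend on [rho], hence the phantom
   argument. *)
Definition semidirect (R : realType) (n N : nat) (G : lieGroupType R n)
  (rho : sl_rep N G) : Type := (G * 'cV[R]_N)%type.

Section semidirect.
Context {R : realType} (n N : nat) (G : lieGroupType R n) (rho : sl_rep N G).
Local Notation S := (semidirect rho).

HB.instance Definition _ := Manifold.copy S (G * 'cV[R]_N)%type.

Definition sd_mul (p q : S) : S := ((p.1 * q.1)%g, rho (q.1^-1)%g *m p.2 + q.2).
Definition sd_one : S := (1%g, 0).
Definition sd_inv (p : S) : S := ((p.1^-1)%g, - (rho p.1 *m p.2)).

Fact sd_mulA : associative sd_mul.
Proof.
move=> p q r; rewrite /sd_mul /= mulgA invgM sl_repM; congr (_, _).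
by rewrite mulmxDr mulmxA addrA.
Qed.
Fact sd_mul1g : left_id sd_one sd_mul.
Proof. by case=> g x; rewrite /sd_mul /= mul1g mulmx0 add0r. Qed.
Fact sd_mulg1 : right_id sd_one sd_mul.
Proof. by case=> g x; rewrite /sd_mul /= mulg1 invg1 sl_rep1 mul1mx addr0. Qed.
Fact sd_mulVg : left_inverse sd_one sd_inv sd_mul.
Proof.
case=> g x; rewrite /sd_mul /= mulVg; congr (_, _).
by rewrite mulmxN mulmxA sl_repKV mul1mx addNr.
Qed.
Fact sd_mulgV : right_inverse sd_one sd_inv sd_mul.
Proof. by case=> g x; rewrite /sd_mul /= mulgV invgK subrr. Qed.

HB.instance Definition _ :=
  isGroup.Build S sd_mulA sd_mul1g sd_mulg1 sd_mulVg sd_mulgV.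

Let fst_continuous (T : topologicalType) (f : T -> S) x :
  {for x, continuous f} -> {for x, continuous (fun y => (f y).1)}.
Proof. by move=> cf; apply: (continuous_comp cf); exact: cvg_fst. Qed.

Let snd_continuous (T : topologicalType) (f : T -> S) x :
  {for x, continuous f} -> {for x, continuous (fun y => (f y).2)}.
Proof. by move=> cf; apply: (continuous_comp cf); exact: cvg_snd. Qed.

Fact sd_invg_continuous : continuous (fun x : S => x^-1%g).
Proof.
move=> x; have cid : {for x, continuous (@id S)} by move=> B.
have c1 := fst_continuous cid; have c2 := snd_continuous cid.
have ci : {for x, continuous (fun y : S => (y.1^-1)%g)}.
  apply: (@continuous_comp _ _ _ (fun y : S => y.1) (fun g : G => g^-1%g)) => //.
  exact: (@invg_smooth R n G).1.
have cr : {for x, continuous (fun y : S => rho y.1)}.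
  apply: (@continuous_comp _ _ _ (fun y : S => y.1) rho) => //.
  exact: sl_rep_continuous.
have cm : {for x, continuous (fun y : S => - (rho y.1 *m y.2))}.
  by apply: cvgN; exact: continuous_mulmx cr c2.
exact: cvg_pair ci cm.
Qed.

Fact sd_mulg_continuous : continuous (fun p : S * S => (p.1 * p.2)%g).
Proof.
move=> p.
have cf : {for p, continuous (@fst S S)} by exact: cvg_fst.
have cs : {for p, continuous (@snd S S)} by exact: cvg_snd.
have c11 := fst_continuous cf; have c12 := snd_continuous cf.
have c21 := fst_continuous cs; have c22 := snd_continuous cs.
have cM : {for p, continuous (fun q : S * S => (q.1.1 * q.2.1)%g)}.
  have cp : {for p, continuous (fun q : S * S => (q.1.1, q.2.1))}.
    exact: cvg_pair c11 c21.
  apply: (@continuous_comp _ _ _ (fun q : S * S => (q.1.1, q.2.1))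
    (fun p : G * G => (p.1 * p.2)%g)) => //.
  exact: (@mulg_smooth R n G).1.
have cr : {for p, continuous (fun q : S * S => rho (q.2.1^-1)%g)}.
  apply: (@continuous_comp _ _ _ (fun q : S * S => (q.2.1^-1)%g) rho).
    apply: (@continuous_comp _ _ _ (fun q : S * S => q.2.1) (fun g : G => g^-1%g)) => //.
    exact: (@invg_smooth R n G).1.
  exact: sl_rep_continuous.
have cm : {for p, continuous
    (fun q : S * S => rho (q.2.1^-1)%g *m q.1.2 + q.2.2)}.
  by apply: cvgD; [exact: continuous_mulmx cr c12|exact: c22].
exact: cvg_pair cM cm.
Qed.

Lemma smooth_dom_open (T T' : topologicalType) k k' (c : chart R k T)
    (d : chart R k' T') (f : T -> T') : continuous f ->
  open (ccod c `&` cinv c @^-1` (f @^-1` cdom d)).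
Proof.
move=> cf; rewrite openE => y [cy dy]; apply: filterI.
  by apply: open_nbhs_nbhs; split=> //; exact: ccod_open.
apply: (cinv_continuous cy); apply: (cf (cinv c y)); apply: open_nbhs_nbhs.
by split=> //; exact: cdom_open.
Qed.

Let dpart a b (B : set 'cV[R]_(a + b)) k : Ck k B (fun y => dsubmx y).
Proof.
apply: (@Ck_sub _ _ _ _ _ setT) => //.
by apply: (Ck_postlin openT (@dsubmx_continuous R a b)); exact: smooth_on_id.
Qed.

Fact sd_invg_smooth : smooth_map (fun x : S => x^-1%g).
Proof.
split; first exact: sd_invg_continuous.
move=> _ _ [[c1 c2] [/= ac1 ac2] <-] [[d1 d2] [/= ad1 ad2] <-] k.
move: ac2 ad2 => -> ->.
set A := (X in Ck k X _).
have oA : open A.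
  exact: (@smooth_dom_open _ _ _ _ (prod_chart c1 (cV_chart N))
    (prod_chart d1 (cV_chart N)) _ sd_invg_continuous).
apply: (Ck_postlin (f := fun y => (d1 (cinv c1 (usubmx y))^-1%g,
  - (rho (cinv c1 (usubmx y)) *m dsubmx y))) oA (@col_pair_continuous R n N)).
apply: Ck_pair => //.
  have := (@invg_smooth R n G).2 c1 d1 ac1 ad1 k.
  move=> /(Ck_prelin (@smooth_dom_open _ _ _ _ c1 d1 _ (@invg_smooth R n G).1)
    (@usubmx_continuous R n N)).
  by apply: Ck_sub => y [[/= ? _] [/= ? _]].
have Crho : Ck k A (fun y => rho (cinv c1 (usubmx y))).
  have := @sl_rep_smooth _ _ _ _ rho c1 ac1 k.
  move=> /(Ck_prelin (@ccod_open _ _ _ c1) (@usubmx_continuous R n N)).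
  by apply: Ck_sub => y [[/= ? _] _].
have := Ck_mulmx oA Crho (@dpart n N A k).
move=> /(Ck_mulmx oA (smooth_on_cst A (- 1%:M : 'M[R]_N) k)).
by apply: Ck_eq => // y _; rewrite /= mulNmx mul1mx.
Qed.

Fact sd_mulg_smooth : smooth_map (fun p : S * S => (p.1 * p.2)%g).
Proof.
split; first exact: sd_mulg_continuous.
move=> _ _ [[_ _] [/= [[c1 c2] [/= ac1 ac2] <-] [[e1 e2] [/= ae1 ae2] <-]] <-] [[d1 d2] [/= ad1 ad2] <-] k.
move: ac2 ad2 ae2 => -> -> ->.
set A := (X in Ck k X _).
have oA : open A.
  exact: (@smooth_dom_open _ _ _ _
    (prod_chart (prod_chart c1 (cV_chart N)) (prod_chart e1 (cV_chart N)))
    (prod_chart d1 (cV_chart N)) _ sd_mulg_continuous).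
pose L (z : 'cV[R]_((n + N) + (n + N))) : 'cV[R]_(n + n) :=
  col_pair (usubmx (usubmx z), usubmx (dsubmx z)).
have Llin : linear L by move=> a x y; rewrite /L /col_pair /= !linearP scale_col_mx add_col_mx.
have Lcont : continuous L.
  move=> z; apply: continuous_comp; last exact: col_pair_continuous.
  have u1 : {for z, continuous (usubmx \o usubmx : 'cV[R]_((n+N)+(n+N)) -> 'cV[R]_n)}.
    by apply: continuous_comp; exact: usubmx_continuous.
  have u2 : {for z, continuous (usubmx \o dsubmx : 'cV[R]_((n+N)+(n+N)) -> 'cV[R]_n)}.
    apply: continuous_comp; [exact: dsubmx_continuous|exact: usubmx_continuous].
  exact: cvg_pair u1 u2.
pose lM := GRing.isLinear.Build _ _ _ _ _ Llin.
pose Ll : {linear 'cV[R]_((n + N) + (n + N)) -> 'cV[R]_(n + n)} := HB.pack L lM.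
pose a1 (z : 'cV[R]_((n + N) + (n + N))) := cinv c1 (usubmx (usubmx z : 'cV[R]_(n + N))).
pose a2 (z : 'cV[R]_((n + N) + (n + N))) := cinv e1 (usubmx (dsubmx z : 'cV[R]_(n + N))).
pose F z : 'cV[R]_n * 'cV[R]_N := (d1 (a1 z * a2 z)%g,
  rho (a2 z)^-1%g *m dsubmx (usubmx z) + dsubmx (dsubmx z)).
suff CF : Ck k A F.
  by apply: Ck_eq (Ck_postlin oA (@col_pair_continuous R n N) CF) => //.
apply: Ck_pair => //.
  have acc : @atlas R (n + n)%N (G * G)%type (prod_chart c1 e1) by exists (c1, e1).
  have := (@mulg_smooth R n G).2 _ d1 acc ad1 k.
  move=> /(@Ck_prelin _ _ _ _ _ _ _ Ll (smooth_dom_open (@mulg_smooth R n G).1) Lcont).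
  move=> CL; have := Ck_sub (A := A) _ CL; move=> {}CL.
  apply: Ck_eq (CL _) => //.
    by move=> z _; rewrite /= /L /col_pair /= col_mxKu col_mxKd.
  move=> z [[[/= ? _] [/= ? _]] [/= ? _]].
  by rewrite /L /col_pair /= /setI /= col_mxKu col_mxKd.
have Cua : Ck k A (fun z => usubmx z : 'cV[R]_(n + N)).
  by apply: (Ck_postlin oA (@usubmx_continuous R _ _)); exact: smooth_on_id.
have Cda : Ck k A (fun z => dsubmx z : 'cV[R]_(n + N)) by exact: dpart.
have Cd x : Ck k A (x : _ -> 'cV[R]_(n + N)) -> Ck k A (fun z => dsubmx (x z)).
  by move=> Cx; exact: (Ck_postlin oA (@dsubmx_continuous R n N) Cx).
apply: Ck_add => //; last exact: Cd.
apply: Ck_mulmx => //; last exact: Cd.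
have -> : (fun z => rho (a2 z)^-1%g) = (fun z => \adj (rho (a2 z))).
  by apply/funext => z; rewrite sl_repV.
apply: Ck_adj => //.
have := @sl_rep_smooth _ _ _ _ rho e1 ae1 k.
have oe : open (usubmx @^-1` ccod e1 : set 'cV[R]_(n + N)).
  by apply: open_comp => [x _|]; [exact: usubmx_continuous|exact: ccod_open].
move=> /(Ck_prelin (@ccod_open _ _ _ e1) (@usubmx_continuous R n N)).
move=> /(Ck_prelin oe (@dsubmx_continuous R (n + N)%N (n + N)%N)).
by apply: Ck_sub => z [[_ [/= ? _]] _].
Qed.

HB.instance Definition _ :=
  Manifold_Group_isLieGroup.Build R (n + N)%N S sd_mulg_smooth sd_invg_smooth.

End semidirect.

Definition simply_connected (R : realType) (T : topologicalType) : Prop :=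
  (forall x y : T, exists gamma : R -> T,
    [/\ {within `[0, 1], continuous gamma}, gamma 0 = x & gamma 1 = y]) /\
  (forall gamma : R -> T, {within `[0, 1], continuous gamma} ->
    gamma 0 = gamma 1 ->
    exists h : R * R -> T,
      [/\ {within `[0, 1] `*` `[0, 1], continuous h},
          forall t, t \in `[0, 1] -> h (0, t) = gamma t,
          forall t, t \in `[0, 1] -> h (1, t) = gamma 0 &
          forall s, s \in `[0, 1] -> h (s, 0) = gamma 0 /\ h (s, 1) = gamma 0]).

(* The Lie algebra of [G] is carried by ['cV[R]_n], identified with the tangent
   space at 1 through a chart around 1. *)
Section lie_algebra.
Context {R : realType} {n : nat} (G : lieGroupType R n).

Definition chart1 : chart R n G := s2val (cid2 (@atlas_cover R n G 1%g)).

Definition Ad (g : G) (v : 'cV[R]_n) : 'cV[R]_n :=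
  'D_v (fun y => chart1 (g * cinv chart1 y * g^-1)%g) (chart1 1%g).

(* [ad X Y], the derivative at 1 of [fun g => Ad g Y] in the direction [X] *)
Definition lie_bracket (X Y : 'cV[R]_n) : 'cV[R]_n :=
  'D_X (fun x => Ad (cinv chart1 x) Y) (chart1 1%g).

Definition lie_ideal (I : {vspace 'cV[R]_n}) : Prop :=
  forall X Y, Y \in I -> lie_bracket X Y \in I.

Definition lie_derived (U : {vspace 'cV[R]_n}) : {vspace 'cV[R]_n} :=
  <<[seq lie_bracket X Y | X <- vbasis U, Y <- vbasis U]>>%VS.

Definition lie_solvable (U : {vspace 'cV[R]_n}) : Prop :=
  exists k, iter k lie_derived U = 0%VS.

Definition semisimple : Prop :=
  forall I, lie_ideal I -> lie_solvable I -> I = 0%VS.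

Definition ad_diagonalizable (X : 'cV[R]_n) : Prop :=
  exists2 P : 'M[R]_n, P \in unitmx &
    forall j, exists l : R, lie_bracket X (col j P) = l *: col j P.

Definition split_abelian (A : {vspace 'cV[R]_n}) : Prop :=
  (forall X Y, X \in A -> Y \in A -> lie_bracket X Y = 0) /\
  (forall X, X \in A -> ad_diagonalizable X).

(* the dimension of a maximal R-split Cartan subspace *)
Definition real_rank : nat :=
  \big[maxn/0%N]_(k < n.+1 |
    `[< exists2 A, split_abelian A & \dim A = k >]) k.

End lie_algebra.

Section group_notions.
Context {R : realType} {n : nat} (G : lieGroupType R n).

Definition is_subgroup (K : set G) : Prop :=
  [/\ K 1%g, forall x y, K x -> K y -> K (x * y)%g & forall x, K x -> K x^-1%g].

Definition is_normal (K : set G) : Prop :=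
  forall g x, K x -> K (g * x * g^-1)%g.

(* For a connected semisimple group, a nontrivial compact connected normal
   subgroup is exactly a product of compact simple factors. *)
Definition no_compact_factors : Prop :=
  forall K : set G, is_subgroup K -> is_normal K -> connected K -> compact K ->
    K = [set 1%g].

Definition group_center : set G := [set z | forall g, (z * g = g * z)%g].

(* The commutator subgroup is taken in the algebraic sense. *)
Definition perfect : Prop :=
  forall K : set G, is_subgroup K -> (forall x y, K [~ x, y]%g) -> K = setT.

End group_notions.

Arguments group_center {R n} G.
Arguments perfect {R n} G.
Arguments no_compact_factors {R n} G.
Arguments semisimple {R n} G.
Arguments real_rank {R n} G.

Section representation.
Context {R : realType} {n N : nat} {G : lieGroupType R n} (rho : sl_rep N G).

Definition subrep (W : {vspace 'cV[R]_N}) : Prop :=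
  forall g w, w \in W -> rho g *m w \in W.

Definition irreducible_subrep (W : {vspace 'cV[R]_N}) : Prop :=
  [/\ subrep W, W <> 0%VS &
      forall W', subrep W' -> (W' <= W)%VS -> W' = 0%VS \/ W' = W].

Definition acts_trivially (W : {vspace 'cV[R]_N}) : Prop :=
  forall g w, w \in W -> rho g *m w = w.

Definition irreducible_decomposition (k : nat)
    (W : 'I_k -> {vspace 'cV[R]_N}) : Prop :=
  [/\ forall i, irreducible_subrep (W i), directv (\sum_i W i)%VS &
      (\sum_i W i)%VS = fullv].

Definition no_trivial_constituent : Prop :=
  exists (k : nat) (W : 'I_k -> {vspace 'cV[R]_N}),
    irreducible_decomposition W /\ forall i, ~ acts_trivially (W i).

Definition symplectic_contribution : Prop :=
  exists omega : 'cV[R]_N -> 'cV[R]_N -> R,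
    [/\ (forall w, scalar (omega w)) /\ (forall w, scalar (omega^~ w)),
        forall w1 w2, omega w1 w2 = - omega w2 w1,
        exists w1 w2, omega w1 w2 <> 0 &
        forall g w1 w2, omega (rho g *m w1) (rho g *m w2) = omega w1 w2].

End representation.

Section central_extension.
Context {R : realType} {d n : nat} {H : lieGroupType R d} {S : lieGroupType R n}.

Definition lie_morphism (theta : H -> S) : Prop :=
  {morph theta : x y / (x * y)%g >-> (x * y)%g} /\ smooth_map theta.

Definition hom_kernel (theta : H -> S) : set H := theta @^-1` [set 1%g].

Definition central_extension (theta : H -> S) : Prop :=
  [/\ lie_morphism theta, forall s, exists h, theta h = s &
      hom_kernel theta `<=` group_center H].

Definition perfect_central_extension (theta : H -> S) : Prop :=
  central_extension theta /\ perfect H.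

End central_extension.

(* Main.v *)
(* An invariant symplectic form [omega] is the datum of a Heisenberg-type
   extension of [G_rho] by [R], with cocycle [omega (rho g2^-1 x1) x2]. It is
   perfect: commutators of vectors fill the center, the vectors
   [rho g v - v] span [R^N] as there are no trivial constituents, and [G] is
   perfect since its Lie algebra is.

   Conversely let [theta : H -> G_rho] be a perfect central extension. A
   countability argument shows that the differential [dtheta] is surjective;
   its kernel is then fixed by [Ad H], so that the Lie algebra [g] of [G] acts
   on the Lie algebra [h] of [H]. Complete reducibility, in the form of a
   Reynolds operator built from Casimir elements, turns a nonzero element of
   [ker dtheta] into a functional [p] on [h] that does not kill it and is
   invariant under [g]. The form [p [v, w]] descends to an invariant alternating
   form on [R^N]. If that form vanishes, then [p] kills all brackets and
   integrates to a local homomorphism from [H] to [R]; since [H] is perfect and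
   second countable, this has countable range, a contradiction. Hence without a
   symplectic contribution [dtheta] is bijective, and lifting null homotopies
   from the simply connected group [G_rho] shows that [theta] is injective. *)
Require Import Defs.
From HB Require Import structures.
From mathcomp Require Import all_boot all_order perm all_algebra.
From mathcomp Require Import all_classical all_reals all_analysis.
From mathcomp Require Import complex.
From mathcomp Require Import ring lra.

Set Implicit Arguments.
Unset Strict Implicit.
Unset Printing Implicit Defensive.

Import Order.TTheory GRing.Theory Num.Theory.
Import numFieldNormedType.Exports.

Local Open Scope ring_scope.

(** * Cartan's criterion and Casimir operators *)

(** The extension group [H] is not assumed connected, so statements about its Lie algebra do not
    integrate over it. Connectedness is available only on [G] and [G_rho]: functions of [H] are
    compared with functions of [G_rho] through the central kernel, and second countability bridges
    the remaining gap, since a continuous real function with countable range on a connected space is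
    constant. Exponentials and flows are replaced by first-order calculus at the identity: a
    function all of whose translates have zero derivative at 1 is locally constant, local preimages
    come from a contraction, and a functional killing brackets is integrated as a closed
    left-invariant one-form. No Levi splitting of [h] is built: [ad] factors through [dtheta], so
    composing it with any linear section of [dtheta] over [g] already gives a representation of [g].
    Only a projection onto the invariants of this representation is wanted, and a minimality
    argument with Casimir elements, resting on Cartan's criterion, stands in for Weyl's theorem. *)

Section interpolation.
Variable F : fieldType.
Implicit Types (P Q : {poly F}) (s : seq F) (f g : F -> F).

(** If the eigenvalues of a matrix lie in [s] with multiplicities at most [N], such a [P] acts on
    the generalized eigenspace of [mu] as the scalar [f mu]. *)
Definition pcongr (N : nat) s P f :=
  forall mu, mu \in s -> ('X - mu%:P) ^+ N %| P - (f mu)%:P.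

Lemma coprime_XsubC_exp (mu nu : F) N : mu != nu ->
  coprimep (('X - mu%:P) ^+ N) (('X - nu%:P) ^+ N).
Proof.
move=> munu; rewrite coprimep_expl // coprimep_expr //.
by rewrite coprimep_XsubC root_XsubC eq_sym.
Qed.

Lemma coprimep_prod_XsubC (mu : F) s N : mu \notin s ->
  coprimep (('X - mu%:P) ^+ N) (\prod_(nu <- s) ('X - nu%:P) ^+ N).
Proof.
elim: s => [|nu s IHs]; first by rewrite big_nil coprimep1.
rewrite inE negb_or => /andP[munu /IHs cop].
by rewrite big_cons coprimepMr cop andbT coprime_XsubC_exp.
Qed.

(** Chinese remainder theorem for the pairwise coprime moduli [('X - mu%:P) ^+ N], adding one point
    of [s] at a time. *)
Lemma interpolation N s f : uniq s -> exists P, pcongr N s P f.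
Proof.
elim: s => [|mu s IHs] /=; first by exists 0.
move=> /andP[mus /IHs[P PP]].
have /Bezout_eq1_coprimepP[[u w] /= uw] := coprimep_prod_XsubC N mus.
set A := ('X - mu%:P) ^+ N in uw; set B := \prod_(nu <- s) _ in uw.
(* [w * B] is 1 modulo the new modulus and 0 modulo the old ones, so the correction acts only at
   [mu]. *)
exists (P + ((f mu)%:P - P) * (w * B)) => nu; rewrite inE => /predU1P[->|nus].
  have -> : P + ((f mu)%:P - P) * (w * B) - (f mu)%:P = (P - (f mu)%:P) * (1 - w * B) by ring.
  have -> : 1 - w * B = u * A by rewrite -uw; ring.
  by rewrite mulrA dvdp_mull.
rewrite addrAC dvdp_add ?PP // mulrA dvdp_mull // /B (big_rem nu) //=.
by rewrite dvdp_mulr.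
Qed.

Lemma pcongrM N s P Q f g : pcongr N s P f -> pcongr N s Q g ->
  pcongr N s (P * Q) (fun x => f x * g x).
Proof.
move=> PP QQ mu mus; rewrite polyCM.
have -> : P * Q - (f mu)%:P * (g mu)%:P =
  (P - (f mu)%:P) * Q + (f mu)%:P * (Q - (g mu)%:P) by ring.
by rewrite dvdp_add //; [exact/dvdp_mulr/PP|exact/dvdp_mull/QQ].
Qed.

Lemma pcongrB N s P Q f g : pcongr N s P f -> pcongr N s Q g ->
  pcongr N s (P - Q) (fun x => f x - g x).
Proof.
move=> PP QQ mu mus; rewrite polyCB.
have -> : P - Q - ((f mu)%:P - (g mu)%:P) =
  (P - (f mu)%:P) - (Q - (g mu)%:P) by ring.
by rewrite dvdp_sub //; [exact: PP|exact: QQ].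
Qed.

Lemma pcongrC N s (a : F) : pcongr N s a%:P (fun=> a).
Proof. by move=> mu _; rewrite subrr dvdp0. Qed.

Lemma pcongr_sum N s (I : Type) (r : seq I) (P : I -> {poly F}) (f : I -> F -> F) :
  (forall i, pcongr N s (P i) (f i)) ->
  pcongr N s (\sum_(i <- r) P i) (fun x => \sum_(i <- r) f i x).
Proof.
move=> PP mu mus; rewrite rmorph_sum -sumrB /=.
by elim/big_rec: _ => [|i Q _ dQ]; rewrite ?dvdp0 // dvdp_add // PP.
Qed.

Lemma pcongr0_dvd N s P f : uniq s -> pcongr N s P f -> {in s, forall x, f x = 0} ->
  \prod_(nu <- s) ('X - nu%:P) ^+ N %| P.
Proof.
elim: s => [|mu s IHs] /=; first by rewrite big_nil dvd1p.
move=> /andP[mus us] PP f0; rewrite big_cons.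
rewrite Gauss_dvdp; last exact: coprimep_prod_XsubC.
apply/andP; split.
  by have := PP mu (mem_head _ _); rewrite f0 ?mem_head // polyC0 subr0.
apply: IHs => // [nu nus|nu nus]; first by apply: PP; rewrite inE nus orbT.
by apply: f0; rewrite inE nus orbT.
Qed.

End interpolation.

(** * Eigenvalues, nilpotents and idempotents *)

Section matrix_facts.
Variable C : numClosedFieldType.
Variable n : nat.
Implicit Types A B M x : 'M[C]_n.+1.

(** The size [n.+1] bounds all multiplicities, so that interpolation can use one exponent for all
    eigenvalues. *)
Lemma char_poly_roots x : exists2 s : seq C, uniq s &
  char_poly x %| \prod_(nu <- s) ('X - nu%:P) ^+ n.+1.
Proof.
have [r xr] := closed_field_poly_normal (char_poly x).
have := char_poly_monic x; rewrite monicE => /eqP lc1.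
rewrite lc1 scale1r in xr.
have szr : size r = n.+1.
  by have := size_char_poly x; rewrite xr size_prod_XsubC => -[].
exists (undup r); first exact: undup_uniq.
rewrite xr; rewrite (eq_bigr (fun z => ('X - z%:P))) //.
rewrite -(prodr_undup_exp_count r xpredT (fun z => 'X - z%:P)).
rewrite big_seq [in X in _ %| X]big_seq.
elim/big_ind2: _ => [||nu nur]; first exact: dvdpp.
  by move=> p1 p2 q1 q2; exact: dvdp_mul.
by apply: dvdp_exp2l; rewrite -szr count_size.
Qed.

Lemma nilpotent_trace0 M k : M ^+ k = 0 -> \tr M = 0.
Proof.
move=> Mk; have [r xr] := closed_field_poly_normal (char_poly M).
have := char_poly_monic M; rewrite monicE => /eqP lc1.
rewrite lc1 scale1r in xr.
have r0 : all (pred1 0) r.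
  apply/allP => z zr; have : root (char_poly M) z by rewrite xr root_prod_XsubC.
  rewrite -eigenvalue_root_char => /eigenvalueP[v vM v0].
  have vk j : v *m M ^+ j = z ^+ j *: v.
    elim: j => [|j IHj]; first by rewrite expr0 mulmx1 expr0 scale1r.
    by rewrite exprSr -[_ * M]/(_ *m M) mulmxA IHj -scalemxAl vM scalerA -exprSr.
  have := vk k; rewrite Mk mulmx0 => /esym/eqP; rewrite scaler_eq0 (negPf v0) orbF.
  by rewrite expf_eq0 => /andP[_ /eqP ->] /=.
have := char_poly_trace M; rewrite xr.
have -> : r = nseq (size r) 0 by apply/all_pred1P.
have szr : size r = n.+1.
  by have := size_char_poly M; rewrite xr size_prod_XsubC => -[].
rewrite szr big_nseq polyC0 subr0 iter_mulr mulr1 coefXn /= ltn_eqF //.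
by move=> /(_ isT)/esym/eqP; rewrite oppr_eq0 => /eqP.
Qed.

(** In a rank factorization [M = C *m R], idempotence forces [R *m C = 1], and the trace becomes
    that of an identity matrix whose size is the rank. *)
Lemma idempotent_trace M : M * M = M -> \tr M = (\rank M)%:R.
Proof.
move=> MM; have fr : row_base M *m col_base M = 1%:M.
  have [B BB] := row_freeP (row_base_free M).
  have [A AA] := row_fullP (col_base_full M).
  have : col_base M *m row_base M *m (col_base M *m row_base M) =
      col_base M *m row_base M by rewrite mulmx_base.
  move: (col_base M) (row_base M) A B AA BB => Cb Rb A B AA BB.
  move=> /(congr1 (fun Z => A *m Z *m B)).
  have -> : A *m (Cb *m Rb) = Rb by rewrite mulmxA AA mul1mx.
  rewrite BB (mulmxA A) (_ : A *m (Cb *m Rb) = Rb); last by rewrite mulmxA AA mul1mx.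
  by rewrite -mulmxA -(mulmxA Cb) BB mulmx1.
by rewrite -{1}(mulmx_base M) mxtrace_mulC fr mxtrace1.
Qed.

End matrix_facts.

(** * A trace criterion for nilpotency *)

Section trace_criterion.
Variable C : numClosedFieldType.
Variable n : nat.
Implicit Types A B M v : 'M[C]_n.+1.
Variable x : 'M[C]_n.+1.

(** [nn.+1] is convertible to [n.+1 * n.+1], so operators on matrices flattened by [mxvec] live in a
    matrix ring. *)
Local Notation nn := (n + n * n.+1)%N.

Definition adx : 'M[C]_nn.+1 := lin_mx (mulmx x) - lin_mx (mulmxr x).

Let vec v : 'rV[C]_nn.+1 := mxvec v.

Lemma adxE v : vec v *m adx = vec (x * v - v * x).
Proof.
have E (f : {linear 'M[C]_n.+1 -> 'M[C]_n.+1}) :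
  vec v *m (lin_mx f : 'M[C]_nn.+1) = vec (f v).
  by have H := mul_vec_lin f v; exact H.
rewrite /adx mulmxBr (E (mulmx x)) (E (mulmxr x)) /vec linearB.
by [].
Qed.

Let mv : {linear 'M[C]_n.+1 -> 'rV[C]_(n.+1 * n.+1)} := mxvec.
Let vec0 : vec 0 = 0. Proof. exact: (linear0 mv). Qed.
Let vecD v w : vec (v + w) = vec v + vec w. Proof. exact: (linearD mv). Qed.
Let vecB v w : vec (v - w) = vec v - vec w. Proof. exact: (linearB mv). Qed.
Let vecZ a v : vec (a *: v) = a *: vec v. Proof. exact: (linearZ_LR mv). Qed.
Let vec_sum (s : seq C) (f : C -> 'M[C]_n.+1) :
  vec (\sum_(i <- s) f i) = \sum_(i <- s) vec (f i).
Proof. exact: (linear_sum mv). Qed.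

Lemma vec_inj v w : vec v = vec w -> v = w.
Proof. exact: (can_inj (@mxvecK C n.+1 n.+1)). Qed.

Variable E : 'M[C]_n.+1 -> Prop.
Hypotheses (E0 : E 0) (ED : forall v w, E v -> E w -> E (v + w))
  (EZ : forall a v, E v -> E (a *: v)) (Ead : forall v, E v -> E (x * v - v * x)).

Lemma adx_poly_stable (P : {poly C}) v : E v ->
  exists2 w, E w & vec v *m horner_mx adx P = vec w.
Proof.
move=> Ev; elim/poly_ind: P => [|P a [w Ew vP]].
  by exists 0 => //; rewrite rmorph0 mulmx0 vec0.
exists (x * w - w * x + a *: v); first by apply: ED; [exact: Ead|exact: EZ].
rewrite rmorphD rmorphM /= horner_mx_X horner_mx_C mulmxDr.
rewrite -[_ * adx]/(_ *m adx) mulmxA vP adxE.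
by rewrite mul_mx_scalar (vecD (x * w - w * x)) vecZ.
Qed.

(** Left multiplication by [x - p] and right multiplication by [x - q] commute, and their difference
    is [ad x - (p - q)]. In its power [a + b] each term contains the former at least [a] times or
    the latter at least [b] times. *)
Lemma adx_generalized (p q : C) a b v :
  (x - p%:M) ^+ a * v = 0 -> v * (x - q%:M) ^+ b = 0 ->
  vec v *m (adx - (p - q)%:M) ^+ (a + b) = 0.
Proof.
move Es : (a + b)%N => s; elim: s a b Es v => [|s IHs] a b.
  move=> /eqP; rewrite addn_eq0 => /andP[/eqP -> _] v.
  by rewrite !expr0 mul1r mulmx1 => -> _; rewrite vec0.
have step v : vec v *m (adx - (p - q)%:M) = vec ((x - p%:M) * v - v * (x - q%:M)).
  rewrite mulmxBr adxE mul_mx_scalar -vecZ -vecB; congr vec.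
  rewrite mulrBl mulrBr -![_%:M * v]/(_%:M *m v) -![v * _%:M]/(v *m _%:M).
  rewrite mul_scalar_mx mul_mx_scalar; move: (x * v) (v * x) => X Y.
  by apply/matrixP => i j; rewrite !mxE; ring.
case: a => [|a]; first by move=> _ v; rewrite expr0 mul1r => -> _; rewrite vec0 mul0mx.
case: b => [|b]; first by move=> _ v _; rewrite expr0 mulr1 => ->; rewrite vec0 mul0mx.
move=> abs v va vb; rewrite exprS -[_ * _ ^+ s]/(_ *m _ ^+ s) mulmxA step.
rewrite vecB mulmxBl.
have e1 : (a + b.+1 = s)%N by apply: succn_inj; rewrite -abs addSn.
have e2 : (a.+1 + b = s)%N by apply: succn_inj; rewrite -abs addnS.
have v1 : (x - p%:M) ^+ a * ((x - p%:M) * v) = 0 by rewrite mulrA -exprSr.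
have v2 : (x - p%:M) * v * (x - q%:M) ^+ b.+1 = 0 by rewrite -mulrA vb mulr0.
have v3 : (x - p%:M) ^+ a.+1 * (v * (x - q%:M)) = 0 by rewrite mulrA va mul0r.
have v4 : v * (x - q%:M) * (x - q%:M) ^+ b = 0 by rewrite -mulrA -exprS.
by rewrite (IHs a b.+1 e1 _ v1 v2) (IHs a.+1 b e2 _ v3 v4) subr0.
Qed.

Lemma vec_scalar_horner (P : {poly C}) (mu a : C) N v :
  ('X - mu%:P) ^+ N %| P - a%:P -> vec v *m (adx - mu%:M) ^+ N = 0 ->
  vec v *m horner_mx adx P = vec (a *: v).
Proof.
move=> /dvdpP[Q PQ] v0; rewrite -(subrK a%:P P) PQ mulrC rmorphD rmorphM rmorphXn.
rewrite rmorphB /= horner_mx_X !horner_mx_C mulmxDr.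
rewrite -[_ ^+ N * _]/(_ ^+ N *m _) mulmxA v0 mul0mx add0r.
by rewrite mul_mx_scalar vecZ.
Qed.

(* Applied to [D = q x], where [q] interpolates complex conjugation on the
   eigenvalues of [x], so that [tr (x D)] is a sum of squared moduli. *)
Lemma nilpotent_trace_criterion :
  (forall D, (forall v, E v -> E (D * v - v * D)) -> \tr (x * D) = 0) ->
  exists N, x ^+ N = 0.
Proof.
move=> trE; set N := n.+1.
have [s us xs] := char_poly_roots x; rewrite -/N in xs.
have zero P f : pcongr N s P f -> {in s, forall z, f z = 0} -> horner_mx x P = 0.
  move=> PP f0; have /dvdpP[Q ->] := dvdp_trans xs (pcongr0_dvd us PP f0).
  by rewrite rmorphM /= Cayley_Hamilton mulr0.
have eqh P Q f : pcongr N s P f -> pcongr N s Q f -> horner_mx x P = horner_mx x Q.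
  move=> PP QQ; apply/eqP; rewrite -subr_eq0 -rmorphB /=; apply/eqP.
  by apply: zero (pcongrB PP QQ) _ => z _; rewrite subrr.
(* [e i] interpolates the indicator of [i], so that [Ei i] is the projector onto the generalized
   eigenspace of [i]. *)
pose dl (i z : C) : C := (z == i)%:R.
have /choice[e eP] : forall i, exists P, pcongr N s P (dl i).
  by move=> i; exact: interpolation.
have [q qP] := interpolation N (fun z => z^*) us.
pose Ei i := horner_mx x (e i); pose D := horner_mx x q.
have sumE : \sum_(i <- s) Ei i = 1.
  rewrite /Ei -rmorph_sum /=; have := pcongr_sum s eP.
  have one : pcongr N s 1%:P (fun z => \sum_(i <- s) dl i z).
    move=> z zs; have := @pcongrC _ N s (1 : C) z zs; rewrite (_ : \sum_(i <- s) _ = 1) //.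
    rewrite (bigD1_seq z) //= /dl eqxx big1 ?addr0 // => i /negPf iz.
    by rewrite eq_sym iz.
  by move=> /(eqh _ _ _)/(_ one) ->; rewrite rmorph1.
have ee i : Ei i * Ei i = Ei i.
  rewrite /Ei -rmorphM /=; apply: eqh (pcongrM (eP i) (eP i)) _ => z zs.
  have := eP i z zs; rewrite /dl; case: (z == i); by rewrite ?mulr1 ?mulr0.
have DE i : D * Ei i = i^* *: Ei i.
  rewrite -mul_scalar_mx -[_ *m _]/(_ * _) -(horner_mx_C x) /D /Ei -!rmorphM /=.
  have := pcongrM (@pcongrC _ N s i^*) (eP i); apply: eqh.
  move=> z zs; have := pcongrM qP (eP i) zs; rewrite /= /dl.
  by case: eqP => [->//|_]; rewrite !mulr0.
have ED' i : Ei i * D = i^* *: Ei i by rewrite -DE /Ei /D -!rmorphM mulrC.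
have xE i : i \in s -> (x - i%:M) ^+ N * Ei i = 0.
  move=> is_; have -> : (x - i%:M) ^+ N = horner_mx x (('X - i%:P) ^+ N).
    by rewrite rmorphXn rmorphB /= horner_mx_X horner_mx_C.
  rewrite /Ei -rmorphM /=; apply: (@zero _ (fun=> 0)) => // z zs.
  rewrite polyC0 subr0; have [->|zi] := eqVneq z i; first exact: dvdp_mulr.
  by apply: dvdp_mull; have := eP i z zs; rewrite /dl (negPf zi) polyC0 subr0.
have Ex i : i \in s -> Ei i * (x - i%:M) ^+ N = 0.
  move=> is_; rewrite -(xE i is_); have -> : (x - i%:M) ^+ N = horner_mx x (('X - i%:P) ^+ N).
    by rewrite rmorphXn rmorphB /= horner_mx_X horner_mx_C.
  by rewrite /Ei -!rmorphM /= mulrC.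
pose s2 := undup [seq i - j | i <- s, j <- s].
(* Conjugation is additive, so the value prescribed to [P] at [i - j] is the difference of those
   prescribed to [q] at [i] and [j]. Hence [ad D] is the polynomial [P] in [ad x], and it preserves
   [E]. *)
have [P PP] := interpolation (N + N) (fun z => z^*) (undup_uniq [seq i - j | i <- s, j <- s]).
have adD v : vec v *m horner_mx adx P = vec (D * v - v * D).
  have vE : v = \sum_(i <- s) \sum_(j <- s) Ei i * v * Ei j.
    under eq_bigr do rewrite -mulr_sumr sumE mulr1.
    by rewrite -mulr_suml sumE mul1r.
  rewrite [in LHS]vE [in RHS]vE mulr_sumr mulr_suml -sumrB !vec_sum mulmx_suml /=.
  rewrite big_seq [RHS]big_seq; apply: eq_bigr => i is_.
  rewrite mulr_sumr mulr_suml -sumrB !vec_sum mulmx_suml /=.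
  rewrite big_seq [RHS]big_seq; apply: eq_bigr => j js.
  rewrite (@vec_scalar_horner _ (i - j) (i - j)^* (N + N)).
  - rewrite !mulrA DE -!mulrA ED' rmorphB /=; congr vec.
    by rewrite scalerBl -scalerAl -!scalerAr.
  - by apply: PP; rewrite mem_undup; apply/allpairsP; exists (i, j).
  - by apply: adx_generalized; [rewrite !mulrA xE // !mul0r|rewrite -!mulrA Ex // !mulr0].
have stD v : E v -> E (D * v - v * D).
  by move=> Ev; have [w Ew] := adx_poly_stable P Ev; rewrite adD => /vec_inj ->.
have := trE D stD.
have -> : x * D = \sum_(i <- s) (i^* *: (x * Ei i)).
  rewrite -[D]mulr1 -sumE !mulr_sumr; apply: eq_bigr => i _.
  by rewrite DE -scalerAr.
(* On the generalized eigenspace of [i], [x - i] is nilpotent and contributes nothing to the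
   trace. *)
have trx i : i \in s -> \tr (x * Ei i) = i * (\rank (Ei i))%:R.
  move=> is_; rewrite -[x in x * _](subrK i%:M) mulrDl mxtraceD.
  have cEx : GRing.comm (x - i%:M) (Ei i).
    rewrite /GRing.comm; have -> : x - i%:M = horner_mx x ('X - i%:P).
      by rewrite rmorphB /= horner_mx_X horner_mx_C.
    by rewrite /Ei -!rmorphM /= mulrC.
  rewrite (@nilpotent_trace0 _ _ _ N) ?add0r.
    by rewrite -[_%:M * _]/(_%:M *m _) mul_scalar_mx mxtraceZ idempotent_trace // ee.
  rewrite exprMn_comm // (_ : Ei i ^+ N = Ei i); first exact: xE.
  have eek k : Ei i ^+ k.+1 = Ei i by elim: k => [|k IHk]; rewrite ?expr1 // exprS IHk ee.
  exact: eek.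
rewrite raddf_sum /= big_seq => /eqP.
rewrite (eq_bigr (fun i => `|i| ^+ 2 * (\rank (Ei i))%:R)); last first.
  by move=> i is_; rewrite mxtraceZ trx // normCKC mulrA.
rewrite psumr_eq0 => [/allP H|i _]; last by rewrite mulr_ge0 ?exprn_ge0.
exists N; rewrite -[LHS]mulr1 -sumE mulr_sumr big_seq big1 // => i is_.
have := H i is_; rewrite is_ /= mulf_eq0 expf_eq0 normr_eq0 pnatr_eq0 mxrank_eq0 /=.
move=> /orP[/eqP i0|/eqP ->]; last by rewrite mulr0.
by have := xE i is_; rewrite {1}i0 raddf0 subr0.
Qed.

End trace_criterion.

(** * Engel's theorem through vanishing products *)

Section engel.
Variables (F : fieldType) (n : nat).
Local Notation M := 'M[F]_n.+1.
Implicit Types (T L : {vspace M}) (x y t z : M) (w u v : seq M).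

Local Notation pr w := (\prod_(a <- w) a).

(** Nilpotency of the associative algebra without unit generated by [T]. Engel's theorem is proved
    in this form instead of producing a common kernel vector. *)
Definition nil_words T m := forall w, (m <= size w)%N -> all [in T] w -> pr w = 0.

(** Otherwise one could bracket [y] with suitable elements of [T] forever without entering [T].
    After [2m] brackets the result is a sum of words with [2m] letters of [T] around [y]; one side
    has at least [m] of them, so the result is 0, which lies in [T]. *)
Lemma subalgebra_normalizer L T m y : nil_words T m -> (T <= L)%VS ->
  (forall x t, x \in L -> t \in T -> x * t - t * x \in L) ->
  y \in L -> y \notin T ->
  exists x, [/\ x \in L, x \notin T & forall t, t \in T -> x * t - t * x \in T].
Proof.
move=> Tm TL brL yL yT; apply: contrapT => H.
have {}H x : x \in L -> x \notin T -> exists2 t, t \in T & x * t - t * x \notin T.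
  move=> xL xT; apply: contrapT => H'; apply: H; exists x; split=> // t tT.
  by apply: contrapT => xt; apply: H'; exists t => //; exact/negP.
have [k] : exists k, (k = m + m)%N by exists (m + m)%N.
move=> km.
(* Each of the [j] brackets already taken counts as one letter of [T]. *)
suff Y j : (j <= k)%N -> exists z, [/\ z \in L, z \notin T & forall u v,
    all [in T] u -> all [in T] v -> (k <= size u + size v + j)%N ->
    pr u * z * pr v = 0].
  have [z [_ + /(_ [::] [::])]] := Y k (leqnn k).
  by rewrite big_nil mul1r mulr1 => + /(_ isT isT (leqnn _)) z0; rewrite z0 mem0v.
elim: j => [_|j IHj jk].
  exists y; split=> // u v uT vT; rewrite addn0 km => uv.
  have [mu|um] := leqP m (size u); first by rewrite (Tm u) // !mul0r.
  rewrite (Tm v) ?mulr0 // -(leq_add2l m); apply: leq_trans uv _.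
  by rewrite leq_add2r ltnW.
have [z [zL zT zP]] := IHj (ltnW jk); have [t tT zt] := H z zL zT.
exists (z * t - t * z); split=> // [|u v uT vT kuv]; first exact: brL.
rewrite mulrBr mulrBl.
have -> : pr u * (z * t) * pr v = pr u * z * pr (t :: v).
  by rewrite big_cons !mulrA.
have -> : pr u * (t * z) * pr v = pr (rcons u t) * z * pr v.
  by rewrite -cats1 big_cat big_seq1 /= !mulrA.
rewrite !zP ?subrr //= ?all_rcons ?tT ?uT //= ?size_rcons.
- by rewrite addnS addSnnS.
- by rewrite addSn addSnnS.
Qed.

(** Moving [x] across a letter of [T] creates only another letter of [T]. A long word in [T] and [x]
    has either [m] letters of [T] or, by the pigeonhole principle, a run of [k] letters [x]. *)
Lemma nil_words_extend T m x k : nil_words T m -> x ^+ k = 0 ->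
  (forall t, t \in T -> x * t - t * x \in T) -> nil_words (T + <[x]>) (m * k).
Proof.
move=> Tm xk xT.
pose a w := count [in T] w.
pose TX w := all (fun y => (y \in T) || (y == x)) w.
(* Seen from the left, [z] counts as [j] letters of [T]. *)
pose Z j z := forall u, all [in T] u -> (m <= size u + j)%N -> pr u * z = 0.
have Zx j z : Z j z -> Z j (x * z).
  move=> Zz; suff H u v : all [in T] u -> all [in T] v ->
      (m <= size u + size v + j)%N -> pr u * x * pr v * z = 0.
    by move=> u uT mu; have := H u [::] uT isT; rewrite big_nil mulr1 addn0 mulrA; exact.
  elim/last_ind: u v => [|u t IHu] v.
    move=> _ vT mv; rewrite big_nil mul1r -mulrA Zz ?mulr0 //.
  rewrite all_rcons => /andP[tT uT] vT; rewrite size_rcons => mv.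
  have E : pr (rcons u t) * x = pr u * x * t - pr u * (x * t - t * x).
    by rewrite -cats1 big_cat big_seq1 /= mulrBr opprB addrCA !mulrA subrr addr0.
  rewrite E !mulrBl.
  have -> : pr u * x * t * pr v * z = pr u * x * pr (t :: v) * z.
    by rewrite big_cons !mulrA.
  rewrite IHu //=; last 2 first.
  - by rewrite tT.
  - by rewrite addnS -addSn.
  rewrite sub0r -[_ * _ * pr v * z]mulrA -mulrA.
  have -> : pr u * ((x * t - t * x) * (pr v * z)) = pr (u ++ (x * t - t * x) :: v) * z.
    by rewrite big_cat big_cons /= !mulrA.
  rewrite Zz ?oppr0 // ?all_cat ?uT //= ?vT ?xT //.
  by rewrite size_cat /= addnS -addSn.
have Zt j t z : t \in T -> Z j z -> Z j.+1 (t * z).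
  move=> tT Zz u uT mu; rewrite mulrA.
  have -> : pr u * t = pr (rcons u t) by rewrite -cats1 big_cat big_seq1.
  by apply: Zz; rewrite ?all_rcons ?tT //= size_rcons addSnnS.
have Zw w : TX w -> exists2 j, (a w <= j)%N & Z j (pr w).
  elim: w => [_|y w IHw /= /andP[yTx /IHw[j wj Zj]]].
    by exists 0%N => //= u uT; rewrite addn0 big_nil mulr1 => mu; exact: Tm.
  rewrite big_cons; have [yT|yT] := boolP (y \in T).
    by exists j.+1; [rewrite add1n ltnS|exact: Zt].
  move: yTx; rewrite (negPf yT) /= => /eqP yx.
  by exists j; [rewrite add0n|rewrite yx; exact: Zx].
(* The letters of [T] cut the word into [(a w).+1] runs of [x], the first one lengthened by
   [x ^+ j]; one of the runs reaches length [k]. *)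
have Bw w j : TX w -> ((a w).+1 * k <= j + size w)%N -> x ^+ j * pr w = 0.
  elim: w j => [|y w IHw] j /=.
    by rewrite /a /= mul1n addn0 => _ /subnKC <-; rewrite exprD xk !mul0r.
  move=> /andP[yTx TXw]; rewrite /a /= -/(a w) big_cons.
  have [yT|yT] := boolP (y \in T).
    have [kj|jk] := leqP k j; first by rewrite -(subnKC kj) exprD xk !mul0r.
    rewrite add1n mulSn => H; have := IHw 0%N TXw; rewrite expr0 mul1r => ->.
      by rewrite !mulr0.
    rewrite add0n -(leq_add2l k); apply: leq_trans H _; rewrite -addSnnS.
    by rewrite leq_add2r.
  move: yTx; rewrite (negPf yT) /= => /eqP yx; rewrite add0n addnS -addSn => H.
  by rewrite yx mulrA -exprSr IHw.
have Cw w : TX w -> (m * k <= size w)%N -> pr w = 0.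
  move=> TXw mw; have [ma|am] := leqP m (a w).
    have [j aj Zj] := Zw w TXw; have := Zj [::] isT.
    by rewrite big_nil mul1r add0n; apply; exact: leq_trans ma aj.
  have := Bw w 0%N TXw; rewrite expr0 mul1r; apply.
  by rewrite add0n; apply: leq_trans mw; rewrite leq_mul2r am orbT.
suff G w1 w2 : all [in (T + <[x]>)%VS] w1 -> TX w2 -> (m * k <= size w1 + size w2)%N ->
    pr w1 * pr w2 = 0.
  by move=> w mw wT; have := G w [::] wT isT; rewrite big_nil mulr1 addn0; exact.
elim/last_ind: w1 w2 => [|w1 y IHw] w2.
  by rewrite big_nil mul1r => _ TX2 m2; exact: Cw.
rewrite all_rcons size_rcons => /andP[/memv_addP[t tT [_ /vlineP[c ->] ->]] w1T] TX2 mw.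
rewrite -cats1 big_cat big_seq1 /= mulrDr mulrDl -!mulrA -scalerAl -scalerAr.
rewrite -(big_cons _ _ t w2 xpredT id) -(big_cons _ _ x w2 xpredT id).
rewrite !IHw ?scaler0 ?addr0 //= ?tT ?eqxx ?orbT //.
- by rewrite addnS -addSn.
- by rewrite addnS -addSn.
Qed.

(** A subalgebra of maximal dimension among those whose long words vanish must be all of [L], since
    otherwise an element normalizing it enlarges it. *)
Theorem engel L : (forall x y, x \in L -> y \in L -> x * y - y * x \in L) ->
  (forall x, x \in L -> exists k, x ^+ k = 0) -> exists m, nil_words L m.
Proof.
move=> brL nilL.
pose P d := `[< exists T : {vspace M}, [/\ (T <= L)%VS, \dim T = d,
  forall x y, x \in T -> y \in T -> x * y - y * x \in T & exists m, nil_words T m] >].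
have exP : exists d, P d.
  exists 0%N; apply/asboolP; exists 0%VS; split.
  - exact: sub0v.
  - exact: dimv0.
  - by move=> x y; rewrite !memv0 => /eqP -> /eqP ->; rewrite mulr0 subrr.
  - exists 1%N => -[//|y w] _ /= /andP[]; rewrite memv0 => /eqP -> _.
    by rewrite big_cons mul0r.
have ubP d : P d -> (d <= \dim L)%N by move=> /asboolP[T [TL <- _ _]]; exact: dimvS.
have [d /asboolP[T [TL Td brT [m Tm]]] dmax] := ex_maxnP exP ubP.
have [LT|] := boolP (L <= T)%VS.
  exists m => w mw wL; apply: Tm => //; apply: sub_all wL => x.
  exact: (subvP LT).
move=> /subvPn[y yL yT].
have brTL x t : x \in L -> t \in T -> x * t - t * x \in L.
  by move=> xL tT; apply: brL => //; exact: (subvP TL).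
have [x [xL xT xN]] := subalgebra_normalizer Tm TL brTL yL yT.
have [k xk] := nilL x xL.
have := dmax (\dim (T + <[x]>)).
suff PT : P (\dim (T + <[x]>)).
  move=> /(_ PT); rewrite -Td leqNgt => /negP[].
  rewrite ltn_neqAle dimvS ?addvSl // andbT.
  apply: contra xT => /eqP TE.
  have : (T == T + <[x]>)%VS by rewrite eqEdim addvSl TE leqnn.
  by move=> /eqP ->; rewrite (subvP (addvSr T <[x]>)) ?memv_line.
apply/asboolP; exists (T + <[x]>)%VS; split=> //.
- by rewrite subv_add TL -memvE.
- move=> u v /memv_addP[t tT [_ /vlineP[c ->] ->]] /memv_addP[t' t'T [_ /vlineP[c' ->] ->]].
  have -> : (t + c *: x) * (t' + c' *: x) - (t' + c' *: x) * (t + c *: x) =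
      (t * t' - t' * t) + c *: (x * t' - t' * x) - c' *: (x * t - t * x).
    rewrite !mulrDl !mulrDr -!scalerAl -!scalerAr !scalerBr !scalerA (mulrC c').
    move: (t * t') (t' * t) (t * x) (x * t) (t' * x) (x * t') (x * x) => A B C D E G H.
    by apply/matrixP => i j; rewrite !mxE; ring.
  apply: (subvP (addvSl T _)); apply: rpredB; last by apply: rpredZ; exact: xN.
  by apply: rpredD; [exact: brT|apply: rpredZ; exact: xN].
- by exists (m * k)%N; exact: nil_words_extend.
Qed.

(* Writing elements of [L] as sums of brackets turns vanishing of long words
   into vanishing of short ones. *)
Lemma nil_words_perfect L m (S : M -> Prop) : nil_words L m ->
  (forall x, S x -> x \in L) ->
  (forall P : M -> Prop, P 0 -> (forall x y, P x -> P y -> P (x + y)) ->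
    (forall c x, P x -> P (c *: x)) ->
    (forall x y, S x -> S y -> P (x * y - y * x)) -> forall x, S x -> P x) ->
  forall x, S x -> x = 0.
Proof.
move=> Lm SL Sind.
suff Y j : (j <= m)%N -> forall x, S x -> forall u v, all [in L] u -> all [in L] v ->
    (m - j <= size u + size v)%N -> pr u * x * pr v = 0.
  move=> x Sx; have := Y m (leqnn m) x Sx [::] [::] isT isT.
  by rewrite subnn big_nil mul1r mulr1; exact.
elim: j => [_|j IHj jm] x Sx u v uL vL.
  rewrite subn0 => muv; have xL := SL _ Sx.
  have -> : pr u * x * pr v = pr (u ++ x :: v) by rewrite big_cat big_cons /= mulrA.
  by apply: Lm; [rewrite size_cat /= addnS leqW|rewrite all_cat /= uL xL].
move=> muv; pose Q z := pr u * z * pr v = 0.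
apply: (Sind Q) Sx; rewrite /Q.
- by rewrite mulr0 mul0r.
- by move=> y z y0 z0; rewrite mulrDr mulrDl y0 z0 addr0.
- by move=> c y y0; rewrite -scalerAr -scalerAl y0 scaler0.
move=> y z Sy Sz; have yL := SL _ Sy; have zL := SL _ Sz; rewrite mulrBr mulrBl.
have E a b : pr u * (a * b) * pr v = pr (rcons u a) * b * pr v.
  by rewrite -cats1 big_cat big_seq1 /= !mulrA.
have muv' : (m - j <= (size u).+1 + size v)%N.
  by rewrite addSn -(subnSK jm) ltnS.
by rewrite !E !(IHj (ltnW jm)) ?subrr // ?all_rcons ?yL ?zL ?size_rcons.
Qed.

End engel.

(** * Bilinear brackets on columns and their derived spaces *)

Section lie_bracket_theory.
Variables (R : rcfType) (n : nat) (br : 'cV[R]_n -> 'cV[R]_n -> 'cV[R]_n).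
Hypotheses (brl : forall Y, linear (br^~ Y)) (brr : forall X, linear (br X)).

Local Notation g := 'cV[R]_n.
Implicit Types (X Y Z : g) (U I : {vspace g}).

(** Same formula as [lie_derived] for an arbitrary bracket, so that the solvability condition in
    [semisimple] unfolds to iterates of it. *)
Definition derived U : {vspace g} :=
  <<[seq br X Y | X <- vbasis U, Y <- vbasis U]>>%VS.

Lemma br0l Y : br 0 Y = 0.
Proof. by have := brl Y (-1) 0 0; rewrite scaleN1r oppr0 addr0 scaleN1r addNr. Qed.
Lemma brDl X X' Y : br (X + X') Y = br X Y + br X' Y.
Proof. by have := brl Y 1 X X'; rewrite !scale1r. Qed.
Lemma brZl a X Y : br (a *: X) Y = a *: br X Y.
Proof. by have := brl Y a X 0; rewrite !addr0 br0l addr0. Qed.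
Lemma br0r X : br X 0 = 0.
Proof. by have := brr X (-1) 0 0; rewrite scaleN1r oppr0 addr0 scaleN1r addNr. Qed.
Lemma brDr X Y Y' : br X (Y + Y') = br X Y + br X Y'.
Proof. by have := brr X 1 Y Y'; rewrite !scale1r. Qed.
Lemma brZr a X Y : br X (a *: Y) = a *: br X Y.
Proof. by have := brr X a Y 0; rewrite !addr0 br0r addr0. Qed.
Lemma br_suml (J : Type) (r : seq J) (f : J -> g) Y :
  br (\sum_(i <- r) f i) Y = \sum_(i <- r) br (f i) Y.
Proof. by elim/big_rec2: _ => [|i y x _ <-]; rewrite ?br0l ?brDl. Qed.
Lemma br_sumr (J : Type) (r : seq J) (f : J -> g) X :
  br X (\sum_(i <- r) f i) = \sum_(i <- r) br X (f i).
Proof. by elim/big_rec2: _ => [|i y x _ <-]; rewrite ?br0r ?brDr. Qed.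

Lemma mem_derived U X Y : X \in U -> Y \in U -> br X Y \in derived U.
Proof.
move=> XU YU; rewrite (coord_vbasis XU) (coord_vbasis YU) br_suml.
apply: rpred_sum => i _; rewrite br_sumr; apply: rpred_sum => j _.
rewrite brZl brZr; do 2!apply: rpredZ; apply: memv_span.
by apply/allpairsP; exists ((vbasis U)`_i, (vbasis U)`_j); split=> //=;
  apply: mem_nth; rewrite size_tuple.
Qed.

Lemma derived_ind U (P : g -> Prop) : P 0 ->
  (forall X Y, P X -> P Y -> P (X + Y)) -> (forall a X, P X -> P (a *: X)) ->
  (forall X Y, X \in U -> Y \in U -> P (br X Y)) ->
  forall X, X \in derived U -> P X.
Proof.
move=> P0 PD PZ Pbr X; rewrite /derived; set s := [seq _ | _ <- _, _ <- _].
rewrite -[s]/(val (in_tuple s)) => XU; rewrite (coord_span XU).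
elim/big_ind: _ => // i _; apply: PZ.
have : (in_tuple s)`_i \in s by apply: mem_nth; rewrite [X in (_ < X)%N]size_tuple.
move=> /allpairsP[[Y Z] /= [YU ZU ->]].
by apply: Pbr; exact: vbasis_mem.
Qed.

End lie_bracket_theory.

Section linear_lemmas.
Variables (R : pzRingType) (V W : lmodType R) (f : V -> W).
Hypothesis flin : linear f.
Lemma lin0 : f 0 = 0.
Proof. by have := flin (-1) 0 0; rewrite scaleN1r oppr0 addr0 scaleN1r addNr. Qed.
Lemma linD X Y : f (X + Y) = f X + f Y.
Proof. by have := flin 1 X Y; rewrite !scale1r. Qed.
Lemma linZ a X : f (a *: X) = a *: f X.
Proof. by have := flin a X 0; rewrite !addr0 lin0 addr0. Qed.
Lemma linN X : f (- X) = - f X.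
Proof. by rewrite -scaleN1r linZ scaleN1r. Qed.
Lemma linB X Y : f (X - Y) = f X - f Y.
Proof. by rewrite linD linN. Qed.
Lemma lin_sum (J : Type) (r : seq J) (P : pred J) (h : J -> V) :
  f (\sum_(i <- r | P i) h i) = \sum_(i <- r | P i) f (h i).
Proof. by elim/big_rec2: _ => [|i y x _ <-]; rewrite ?lin0 ?linD. Qed.
End linear_lemmas.

(** * Cartan's criterion for a perfect subalgebra *)

Section cartan_criterion.
Variables (R : rcfType) (n k : nat) (br : 'cV[R]_n -> 'cV[R]_n -> 'cV[R]_n).
Hypotheses (brl : forall Y, linear (br^~ Y)) (brr : forall X, linear (br X)).
Local Notation g := 'cV[R]_n.
Variable t : g -> 'M[R]_k.+1.
Hypotheses (tlin : linear t)
  (tbr : forall X Y, t (br X Y) = t X * t Y - t Y * t X).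
Variable U : {vspace g}.
Hypotheses (Ubr : forall X Y, X \in U -> Y \in U -> br X Y \in U)
  (Uperf : (U <= derived br U)%VS)
  (trU : forall X Y, X \in U -> Y \in U -> \tr (t X * t Y) = 0).

Local Notation C := R[i].
Let rc : {rmorphism R -> C} := real_complex R.
Let cx (A : 'M[R]_k.+1) : 'M[C]_k.+1 := map_mx rc A.

Let cxM A B : cx (A * B) = cx A * cx B. Proof. exact: map_mxM. Qed.
Let cxD A B : cx (A + B) = cx A + cx B. Proof. exact: map_mxD. Qed.
Let cxB A B : cx (A - B) = cx A - cx B. Proof. exact: map_mxB. Qed.
Let cxZ a A : cx (a *: A) = (rc a) *: cx A. Proof. exact: map_mxZ. Qed.

(** The complex span of [t U]: the trace criterion works with eigenvalues, hence over [R[i]]. *)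
Let E (M : 'M[C]_k.+1) := exists A B, [/\ A \in U, B \in U &
  M = cx (t A) + 'i%C *: cx (t B)].

(** On a bracket, [tr ([Y, Z] D) = tr (Y [Z, D])]. Here [[Z, D]] is again in the complex span of
    [t U], so the trace vanishes; perfectness extends this from brackets to all of [U]. *)
Lemma trace_form0_nilpotent X : X \in U -> exists N, t X ^+ N = 0.
Proof.
move=> XU; suff [N xN] : exists N, cx (t X) ^+ N = 0.
  have cxX j : cx (t X ^+ j) = cx (t X) ^+ j.
    by elim: j => [|j IHj]; [exact: map_mx1|rewrite !exprS cxM IHj].
  by exists N; apply: (map_mx_inj (f := rc)); rewrite -/(cx _) cxX xN map_mx0.
apply: (@nilpotent_trace_criterion _ _ _ E).
- by exists 0, 0; rewrite !mem0v (lin0 tlin) /cx map_mx0 scaler0 addr0.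
- move=> v w [A [B [AU BU ->]]] [A' [B' [AU' BU' ->]]].
  exists (A + A'), (B + B'); rewrite !memvD //; split=> //.
  by rewrite !(linD tlin) !cxD scalerDr addrACA.
- move=> a v [A [B [AU BU ->]]].
  exists (complex.Re a *: A - complex.Im a *: B), (complex.Im a *: A + complex.Re a *: B).
  split; [by rewrite memvB ?memvZ|by rewrite memvD ?memvZ|].
  rewrite !(linD tlin) (linN tlin) !(linZ tlin) cxB cxD !cxZ [a in LHS]complexE.
  have ii : 'i%C * 'i%C = -1 :> C by rewrite -expr2 sqr_i.
  rewrite -![_%:C%C]/(rc _); move: (rc _) (rc _) (cx (t A)) (cx (t B)) => u w M1 M2.
  by move: ('i)%C ii => ii0 ii; apply/matrixP => i j; rewrite !mxE; ring: ii.
- move=> _ [A [B [AU BU ->]]]; exists (br X A), (br X B); split; try exact: Ubr.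
  rewrite !tbr !cxB !cxM mulrDr mulrDl -scalerAr -scalerAl scalerBr.
  by rewrite opprD addrACA.
move=> D DE.
have trE Y M : Y \in U -> E M -> \tr (cx (t Y) * M) = 0.
  move=> YU [A [B [AU BU ->]]].
  rewrite mulrDr -scalerAr linearD linearZ /= -!cxM !trace_map_mx !trU //.
  by rewrite rmorph0 mulr0 addr0.
have E_t Y : Y \in U -> E (cx (t Y)).
  by move=> YU; exists Y, 0; rewrite mem0v (lin0 tlin) /cx map_mx0 scaler0 addr0.
apply: (derived_ind (br := br) (U := U)
  (P := fun X => \tr (cx (t X) * D) = 0)); last exact: (subvP Uperf).
- by rewrite (lin0 tlin) /cx map_mx0 mul0r mxtrace0.
- by move=> Y Z HY HZ; rewrite (linD tlin) cxD mulrDl linearD /= HY HZ addr0.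
- by move=> a Y HY; rewrite (linZ tlin) cxZ -scalerAl linearZ /= HY mulr0.
- move=> Y Z YU ZU; rewrite tbr cxB !cxM.
  have := trE Y _ YU (DE _ (E_t _ ZU)).
  rewrite mulrBr mulrBl !linearB /= !mulrA => /subr0_eq trDZ.
  rewrite -[_ * cx (t Y) * D]mulrA [\tr (cx (t Z) * _)]mxtrace_mulC.
  by rewrite -[in X in _ - X]mulmxE trDZ subrr.
Qed.

(** By Engel the nilpotent matrices [t X] have vanishing long products, and in a perfect algebra
    every element can be replaced by brackets, which lengthens products. *)
Lemma trace_form0_perfect0 X : X \in U -> t X = 0.
Proof.
have [f fE] : exists f : {linear g -> 'M[R]_k.+1}, forall Y, f Y = t Y.
  pose lM := GRing.isLinear.Build _ _ _ _ _ tlin.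
  by pose f : {linear g -> 'M[R]_k.+1} := HB.pack t lM; exists f.
pose L := (linfun f @: U)%VS.
have LP x : x \in L -> exists2 Y, Y \in U & x = t Y.
  by move=> /memv_imgP[Y YU ->]; exists Y; rewrite // lfunE /= fE.
have tL Y : Y \in U -> t Y \in L.
  by move=> YU; rewrite -fE -[f Y](lfunE f); exact: memv_img.
have [m Lm] : exists m, nil_words L m.
  apply: engel => [x y /LP[Y YU ->] /LP[Z ZU ->]|x /LP[Y YU ->]].
    by rewrite -tbr; apply: tL; exact: Ubr.
  exact: trace_form0_nilpotent.
move=> XU; apply: (nil_words_perfect (S := fun x => exists2 Y, Y \in U & x = t Y) Lm).
- by move=> _ [Y YU ->]; exact: tL.
- move=> P P0 PD PZ Pbr _ [Y YU ->].
  apply: (derived_ind (br := br) (U := U) (P := fun X => P (t X)));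
    last exact: (subvP Uperf).
  + by rewrite (lin0 tlin).
  + by move=> ? ? ? ?; rewrite (linD tlin); exact: PD.
  + by move=> ? ? ?; rewrite (linZ tlin); exact: PZ.
  + by move=> A B AU BU; rewrite tbr; apply: Pbr; [exists A|exists B].
- by exists X.
Qed.
End cartan_criterion.

(** * Semisimple algebras and the Killing form *)

Section semisimple_algebra.
Variables (R : rcfType) (n : nat) (br : 'cV[R]_n -> 'cV[R]_n -> 'cV[R]_n).
Hypotheses (brl : forall Y, linear (br^~ Y)) (brr : forall X, linear (br X)).
Hypothesis jacobi : forall X Y Z, br (br X Y) Z = br X (br Y Z) - br Y (br X Z).
Local Notation g := 'cV[R]_n.
Implicit Types (X Y Z : g) (U I J : {vspace g}).
Local Notation derived := (derived br).

Definition ideal I := forall X Y, Y \in I -> br X Y \in I.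
Hypothesis ss : forall I, ideal I -> (exists k, iter k derived I = 0%VS) -> I = 0%VS.

Lemma derived_sub I : ideal I -> (derived I <= I)%VS.
Proof.
move=> idI; apply/subvP; apply: derived_ind => [|X Y|a X|X Y _].
- exact: mem0v.
- exact: memvD.
- exact: memvZ.
- exact: idI.
Qed.

Lemma derived_ideal I : ideal I -> ideal (derived I).
Proof.
move=> idI Z; apply: derived_ind => [|X Y|a X|X Y XI YI].
- by rewrite (br0r brr) mem0v.
- by rewrite (brDr brr); exact: memvD.
- by rewrite (brZr brr); exact: memvZ.
- have -> : br Z (br X Y) = br (br Z X) Y + br X (br Z Y).
    by rewrite jacobi subrK.
  by apply: memvD; apply: mem_derived => //; exact: idI.
Qed.

(** The derived series becomes stationary where its dimension is smallest. *)
Lemma perfect_core I : ideal I -> exists k, let U := iter k derived I in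
  [/\ ideal U, (U <= I)%VS & (U <= derived U)%VS].
Proof.
move=> idI; have H k : ideal (iter k derived I) /\ (iter k derived I <= I)%VS.
  elim: k => [|k [idk subk]] /=; first by split.
  by split; [exact: derived_ideal|exact: subv_trans (derived_sub idk) subk].
pose P d := `[< exists k, \dim (iter k derived I) = d >].
have exP : exists d, P d by exists (\dim I); apply/asboolP; exists 0%N.
case: (ex_minnP exP) => d /asboolP[k kd] dmin; exists k => /=.
have [idk subk] := H k; split=> //.
have := dimv_leqif_eq (derived_sub idk) => -[_].
rewrite eqn_leq dimvS ?derived_sub // {1}kd dmin; last first.
  by apply/asboolP; exists k.+1.
by move=> /esym/eqP {1}<-.
Qed.

Section trace_form.
Variables (k : nat) (t : g -> 'M[R]_k).
Hypotheses (tlin : linear t)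
  (tbr : forall X Y, t (br X Y) = t X *m t Y - t Y *m t X).

Lemma trace_form0 U : (forall X Y, X \in U -> Y \in U -> br X Y \in U) ->
  (U <= derived U)%VS ->
  (forall X Y, X \in U -> Y \in U -> \tr (t X *m t Y) = 0) ->
  forall X, X \in U -> t X = 0.
Proof.
case: k t tlin tbr => [|k'] t' t'lin t'br Ubr Uperf trU X XU.
  by apply/matrixP => -[].
exact: (trace_form0_perfect0 t'lin t'br Ubr Uperf trU).
Qed.

Definition trace_form X Y := \tr (t X *m t Y).

Lemma trace_formC X Y : trace_form X Y = trace_form Y X.
Proof. exact: mxtrace_mulC. Qed.

Lemma trace_form_linear Y : linear (trace_form^~ Y : g -> R^o).
Proof.
by move=> a X X'; rewrite /trace_form (linD tlin) (linZ tlin) mulmxDl -scalemxAl !linearE.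
Qed.

Lemma trace_form_invariant Z X Y :
  trace_form (br Z X) Y + trace_form X (br Z Y) = 0.
Proof.
rewrite /trace_form !tbr mulmxBl mulmxBr !linearB /= !mulmxA addrA subrK.
by rewrite [X in _ - X]mxtrace_mulC mulmxA subrr.
Qed.

(** Written as a kernel, so that rank and nullity bound its dimension from below even for a
    degenerate form. *)
Definition orth I : {vspace g} := lker (linfun (fun X : g =>
  \row_(i < \dim I) trace_form X (vbasis I)`_i)).

Lemma orthP I X : reflect (forall Y, Y \in I -> trace_form X Y = 0) (X \in orth I).
Proof.
pose f X : 'rV[R]_(\dim I) := \row_(i < \dim I) trace_form X (vbasis I)`_i.
have flin : linear f.
  by move=> a Y Z; apply/rowP => i; rewrite !mxE trace_form_linear.
have fE : linfun f X = f X.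
  pose lM := GRing.isLinear.Build _ _ _ _ _ flin.
  by pose fl : {linear g -> 'rV[R]_(\dim I)} := HB.pack f lM; rewrite (lfunE fl).
rewrite /orth memv_ker fE; apply: (iffP eqP) => [f0 Y YI|XI].
  rewrite (coord_vbasis YI) trace_formC (lin_sum (trace_form_linear X)) big1 // => i _.
  rewrite (linZ (trace_form_linear X)) trace_formC.
  by have /rowP/(_ i) := f0; rewrite !mxE => ->; rewrite scaler0.
apply/rowP => i; rewrite !mxE; apply: XI.
by apply: vbasis_mem; apply: mem_nth; rewrite size_tuple.
Qed.

Lemma orth_ideal I : ideal I -> ideal (orth I).
Proof.
move=> idI Z X /orthP XI; apply/orthP => Y YI.
by have := trace_form_invariant Z X Y; rewrite (XI _ (idI Z Y YI)) addr0.
Qed.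

Lemma orth_dim I : (n <= \dim I + \dim (orth I))%N.
Proof.
have := limg_ker_dim (linfun (fun X : g =>
  \row_(i < \dim I) trace_form X (vbasis I)`_i)) fullv.
rewrite capfv -/(orth I) dimvf /dim /= muln1 => {1}<-.
rewrite addnC leq_add2r; apply: leq_trans (dimvS (subvf _)) _.
by rewrite dimvf /dim /= mul1n.
Qed.
End trace_form.

Definition admx X : 'M[R]_n := \matrix_(i, j) br X (delta_mx j 0) i 0.

Lemma admxE X Y : admx X *m Y = br X Y.
Proof.
rewrite [in RHS](matrix_sum_delta Y); apply/colP => i.
under eq_bigr do rewrite big_ord1.
rewrite (br_sumr brr) summxE !mxE; apply: eq_bigr => j _.
by rewrite (brZr brr) !mxE mulrC.
Qed.

Lemma admx_ext (A B : 'M[R]_n) : (forall Y : g, A *m Y = B *m Y) -> A = B.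
Proof.
move=> AB; apply/matrixP => i j; have /colP/(_ i) := AB (delta_mx j 0).
by rewrite -!colE !mxE.
Qed.

Lemma admx_linear : linear admx.
Proof.
by move=> a X Y; apply: admx_ext => Z; rewrite mulmxDl -scalemxAl !admxE brl.
Qed.

Lemma admx_br X Y : admx (br X Y) = admx X *m admx Y - admx Y *m admx X.
Proof. by apply: admx_ext => Z; rewrite mulmxBl -!mulmxA !admxE jacobi. Qed.

Local Notation korth := (orth admx).

Lemma iter_derived_perfect k I : (iter k derived I <= derived (iter k derived I))%VS ->
  (forall X Y, X \in iter k derived I -> Y \in iter k derived I -> br X Y = 0) ->
  iter k derived I = 0%VS.
Proof.
move=> perfU brU; apply/eqP; rewrite -subv0; apply: subv_trans perfU _.
apply/subvP; apply: derived_ind => [|X Y|a X|X Y XU YU]; rewrite ?memv0.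
- by [].
- by move=> /eqP -> /eqP ->; rewrite addr0.
- by move=> /eqP ->; rewrite scaler0.
- by rewrite brU.
Qed.

(** The trace form of [ad] vanishes on this intersection, so by Cartan's criterion the perfect end
    of its derived series has zero adjoint action. That end is abelian and perfect, hence 0, and the
    intersection is a solvable ideal. *)
Lemma ideal_cap_korth I : ideal I -> (I :&: korth I = 0)%VS.
Proof.
move=> idI; have idK : ideal (I :&: korth I)%VS.
  move=> X Y; rewrite !memv_cap => /andP[YI YK].
  by rewrite idI // (orth_ideal admx_linear admx_br idI).
apply: ss => //; have [k [idU /subvP UI perfU]] := perfect_core idK.
exists k; apply: iter_derived_perfect => // X Y XU YU; rewrite -admxE.
rewrite (trace_form0 admx_linear admx_br _ perfU _ XU) ?mul0mx //.
- by move=> X' Y' _; exact: idU.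
- move=> X' Y' /UI; rewrite memv_cap => /andP[_ /(orthP admx_linear) X'K] /UI.
  by rewrite memv_cap => /andP[+ _]; exact: X'K.
Qed.

Lemma ideal_add_korth I : ideal I -> (I + korth I = fullv)%VS.
Proof.
move=> idI; apply/eqP; rewrite eqEdim subvf /=.
rewrite dimvf /dim /= muln1 dimv_disjoint_sum ?ideal_cap_korth //.
exact: orth_dim.
Qed.

(** The Killing complement of [[g, g]] is an ideal, and its brackets lie both in it and in [[g, g]].
    It is therefore abelian, hence 0. *)
Lemma derived_full : derived fullv = fullv.
Proof.
have idf : ideal fullv by move=> *; rewrite memvf.
have idD := derived_ideal idf; rewrite -[RHS](ideal_add_korth idD).
suff -> : korth (derived fullv) = 0%VS by rewrite addv0.
apply: ss; first exact: (orth_ideal admx_linear admx_br idD).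
exists 1%N => /=; apply/eqP; rewrite -subv0 -(ideal_cap_korth idD).
apply/subvP; apply: derived_ind => [|X Y|a X|X Y XU YU].
- exact: mem0v.
- exact: memvD.
- exact: memvZ.
- rewrite memv_cap mem_derived ?memvf //=.
  exact: (orth_ideal admx_linear admx_br idD).
Qed.

(** * Casimir operators *)

Section casimir.
Variables (k : nat) (t : g -> 'M[R]_k).
Hypotheses (tlin : linear t)
  (tbr : forall X Y, t (br X Y) = t X *m t Y - t Y *m t X).
Hypothesis tn0 : exists X, t X <> 0.

(* [g1] is a complement, and an ideal, on which the trace form is
   nondegenerate. *)
Let rad := orth t fullv.
Let g1 := korth rad.
Let b i := (vbasis g1)`_i.
Local Notation m := (\dim g1).
Let Q : 'M[R]_m := \matrix_(i, j) trace_form t (b i) (b j).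

Let idrad : ideal rad.
Proof. by apply: (orth_ideal tlin tbr) => X Y _; rewrite memvf. Qed.
Let idg1 : ideal g1.
Proof. exact: (orth_ideal admx_linear admx_br idrad). Qed.
Let bg1 i : (i < m)%N -> b i \in g1.
Proof. by move=> im; apply: vbasis_mem; apply: mem_nth; rewrite size_tuple. Qed.

Let m_gt0 : (0 < m)%N.
Proof.
rewrite lt0n dimv_eq0; apply/negP => /eqP g10; case: tn0 => X; apply.
have := ideal_add_korth idrad; rewrite -/g1 g10 addv0 => radf.
apply: (trace_form0 tlin tbr (U := fullv)) (memvf X).
- by move=> *; rewrite memvf.
- by rewrite derived_full.
- by move=> Y Z _ _; have := memvf Y; rewrite -radf => /(orthP tlin)/(_ Z (memvf Z)).
Qed.

Let Q_unit : Q \in unitmx.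
Proof.
rewrite -row_free_unit; apply: inj_row_free => v vQ.
pose X := \sum_i v 0 i *: b i.
have Xg1 : X \in g1 by apply: rpred_sum => i _; apply: rpredZ; exact: bg1.
have Xb (j : 'I_m) : trace_form t X (b j) = 0.
  have /rowP/(_ j) := vQ; rewrite !mxE => <-.
  rewrite (lin_sum (trace_form_linear tlin _)); apply: eq_bigr => i _.
  by rewrite (linZ (trace_form_linear tlin _)) !mxE.
have Xo Y : Y \in g1 -> trace_form t X Y = 0.
  move=> Yg1; rewrite (coord_vbasis Yg1) trace_formC.
  rewrite (lin_sum (trace_form_linear tlin _)) big1 // => j _.
  by rewrite (linZ (trace_form_linear tlin _)) trace_formC Xb scaler0.
have X0 : X = 0.
  apply/eqP; rewrite -memv0 -(ideal_cap_korth idrad) memv_cap Xg1 andbT.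
  apply/(orthP tlin) => Y _; have := memvf Y; rewrite -(ideal_add_korth idrad).
  move=> /memv_addP[Y1 Y1r [Y2 Y2g ->]]; rewrite trace_formC.
  rewrite (linD (trace_form_linear tlin _)) [X in _ + X]trace_formC Xo // addr0.
  by move: Y1r => /(orthP tlin); apply; exact: memvf.
apply/rowP => i; rewrite mxE.
have /basis_free/freeP fr := vbasisP g1; exact: (fr (fun i => v 0 i) X0).
Qed.

(** The sum runs over bases of [g1] dual for the trace form, so its trace is the dimension of [g1],
    which is positive because [t] is not 0. It commutes with [t Z] because [ad Z] is skew for an
    invariant form. *)
Lemma casimir : exists (x y : 'I_m -> g),
  let Om := \sum_i t (x i) *m t (y i) in
  \tr Om <> 0 /\ forall Z, t Z *m Om = Om *m t Z.
Proof.
pose P := invmx Q.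
exists b, (fun i => \sum_(j < m) P i j *: b j) => Om; split.
  rewrite /Om linear_sum /=; under eq_bigr do rewrite -/(trace_form t _ _).
  have -> : \sum_(i < m) trace_form t (b i) (\sum_(j < m) P i j *: b j) = \tr (P *m Q).
    apply: eq_bigr => i _; rewrite trace_formC (lin_sum (trace_form_linear tlin _)) mxE.
    apply: eq_bigr => j _; by rewrite (linZ (trace_form_linear tlin _)) mxE.
  by rewrite mulVmx // mxtrace1 => /eqP; rewrite pnatr_eq0 eqn0Ngt m_gt0.
move=> Z; pose A := \matrix_(i < m, j < m) coord (vbasis g1) j (br Z (b i)).
have brA (i : 'I_m) : br Z (b i) = \sum_j A i j *: b j.
  rewrite {1}(coord_vbasis (idg1 Z (bg1 (ltn_ord i)))).
  by apply: eq_bigr => j _; rewrite mxE.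
have AQ : A *m Q + Q *m A^T = 0.
  apply/matrixP => i j; rewrite [RHS]mxE -(trace_form_invariant tbr Z (b i) (b j)).
  rewrite !brA [in RHS]trace_formC [X in _ = X + _]trace_formC.
  rewrite !(lin_sum (trace_form_linear tlin _)) [X in _ = _ + X]trace_formC.
  rewrite !(lin_sum (trace_form_linear tlin _)) !mxE.
  congr (_ + _); apply: eq_bigr => l _.
    by rewrite (linZ (trace_form_linear tlin _)) !mxE.
  by rewrite (linZ (trace_form_linear tlin _)) !mxE mulrC trace_formC.
pose f (M : 'M[R]_m) : 'M[R]_k := \sum_(i < m) \sum_(j < m) M i j *: (t (b i) *m t (b j)).
have fD M M' : f (M + M') = f M + f M'.
  rewrite -big_split; apply: eq_bigr => i _; rewrite -big_split.
  by apply: eq_bigr => j _; rewrite mxE scalerDl.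
have OmE : Om = f P.
  apply: eq_bigr => i _; rewrite (lin_sum tlin) mulmx_sumr.
  by apply: eq_bigr => j _; rewrite (linZ tlin) scalemxAr.
(* Skewness of [ad Z] for [Q], transported to the inverse matrix. *)
have AP : A^T *m P + P *m A = 0.
  have PAP : P *m (A *m Q + Q *m A^T) *m P = 0 by rewrite AQ mulmx0 mul0mx.
  rewrite -[RHS]PAP mulmxDr mulmxDl [P *m (A *m Q)]mulmxA -mulmxA mulmxV // mulmx1.
  by rewrite [P *m (Q *m _)]mulmxA mulVmx // mul1mx addrC.
have tZb (i : 'I_m) : t (br Z (b i)) = \sum_(j < m) A i j *: t (b j).
  by rewrite brA (lin_sum tlin); apply: eq_bigr => j _; rewrite (linZ tlin).
apply/subr0_eq; rewrite OmE -[RHS](_ : f (A^T *m P + P *m A) = 0); last first.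
  by rewrite AP /f big1 // => i _; rewrite big1 // => j _; rewrite mxE scale0r.
have -> : t Z *m f P - f P *m t Z = \sum_(i < m) \sum_(j < m) P i j *:
    (t (br Z (b i)) *m t (b j) + t (b i) *m t (br Z (b j))).
  rewrite mulmx_sumr mulmx_suml -sumrB; apply: eq_bigr => i _.
  rewrite mulmx_sumr mulmx_suml -sumrB; apply: eq_bigr => j _.
  rewrite -scalemxAr -scalemxAl -scalerBr; congr (_ *: _).
  by rewrite !tbr mulmxBl mulmxBr !mulmxA addrA subrK.
rewrite fD; under eq_bigr do under eq_bigr do rewrite scalerDr.
under eq_bigr do rewrite big_split /=.
rewrite big_split /=; congr (_ + _).
  rewrite exchange_big /= [RHS]exchange_big /=; apply: eq_bigr => j _.
  under eq_bigr do rewrite tZb mulmx_suml scaler_sumr.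
  rewrite exchange_big; apply: eq_bigr => l _ /=; rewrite mxE scaler_suml.
  by apply: eq_bigr => i _; rewrite -scalemxAl scalerA !mxE mulrC.
apply: eq_bigr => i _.
under eq_bigr do rewrite tZb mulmx_sumr scaler_sumr.
rewrite exchange_big; apply: eq_bigr => l _ /=; rewrite mxE scaler_suml.
by apply: eq_bigr => j _; rewrite -scalemxAr scalerA.
Qed.
End casimir.
End semisimple_algebra.

(** * Fitting projectors and the Reynolds operator *)

Lemma nilpotent_trace0_real (R : rcfType) (k : nat) (M : 'M[R]_k.+1) (N : nat) :
  M ^+ N = 0 -> \tr M = 0.
Proof.
move=> MN; pose rc : {rmorphism R -> R[i]} := real_complex R.
apply: (fmorph_inj rc); rewrite rmorph0 -trace_map_mx.
apply: (@nilpotent_trace0 _ _ (map_mx rc M) N).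
have MX j : map_mx rc (M ^+ j) = map_mx rc M ^+ j.
  by elim: j => [|j IHj]; [exact: map_mx1|rewrite !exprS map_mxM IHj].
by rewrite -MX MN map_mx0.
Qed.

(** The characteristic polynomial is a power of ['X] times some [q] prime to ['X]; a Bezout relation
    gives a polynomial in [Om] that projects onto the generalized kernel. *)
Lemma fitting_projector (F : fieldType) (k : nat) (Om : 'M[F]_k.+1) :
  exists (P : 'M[F]_k.+1) (N : nat),
  [/\ P * P = P, forall Z : 'M[F]_k.+1, Z * Om = Om * Z -> Z * P = P * Z,
      forall v : 'cV_k.+1, Om *m v = 0 -> P *m v = v & Om ^+ N * P = 0].
Proof.
have [mu [q]] := multiplicity_XsubC (char_poly Om) 0.
rewrite (monic_neq0 (char_poly_monic _)) /= subr0 => q0 pE.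
(* The exponent [mu.+1] is positive even for invertible [Om], so that [1 - P] kills the kernel of
   [Om]. *)
have cop : coprimep ('X^(mu.+1)) q.
  by rewrite coprimep_expl // coprimep_sym coprimepX.
have [[u v] /= uv1] := Bezout_eq1_coprimepP _ _ cop.
pose h : {rmorphism {poly F} -> 'M[F]_k.+1} := horner_mx Om; pose P := h (v * q).
have hM a b : h (a * b) = h a * h b by exact: rmorphM.
have hX : h 'X^(mu.+1) * h q = 0.
  rewrite -rmorphM /= exprS -mulrA ['X^mu * q]mulrC -pE rmorphM /=.
  by rewrite Cayley_Hamilton mulr0.
have P1 : 1 - P = h (u * 'X^(mu.+1)) by rewrite -(rmorph1 h) -rmorphB -uv1 addrK.
have hXE : h 'X^(mu.+1) = Om ^+ mu.+1 by rewrite /h rmorphXn /= horner_mx_X.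
exists P, mu.+1; split.
- suff : P * (1 - P) = 0 by rewrite mulrBr mulr1 => /subr0_eq.
  rewrite P1.
  by rewrite /P -hM mulrACA [q * _]mulrC !hM hX mulr0.
- by move=> Z ZO; apply: (comm_mx_horner (A := Z)).
- move=> w Ow; have : (1 - P) *m w = 0.
    by rewrite P1 hM hXE exprSr mulrA -mulmxA Ow mulmx0.
  by rewrite mulmxBl mul1mx => /subr0_eq.
- by rewrite -hXE /P -hM mulrCA !hM hX mulr0.
Qed.

Section reynolds.
Variables (R : rcfType) (n : nat) (br : 'cV[R]_n -> 'cV[R]_n -> 'cV[R]_n).
Hypotheses (brl : forall Y, linear (br^~ Y)) (brr : forall X, linear (br X)).
Hypothesis jacobi : forall X Y Z, br (br X Y) Z = br X (br Y Z) - br Y (br X Z).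
Hypothesis ss : forall I, ideal br I ->
  (exists k, iter k (derived br) I = 0%VS) -> I = 0%VS.

(* Among the projectors that commute with the representation and fix the
   invariants, one of minimal rank kills the representation: otherwise it could
   be cut down by the Fitting projector of a Casimir operator. *)
Lemma reynolds_operator (k : nat) (t : 'cV[R]_n -> 'M[R]_k) : linear t ->
  (forall X Y, t (br X Y) = t X *m t Y - t Y *m t X) ->
  exists E : 'M[R]_k, (forall X, E *m t X = 0) /\
    forall v : 'cV_k, (forall X, t X *m v = 0) -> E *m v = v.
Proof.
case: k t => [|k] t tlin tbr.
  by exists 0; split=> [X|v _]; apply/matrixP => -[].
pose Pr (E : 'M[R]_k.+1) := [/\ E * E = E, forall X, t X * E = E * t X &
    forall v : 'cV_k.+1, (forall X, t X *m v = 0) -> E *m v = v].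
have exP : exists r, `[< exists2 E, Pr E & \rank E = r >].
  exists k.+1; apply/asboolP; exists 1; last exact: mxrank1.
  by split=> [|X|v _]; rewrite ?mulr1 ?mul1r ?mul1mx.
case: (ex_minnP exP) => r /asboolP[E [EE Et Ev] rE] rmin.
exists E; split=> // X; rewrite -[LHS]/(E * t X) -Et.
apply: contrapT => tE0.
pose t' X := t X * E.
have t'lin : linear t'.
  by move=> a Y Z; rewrite /t' (linD tlin) (linZ tlin) mulrDl scalerAl.
have t't' Y Z : t' Y * t' Z = t Y * t Z * E.
  by rewrite /t' -!mulrA [E * _]mulrA -Et -[t Z * E * E]mulrA EE.
have t'br Y Z : t' (br Y Z) = t' Y *m t' Z - t' Z *m t' Y.
  by rewrite [_ *m _]t't' [X in _ - X]t't' /t' tbr mulrBl.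
have [x [y [/= trOm cOm]]] := casimir brl brr jacobi ss t'lin t'br (ex_intro _ X tE0).
set Om := (X in \tr X) in trOm cOm.
have OmE : Om * E = Om.
  by rewrite mulr_suml; apply: eq_bigr => i _; rewrite [_ *m _]t't' -mulrA EE.
have EOm : E * Om = Om.
  rewrite mulr_sumr; apply: eq_bigr => i _; rewrite [_ *m _]t't'.
  by rewrite [in LHS]mulrA [E * _]mulrA -[E * t _]Et -[_ * E * t _]mulrA -[E * t _]Et -!mulrA EE.
have tOm Z : t Z * Om = Om * t Z.
  have := cOm Z; rewrite -![_ *m _]/(_ * _) /t' -mulrA EOm => ->.
  by rewrite Et mulrA OmE.
have [P [N [PP cP P0 OmP]]] := fitting_projector Om.
have EP : E * P = P * E by apply: cP; rewrite EOm.
have PrEP : Pr (P * E).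
  split=> [|Z|v vt].
  - by rewrite mulrA -[P * E * P]mulrA EP mulrA PP -mulrA EE.
  - by rewrite mulrA [t Z * P]cP // -!mulrA Et.
  - rewrite -mulmxA Ev //; apply: P0; rewrite mulmx_suml big1 // => i _.
    by rewrite [_ *m t' _]t't' -![_ * _]/(_ *m _) -!mulmxA Ev // vt mulmx0.
have rPE : (r <= \rank (P * E)%R)%N by apply: rmin; apply/asboolP; exists (P * E).
(* By minimality [P *m E] has the rank of [E], hence the same row space, and [P] acts as the
   identity on the image of [E]. This makes [Om] nilpotent, against its nonzero trace. *)
have /submxP[Z EZ] : (E <= P *m E)%MS.
  have := mxrank_leqif_sup (submxMl P E) => -[_ /esym].
  by rewrite eqn_leq rE rPE -rE (mxrankS (submxMl P E)) => /esym.
have EPE : E * P = E.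
  rewrite [in LHS]EZ -[_ *m _]/(Z * (P * E)) -!mulrA EP [P * (P * E)]mulrA PP.
  exact/esym.
apply: trOm; apply: (@nilpotent_trace0_real _ _ _ N.+1).
have OmPE : Om * P = Om by rewrite -{1}OmE -mulrA EPE OmE.
by rewrite exprSr -[X in _ * X]OmPE mulrA -exprSr exprS -mulrA OmP mulr0.
Qed.
End reynolds.

(** * Calculus in finite dimension *)

Local Open Scope classical_set_scope.
Local Open Scope ring_scope.

(** * Germs of smooth maps *)

Section smooth_at.
Context {R : realType}.

Definition smooth_at (V W : normedModType R) (f : V -> W) (x : V) :=
  exists U, [/\ open U, U x & smooth_on U f].

Implicit Types U V W : normedModType R.

Lemma smooth_at_nbhs V W (f : V -> W) x :
  smooth_at f x -> \forall y \near x, smooth_at f y.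
Proof.
by move=> [U [oU Ux sf]]; near=> y; exists U; split=> //; near: y;
  exact: open_nbhs_nbhs.
Unshelve. all: by end_near. Qed.

Lemma smooth_at_differentiable V W (f : V -> W) x :
  smooth_at f x -> differentiable f x.
Proof. by move=> [U [oU Ux sf]]; exact: (sf 1%N).1. Qed.

Lemma smooth_at_continuous V W (f : V -> W) x :
  smooth_at f x -> {for x, continuous f}.
Proof. by move=> [U [oU Ux sf]]; exact: (sf 0%N). Qed.

Lemma smooth_at_derive V W (f : V -> W) x v :
  smooth_at f x -> smooth_at ('D_v f) x.
Proof. by move=> [U [oU Ux sf]]; exists U; split=> // k; exact: (sf k.+1).2. Qed.

Lemma smooth_at_eq V W (f g : V -> W) x : (\forall y \near x, f y = g y) ->
  smooth_at f x -> smooth_at g x.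
Proof.
rewrite /prop_near1 nbhsE => -[B [oB Bx] fg] [U [oU Ux sf]]; exists (U `&` B); split=> //.
  exact: openI.
move=> k; apply: (@Ck_eq _ _ _ _ _ f); first exact: openI.
  by move=> y [_ /fg].
by apply: (Ck_sub (B := U)) => // y [].
Qed.

Lemma smooth_at_cst V W (w : W) (x : V) : smooth_at (cst w) x.
Proof. by exists setT; split=> //; [exact: openT|exact: smooth_on_cst]. Qed.

Lemma smooth_at_id V (x : V) : smooth_at id x.
Proof. by exists setT; split=> //; [exact: openT|exact: smooth_on_id]. Qed.

Lemma smooth_at2 V W W' W'' (op : (V -> W) -> (V -> W') -> V -> W'') f g x :
  (forall A k, open A -> Ck k A f -> Ck k A g -> Ck k A (op f g)) ->
  smooth_at f x -> smooth_at g x -> smooth_at (op f g) x.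
Proof.
move=> opC [A [oA Ax sf]] [B [oB Bx sg]]; exists (A `&` B); split=> //.
  exact: openI.
by move=> k; apply: opC; [exact: openI|apply: Ck_sub (sf k) => ? []|
  apply: Ck_sub (sg k) => ? []].
Qed.

Lemma smooth_atD V W (f g : V -> W) x :
  smooth_at f x -> smooth_at g x -> smooth_at (fun y => f y + g y) x.
Proof. by apply: (smooth_at2 (op := fun f g y => f y + g y)) => A k; exact: Ck_add. Qed.

Lemma smooth_atM V (f g : V -> R) x :
  smooth_at f x -> smooth_at g x -> smooth_at (fun y => f y * g y) x.
Proof. by apply: (smooth_at2 (op := fun (f g : V -> R) y => f y * g y)) => A k; exact: Ck_mul. Qed.

Lemma smooth_at_pair V W W' (f : V -> W) (g : V -> W') x :
  smooth_at f x -> smooth_at g x -> smooth_at (fun y => (f y, g y)) x.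
Proof.
by apply: (smooth_at2 (op := fun f g y => (f y, g y))) => A k; exact: Ck_pair.
Qed.

Lemma smooth_at_mulmx V m n p (f : V -> 'M[R]_(m, n)) (g : V -> 'M[R]_(n, p)) x :
  smooth_at f x -> smooth_at g x -> smooth_at (fun y => f y *m g y) x.
Proof.
by apply: (smooth_at2 (op := fun f g y => f y *m g y)) => A k; exact: Ck_mulmx.
Qed.

Lemma smooth_at_postlin V W W' (L : {linear W -> W'}) (f : V -> W) x :
  continuous L -> smooth_at f x -> smooth_at (fun y => L (f y)) x.
Proof.
by move=> cL [U [oU Ux sf]]; exists U; split=> // k; exact: (Ck_postlin oU cL (sf k)).
Qed.

Lemma smooth_at_lin V W (L : {linear V -> W}) x : continuous L -> smooth_at L x.
Proof. by move=> cL; exact: smooth_at_postlin cL (smooth_at_id x). Qed.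

Lemma smooth_at_mx V m n (F : V -> 'M[R]_(m, n)) x :
  (forall i j, smooth_at (fun y => F y i j) x) -> smooth_at F x.
Proof.
move=> sF; have sF' ij : smooth_at (fun y => F y ij.1 ij.2) x by exact: sF.
pose U ij := projT1 (cid (sF' ij)).
have oU ij : [/\ open (U ij), U ij x & smooth_on (U ij) (fun y => F y ij.1 ij.2)].
  by rewrite /U; case: cid.
have oI : open (\bigcap_(ij in [set: 'I_m * 'I_n]) U ij).
  rewrite openE => y Uy.
  have : \forall z \near y, forall ij, U ij z.
    apply: filter_forall => ij; apply: open_nbhs_nbhs; split; last exact: Uy.
    by have [] := oU ij.
  by apply: filterS => z Uz ij _.
exists (\bigcap_(ij in [set: 'I_m * 'I_n]) U ij); split=> //.
- by move=> ij _; have [] := oU ij.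
- move=> k; apply: Ck_matrix => // i j.
  by have [_ _ /(_ k)] := oU (i, j); apply: Ck_sub => y; exact.
Qed.

Lemma smooth_at_entry V m n (F : V -> 'M[R]_(m, n)) i j x :
  smooth_at F x -> smooth_at (fun y => F y i j) x.
Proof. by move=> [U [oU Ux sf]]; exists U; split=> // k; exact: Ck_entry. Qed.

Lemma col_sum_delta n (v : 'cV[R]_n) : v = \sum_i v i ord0 *: delta_mx i ord0.
Proof.
rewrite [LHS]matrix_sum_delta; apply: eq_bigr => i _.
by rewrite big_ord1.
Qed.

Lemma linear_col_sum n W (L : {linear 'cV[R]_n -> W}) v :
  L v = \sum_i v i ord0 *: L (delta_mx i ord0).
Proof.
rewrite [in LHS](col_sum_delta v) linear_sum; apply: eq_bigr => i _.
by rewrite linearZ.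
Qed.

Lemma linear_col_continuous n W (L : {linear 'cV[R]_n -> W}) : continuous L.
Proof.
have -> : L = \sum_i (fun v => v i ord0 *: L (delta_mx i ord0)) :> (_ -> _).
  by apply/funext => v; rewrite fct_sumE; exact: linear_col_sum.
elim/big_ind: _ => [|f g cf cg|i _] v; first exact: cst_continuous.
  exact: cvgD (cf v) (cg v).
apply: continuous_comp (fun y : 'cV[R]_n => y i ord0) (fun a : R => a *: L (delta_mx i ord0)) _ _ _.
  exact: coord_continuous.
exact: scalel_continuous.
Qed.

(** By the chain rule [D_v (f o g)] is the sum of the products of [D_v g_i] and [(d_i f) o g], to
    which the induction on the order applies. Coordinates on the middle space make this a finite
    sum. *)
Lemma Ck_comp V m k (A : set V) (B : set 'cV[R]_m) (g : V -> 'cV[R]_m)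
    (f : 'cV[R]_m -> R) : open A -> open B -> (forall x, A x -> B (g x)) ->
  Ck k A g -> Ck k B f -> Ck k A (f \o g).
Proof.
move=> oA oB AB; elim: k f => [|k IHk] f.
  by move=> Cg Cf x Ax; apply: continuous_comp; [exact: Cg|exact/Cf/AB].
move=> Cg1 [df Cf]; have Cg := Ck_weaken Cg1; case: Cg1 => dg Cdg.
have dfg x : A x -> differentiable (f \o g) x.
  by move=> Ax; apply: differentiable_comp; [exact: dg|exact/df/AB].
split=> // v.
apply: (@Ck_eq _ _ _ _ _ (\sum_i ((fun x => 'D_v g x i ord0) *
    ('D_(delta_mx i ord0) f \o g)))) => //.
  move=> x Ax; rewrite fct_sumE deriveE; last exact: dfg.
  rewrite (diff_comp (dg x Ax) (df _ (AB _ Ax))) /= linear_col_sum.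
  apply: eq_bigr => i _; rewrite /= !fctE deriveE; last exact: dg.
  by rewrite deriveE //; exact/df/AB.
apply: Ck_sum => // i; apply: Ck_mul => //; last exact: IHk Cg (Cf _).
exact: Ck_entry oA (Cdg v).
Qed.

Lemma smooth_at_comp V m p q (g : V -> 'cV[R]_m) (f : 'cV[R]_m -> 'M[R]_(p, q)) x :
  smooth_at g x -> smooth_at f (g x) -> smooth_at (fun y => f (g y)) x.
Proof.
move=> sg sf; apply: smooth_at_mx => i j.
have [B [oB Bx {}sf]] := smooth_at_entry i j sf.
have cg := smooth_at_continuous sg; move: sg => [A [oA Ax sg]].
exists (A `&` (g @^-1` B)^°); split.
- by apply: openI => //; exact: open_interior.
- split=> //; apply: cg; exact: open_nbhs_nbhs.
move=> k; apply: (Ck_comp (f := fun y => f y i j) (B := B)) => //.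
- by apply: openI => //; exact: open_interior.
- by move=> y [_ /interior_subset].
- by apply: Ck_sub (sg k) => y [].
Qed.

End smooth_at.

(** Makes spaces of matrices complete normed modules, the setting of the contraction principle in
    [local_surjection]. *)
HB.instance Definition _ (R : realType) m n :=
  Uniform_isComplete.Build 'M[R]_(m, n) cauchy_cvg.

(** * Mean value estimates and local inversion *)

Section mean_value.
Context {R : realType}.

Lemma mx_entry_le m n (x : 'M[R]_(m, n)) i j : `|x i j| <= `|x|.
Proof.
rewrite [leRHS]/Num.norm /= mx_normrE; apply/bigmax_geP; right => /=.
by exists (i, j).
Qed.

Lemma mx_norm_le m n (x : 'M[R]_(m, n)) c :
  0 <= c -> (forall i j, `|x i j| <= c) -> `|x| <= c.
Proof.
move=> c0 xc; rewrite [leLHS]/Num.norm /= mx_normrE; apply/bigmax_leP.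
by split=> // -[i j] _; exact: xc.
Qed.

Lemma ball_segment (V : normedModType R) (a x y : V) r t :
  0 <= t <= 1 -> `|x - a| < r -> `|y - a| < r -> `|x + t *: (y - x) - a| < r.
Proof.
move=> /andP[t0 t1] xr yr.
have -> : x + t *: (y - x) - a = (1 - t) *: (x - a) + t *: (y - a).
  have -> : y - x = (y - a) - (x - a) by rewrite opprB addrA subrK.
  rewrite addrAC scalerBr [in RHS]scalerBl scale1r -[RHS]addrA; congr (_ + _).
  by rewrite addrC.
apply: le_lt_trans (ler_normD _ _) _; rewrite !normrZ !ger0_norm ?subr_ge0 //.
have [->|t10] := eqVneq t 1; first by rewrite subrr mul0r add0r mul1r.
have t1' : t < 1 by rewrite lt_neqAle t10.
have -> : r = (1 - t) * r + t * r by ring.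
apply: ltr_leD; first by rewrite ltr_pM2l // subr_gt0.
by rewrite ler_wpM2l // ltW.
Qed.

Lemma is_derive_line (V W : normedModType R) (f : V -> W) x v t :
  differentiable f (x + t *: v) ->
  is_derive t (1 : R) (fun s : R => f (x + s *: v)) ('D_v f (x + t *: v)).
Proof.
move=> df; pose L (s : R) := x + s *: v.
have dL : differentiable L t.
  by apply: differentiableD; [exact: differentiable_cst|exact: differentiableZl].
have dfL : differentiable (f \o L) t by exact: differentiable_comp.
have dLE : 'd L t = (fun s : R => s *: v) :> (R -> V).
  rewrite diffD; [|exact: differentiable_cst|exact: differentiableZl].
  apply/funext => s; rewrite /= (_ : 'd (fun=> x) t s = 0); last first.
    by rewrite (_ : (fun=> x) = cst x) // diff_cst.
  by rewrite add0r (diffZl v (@ex_diff _ _ _ _ _ _ _ (is_diff_id t))) diff_val.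
apply: DeriveDef; first exact: diff_derivable.
by rewrite !deriveE // diff_comp //= dLE scale1r.
Qed.

Lemma segment_mvt (V : normedModType R) (f : V -> R) x v :
  (forall t : R, 0 <= t <= 1 -> differentiable f (x + t *: v)) ->
  exists2 t : R, 0 <= t <= 1 & f (x + v) - f x = 'D_v f (x + t *: v).
Proof.
move=> df; have [||c] := @MVT_segment R (fun s => f (x + s *: v))
  (fun t => 'D_v f (x + t *: v)) 0 1 ler01.
- move=> t; rewrite in_itv /= => /andP[t0 t1]; apply: is_derive_line.
  by apply: df; rewrite !ltW.
- apply: derivable_within_continuous => t; rewrite in_itv /= => t01.
  by have [] := is_derive_line (df t t01).
by rewrite in_itv /= scale1r scale0r addr0 subr0 mulr1 => c01 ->; exists c.
Qed.

Lemma derive_col_sum m (W : normedModType R) (f : 'cV[R]_m -> W) x v :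
  differentiable f x -> 'D_v f x = \sum_i v i ord0 *: 'D_(delta_mx i ord0) f x.
Proof.
move=> df; rewrite deriveE // [LHS]linear_col_sum.
by apply: eq_bigr => i _; rewrite deriveE.
Qed.

Lemma near_forall (T : topologicalType) (I : finType) (P : I -> T -> Prop) (x : T) :
  (forall i, \forall y \near x, P i y) -> \forall y \near x, forall i, P i y.
Proof. by move=> xP; apply: filter_forall. Qed.

Lemma differential_near m (f : 'cV[R]_m -> R) a e : smooth_at f a -> 0 < e ->
  \forall x \near a, forall v, `|'D_v f x - 'D_v f a| <= e * `|v|.
Proof.
(* Each of the [m] partial derivatives may vary by [d]; dividing by [m.+1] also covers [m = 0]. *)
move=> sf e0; pose d := e / m.+1%:R; have d0 : 0 < d by rewrite divr_gt0.
have : \forall x \near a, forall i : 'I_m,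
    `|'D_(delta_mx i ord0) f a - 'D_(delta_mx i ord0) f x| < d.
  apply: near_forall => i.
  by have /cvgrPdist_lt/(_ _ d0) :=
    smooth_at_continuous (smooth_at_derive (delta_mx i ord0) sf).
have := smooth_at_nbhs sf; apply: filterS2 => x sfx fx v.
rewrite !derive_col_sum; [|exact: smooth_at_differentiable..].
rewrite -sumrB.
apply: le_trans (ler_norm_sum _ _ _) _.
apply: (@le_trans _ _ (\sum_(i < m) `|v| * d)).
  apply: ler_sum => i _; rewrite -scalerBr normrZ ler_pM //.
    exact: mx_entry_le.
  by rewrite distrC ltW.
rewrite sumr_const card_ord -mulr_natl mulrCA mulrC.
rewrite ler_wpM2r // /d mulrCA ger_pMr // ler_pdivrMr // mul1r.
by rewrite ler_nat.
Qed.

(** Strict differentiability: both points move, and the error is measured against their distance, as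
    contraction and injectivity arguments require. *)
Lemma strict_diff m p (f : 'cV[R]_m -> 'cV[R]_p) a e : smooth_at f a -> 0 < e ->
  exists2 d, 0 < d & forall x y, `|x - a| < d -> `|y - a| < d ->
    `|f y - f x - 'D_(y - x) f a| <= e * `|y - x|.
Proof.
move=> sf e0.
have : \forall x \near a, forall i : 'I_p, smooth_at (fun x => f x i ord0) x /\
    forall v, `|'D_v (fun x => f x i ord0) x - 'D_v (fun x => f x i ord0) a| <= e * `|v|.
  apply: near_forall => i; have sfi := smooth_at_entry i ord0 sf.
  by apply: filterS2 (smooth_at_nbhs sfi) (differential_near sfi e0) => x.
move=> /nbhs_ballP[d /= d0 dP]; exists d => // x y xd yd.
apply: mx_norm_le; first by rewrite mulr_ge0 // ltW.
move=> i j; rewrite (ord1 j) {j}; pose g := fun x => f x i ord0.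
have sg := smooth_at_entry i ord0 sf.
have gP z : `|z - a| < d -> smooth_at g z /\ forall v, `|'D_v g z - 'D_v g a| <= e * `|v|.
  by move=> zd; apply: dP; rewrite mx_norm_ball /ball_ /= distrC.
have [|t t01] := @segment_mvt _ g x (y - x).
  move=> t t01; apply: smooth_at_differentiable.
  by have [] := gP _ (ball_segment t01 xd yd).
rewrite (addrC x (y - x)) subrK => gE.
have -> : (f y - f x - 'D_(y - x) f a) i ord0 = g y - g x - 'D_(y - x) g a.
  rewrite !mxE; congr (_ - _).
  by rewrite derive_mx ?mxE //; exact/diff_derivable/smooth_at_differentiable.
have xt : `|x + t *: (y - x) - a| < d by exact: ball_segment.
by rewrite gE; exact: (gP _ xt).2.
Qed.

Lemma mulmx_lipschitz m p (B : 'M[R]_(m, p)) :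
  exists2 c, 0 < c & forall u : 'cV[R]_p, `|B *m u| <= c * `|u|.
Proof.
exact: (@linear_lipschitz _ _ _ (mulmx B : {linear 'cV[R]_p -> 'cV[R]_m})
  (@linear_col_continuous _ _ _ _)).
Qed.

(** [B] is a right inverse of the differential. Solving [f (a + B *m u) = z] means finding a fixed
    point of [T u = u - (f (a + B *m u) - z)], a contraction near 0. The linear bound on the
    solution controls preimages of curves in [kernel_curve]. *)
Lemma local_surjection m p (f : 'cV[R]_m -> 'cV[R]_p) a (B : 'M[R]_(m, p)) :
  smooth_at f a -> (forall w, 'D_(B *m w) f a = w) ->
  exists C d, [/\ 0 < C, 0 < d & forall z, `|z - f a| < d ->
    exists2 x, `|x - a| <= C * `|z - f a| & f x = z].
Proof.
move=> sf BK; have [c c0 Bc] := mulmx_lipschitz B.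
(* As [c] bounds [B], an error factor [1 / (2c)] makes [T] contract by 1/2, and the ball of radius
   [2 |z - f a|] is then stable. *)
have e0 : 0 < (2 * c)^-1 by rewrite invr_gt0 mulr_gt0.
have [d d0 fd] := strict_diff sf e0.
have d'0 : 0 < d / c / 2 by rewrite !divr_gt0.
exists (c * 2), (d / c / 2); split=> // [|z zd]; first by rewrite mulr_gt0.
pose r := `|z - f a| * 2.
have rd : r < d / c by rewrite /r -ltr_pdivlMr.
pose U := [set u : 'cV[R]_p | `|u| <= r].
pose T u := u - (f (a + B *m u) - z).
have r0 : 0 <= r by rewrite mulr_ge0.
have Ud u : U u -> `|a + B *m u - a| < d.
  move=> Uu; rewrite addrAC subrr add0r; apply: le_lt_trans (Bc u) _.
  by rewrite mulrC -ltr_pdivlMr //; exact: le_lt_trans Uu rd.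
have Tlip u v : U u -> U v -> `|T u - T v| <= 2^-1 * `|u - v|.
  move=> Uu Uv; have := fd _ _ (Ud _ Uv) (Ud _ Uu).
  have -> : a + B *m u - (a + B *m v) = B *m (u - v).
    by rewrite opprD addrACA subrr add0r mulmxBr.
  rewrite BK; have -> : T u - T v = - (f (a + B *m u) - f (a + B *m v) - (u - v)).
    by apply/matrixP => i j; rewrite /T !mxE; ring.
  rewrite normrN => /le_trans; apply.
  rewrite invfM -mulrA ler_wpM2l ?invr_ge0 //.
  by rewrite -ler_pdivlMl ?invr_gt0 // invrK; exact: Bc.
have U0 : U 0 by rewrite /U /= normr0.
have TU : set_fun U U T.
  move=> u Uu; have := Tlip _ _ Uu U0; rewrite subr0.
  have -> : T 0 = z - f a by rewrite /T mulmx0 addr0 sub0r opprB.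
  move=> Tu; rewrite /U /= -[T u](subrK (z - f a)).
  apply: le_trans (ler_normD _ _) _; apply: (le_trans (lerD Tu (lexx _))).
  have : 2^-1 * `|u| <= 2^-1 * r by rewrite ler_wpM2l // invr_ge0.
  by rewrite /r => ?; lra.
pose TF : {fun U >-> U} := HB.pack T (isFun.Build _ _ U U T TU).
have ctrT : is_contraction TF.
  have h0 : 0 <= 2^-1 :> R by rewrite invr_ge0.
  exists (NngNum h0); split=> /=; first by rewrite invf_lt1 // ltr1n.
  by move=> [u v] [/= Uu Uv]; exact: Tlip.
have [||u Uu uT] := @banach_fixed_point _ 'cV[R]_p _ _ ctrT.
- have -> : U = closed_ball_ Num.norm (0 : 'cV[R]_p) r.
    by apply/funext => u; rewrite /U /closed_ball_ /= sub0r normrN.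
  exact: closed_closed_ball_.
- by exists 0.
exists (a + B *m u).
  rewrite addrAC subrr add0r; apply: le_trans (Bc u) _.
  by rewrite -mulrA ler_wpM2l ?(ltW c0) // mulrC.
move/eqP: uT; rewrite /= /T eq_sym -subr_eq0 addrAC subrr add0r oppr_eq0 subr_eq0.
by move/eqP.
Qed.

(** Here [B] is a left inverse, and [f x = f y] gives [|y - x| <= c e |y - x|] with [c e = 1/2]. *)
Lemma local_injection m p (f : 'cV[R]_m -> 'cV[R]_p) a (B : 'M[R]_(m, p)) :
  smooth_at f a -> (forall w, B *m 'D_w f a = w) ->
  exists2 d, 0 < d & forall x y, `|x - a| < d -> `|y - a| < d ->
    f x = f y -> x = y.
Proof.
move=> sf BK; have [c c0 Bc] := mulmx_lipschitz B.
have e0 : 0 < (2 * c)^-1 by rewrite invr_gt0 mulr_gt0.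
have [d d0 fd] := strict_diff sf e0; exists d => // x y xd yd fxy.
have := fd _ _ xd yd; rewrite fxy subrr sub0r normrN => Dle.
have := Bc ('D_(y - x) f a); rewrite BK.
move=> /le_trans/(_ (ler_wpM2l (ltW c0) Dle)).
rewrite mulrA invfM mulrCA mulfV ?gt_eqF // mulr1 => le2.
have : `|y - x| <= 0 by have := normr_ge0 (y - x); lra.
by rewrite normr_le0 subr_eq0 => /eqP.
Qed.

Lemma ball_derive0_cst m (f : 'cV[R]_m -> R) a d :
  (forall x, `|x - a| < d -> smooth_at f x) ->
  (forall x v, `|x - a| < d -> 'D_v f x = 0) ->
  forall x y, `|x - a| < d -> `|y - a| < d -> f x = f y.
Proof.
move=> sf Df x y xd yd; have [|t t01] := @segment_mvt _ f x (y - x).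
  by move=> t t01; apply/smooth_at_differentiable/sf; exact: ball_segment.
rewrite Df; last exact: ball_segment.
by rewrite (addrC x (y - x)) subrK => /eqP; rewrite subr_eq0 => /eqP.
Qed.

Lemma derive_entry (V : normedModType R) m n (F : V -> 'M[R]_(m, n)) x v i j :
  differentiable F x -> ('D_v F x) i j = 'D_v (fun y => F y i j) x.
Proof. by move=> dF; rewrite derive_mx ?mxE //; exact: diff_derivable. Qed.

Lemma derive_scale (V W : normedModType R) (f : V -> W) x v (s : R) :
  differentiable f x -> 'D_(s *: v) f x = s *: 'D_v f x.
Proof. by move=> df; rewrite !deriveE // linearZ. Qed.

Lemma derive_addv (V W : normedModType R) (f : V -> W) x v w :
  differentiable f x -> 'D_(v + w) f x = 'D_v f x + 'D_w f x.
Proof. by move=> df; rewrite !deriveE // linearD. Qed.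

Lemma derive_shiftv (V W : normedModType R) (f : V -> W) x w v :
  'D_v (fun y => f (y + w)) x = 'D_v f (x + w).
Proof. by rewrite /derive; under eq_fun do rewrite /= -addrA. Qed.

Lemma is_derive_line0 (V : normedModType R) (f : V -> R) x v l :
  is_derive (0 : R) (1 : R) (fun s : R => f (x + s *: v)) l <-> is_derive x v f l.
Proof.
have E : (fun s : R => f (x + s *: v)) = (fun h : R => f (h *: v + x)).
  by apply/funext => h; rewrite addrC.
have DE : 'D_v f x = 'D_1 (fun h : R => f (h *: v + x)) 0.
  rewrite /derive; set g1 := fun h => h^-1 *: _; set g2 := fun h => h^-1 *: _.
  suff -> : g1 = g2 by [].
  by apply/funext => h; rewrite /g1 /g2 /= addr0 scale0r add0r [h *: 1]mulr1.
rewrite E; split=> -[df fl]; apply: DeriveDef.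
- exact/derivable1P.
- by rewrite DE fl.
- by move/derivable1P: df.
- by rewrite -DE fl.
Qed.

Local Opaque derive.

Lemma differentiable_shiftv (V W : normedModType R) (f : V -> W) x w :
  differentiable f (x + w) -> differentiable (fun y => f (y + w)) x.
Proof.
by move=> df; exact: (@differentiable_comp _ _ _ _ (fun y => y + w) f).
Qed.

Lemma near_ball (V : normedModType R) (a : V) (P : V -> Prop) :
  (\forall x \near a, P x) -> exists2 d, 0 < d & forall x, `|x - a| < d -> P x.
Proof.
move=> /nbhs_ballP[d /= d0 dP]; exists d => // x xd; apply: dP.
by rewrite -ball_normE /= distrC.
Qed.

Lemma continuous_ball (V : normedModType R) (f : V -> R) a e :
  {for a, continuous f} -> 0 < e ->
  exists2 d, 0 < d & forall x, `|x - a| < d -> `|f a - f x| < e.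
Proof. by move=> /cvgrPdist_lt cf e0; apply: near_ball; exact: cf. Qed.

Lemma smooth_at_ball (V W : normedModType R) (f : V -> W) a : smooth_at f a ->
  exists2 d, 0 < d & forall x, `|x - a| < d -> smooth_at f x.
Proof. by move=> /smooth_at_nbhs; exact: near_ball. Qed.

(** Two mean value steps. The difference is symmetric in [v] and [w] while the order of derivation
    on the right is not, which is the source of Schwarz's theorem below. *)
Lemma second_difference (V : normedModType R) (f : V -> R) a v w d :
  (forall x, `|x - a| < d -> smooth_at f x) -> `|v| + `|w| < d ->
  exists2 x, `|x - a| <= `|v| + `|w| &
    f (a + v + w) - f (a + v) - f (a + w) + f a = 'D_w ('D_v f) x.
Proof.
move=> sf vwd; pose h x := f (x + w) - f x.
have b1 t : 0 <= t <= 1 -> `|a + t *: v - a| <= `|v|.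
  move=> /andP[t0 t1]; rewrite addrAC subrr add0r normrZ ger0_norm //.
  by rewrite ler_piMl.
have b2 t t' : 0 <= t <= 1 -> 0 <= t' <= 1 -> `|a + t *: v + t' *: w - a| <= `|v| + `|w|.
  move=> t1 /andP[t0' t1']; rewrite addrAC; apply: le_trans (ler_normD _ _) _.
  apply: lerD; first exact: b1.
  by rewrite normrZ ger0_norm // ler_piMl.
have s1 t : 0 <= t <= 1 -> smooth_at f (a + t *: v).
  by move=> t01; apply: sf; apply: le_lt_trans vwd; apply: (le_trans (b1 _ t01)); rewrite lerDl.
have s2 t t' : 0 <= t <= 1 -> 0 <= t' <= 1 -> smooth_at f (a + t *: v + t' *: w).
  by move=> t01 t01'; apply: sf; apply: le_lt_trans vwd; exact: b2.
have one : 0 <= (1 : R) <= 1 by rewrite ler01 lexx.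
have s3 t : 0 <= t <= 1 -> differentiable f (a + t *: v + w).
  by move=> t01; have := s2 _ _ t01 one; rewrite scale1r => /smooth_at_differentiable.
have dh t : 0 <= t <= 1 -> differentiable h (a + t *: v).
  move=> t01; apply: differentiableB; last exact/smooth_at_differentiable/s1.
  by apply: differentiable_shiftv; exact: s3.
have [t t01] := segment_mvt dh.
rewrite /h deriveB; first last.
- exact/diff_derivable/smooth_at_differentiable/s1.
- by apply/diff_derivable/differentiable_shiftv/s3.
rewrite derive_shiftv.
have [t' t01' ->] := @segment_mvt _ ('D_v f) (a + t *: v) w (fun t' t01' =>
  smooth_at_differentiable (smooth_at_derive v (s2 _ _ t01 t01'))).
by move=> E; exists (a + t *: v + t' *: w); [exact: b2|rewrite -E; ring].
Qed.

Lemma eq_common_approx (p q : R) :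
  (forall e, 0 < e -> exists r, `|p - r| < e /\ `|q - r| < e) -> p = q.
Proof.
move=> H; apply/eqP; rewrite -subr_eq0 -normr_le0; apply/ler_addgt0Pl => e e0.
have [|r [pr qr]] := H (e / 2); first by rewrite divr_gt0.
rewrite addr0 (_ : p - q = (p - r) - (q - r)); last by rewrite opprB addrA subrK.
by apply: (le_trans (ler_normB _ _)); lra.
Qed.

Lemma derive_swap1 (V : normedModType R) (f : V -> R) a v w :
  smooth_at f a -> 'D_v ('D_w f) a = 'D_w ('D_v f) a.
Proof.
move=> sf; apply: eq_common_approx => e e20.
pose g1 : V -> R := 'D_w ('D_v f); pose g2 : V -> R := 'D_v ('D_w f).
have sg1 : smooth_at g1 a by exact/smooth_at_derive/smooth_at_derive.
have sg2 : smooth_at g2 a by exact/smooth_at_derive/smooth_at_derive.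
have [d1 d10 dP1] := continuous_ball (smooth_at_continuous sg1) e20.
have [d2 d20 dP2] := continuous_ball (smooth_at_continuous sg2) e20.
have [d3 d30 dP3] := smooth_at_ball sf.
pose d := Num.min d1 (Num.min d2 d3).
have d0 : 0 < d by rewrite !lt_min d10 d20.
have dP x : `|x - a| < d -> [/\ smooth_at f x, `|g1 a - g1 x| < e &
    `|g2 a - g2 x| < e].
  rewrite !lt_min => /and3P[? ? ?].
  by split; [exact: dP3|exact: dP1|exact: dP2].
have [s s0 sd] : exists2 s, 0 < s & `|s *: v| + `|s *: w| < d.
  have n0 : 0 < `|v| + `|w| + 1 by rewrite ltr_wpDl // addr_ge0.
  exists (d / (`|v| + `|w| + 1)); first by rewrite divr_gt0.
  rewrite (normrZ _ v) (normrZ _ w) -mulrDr ger0_norm ?divr_ge0 ?ltW // -mulrA.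
  by rewrite gtr_pMr // [_^-1 * _]mulrC ltr_pdivrMr // mul1r ltrDl.
have smf x : `|x - a| < d -> smooth_at f x by move=> /dP[].
have [x1 x1d E1] := second_difference smf sd.
rewrite addrC in sd; have [x2 x2d E2] := second_difference smf sd.
have {}x1d := le_lt_trans x1d; have {}x2d := le_lt_trans x2d sd.
have {}x1d : `|x1 - a| < d by apply: x1d; rewrite addrC.
have DD (u u' x : V) : `|x - a| < d -> 'D_(s *: u) ('D_(s *: u') f) x = s ^+ 2 * 'D_u ('D_u' f) x.
  move=> xd; have sfx := smf _ xd.
  rewrite derive_scale; last exact/smooth_at_differentiable/smooth_at_derive.
  have -> : 'D_u ('D_(s *: u') f) x = 'D_u (fun y => s *: 'D_u' f y) x.
    have [->|u0] := eqVneq u 0; first by rewrite !derive0.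
    apply: near_eq_derive => //.
    apply: filterS (smooth_at_nbhs sfx) => y sfy.
    by rewrite derive_scale //; exact: smooth_at_differentiable.
  rewrite deriveZ; last exact/diff_derivable/smooth_at_differentiable/smooth_at_derive.
  by rewrite expr2 scalerA.
have : g1 x1 = g2 x2.
  apply: (@mulfI _ (s ^+ 2)); first by rewrite expf_neq0 // gt_eqF.
  apply: etrans (esym (DD w v x1 x1d)) _; apply: etrans (DD v w x2 x2d).
  by rewrite -E1 -E2 (addrAC a (s *: v) (s *: w)) (addrAC _ (- f (a + s *: v))).
move=> D12; have [_ d1x _] := dP _ x1d; have [_ _ d2x] := dP _ x2d.
by exists (g2 x2); split; [exact: d2x|rewrite -D12; exact: d1x].
Qed.

Lemma derive_swap (V : normedModType R) m n (f : V -> 'M[R]_(m, n)) a v w :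
  smooth_at f a -> 'D_v ('D_w f) a = 'D_w ('D_v f) a.
Proof.
suff H u u' i j : smooth_at f a ->
    ('D_u ('D_u' f) a) i j = 'D_u ('D_u' (fun y => f y i j)) a.
  move=> sf; apply/matrixP => i j.
  apply: etrans (H _ _ _ _ sf) _; apply: etrans (esym (H _ _ _ _ sf)).
  by apply: derive_swap1; exact: smooth_at_entry.
move=> sf; rewrite derive_entry; last exact/smooth_at_differentiable/smooth_at_derive.
have [->|u0] := eqVneq u 0; first by rewrite !derive0.
apply: near_eq_derive => //; apply: filterS (smooth_at_nbhs sf) => y sfy.
by rewrite derive_entry //; exact: smooth_at_differentiable.
Qed.

(** * The Poincare lemma for closed one-forms *)

Definition dotc m (u v : 'cV[R]_m) : R := \sum_i u i ord0 * v i ord0.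

Section poincare.
Variables (m : nat) (A : 'cV[R]_m -> 'cV[R]_m) (a : 'cV[R]_m) (d M : R).
Hypothesis sA : forall x, `|x - a| < d -> smooth_at A x.
Hypothesis bA : forall x, `|x - a| < d -> `|A x| <= M.
Hypothesis bDA : forall v, exists K, forall x, `|x - a| < d -> `|'D_v A x| <= K.
Hypothesis clA : forall x v w, `|x - a| < d -> dotc ('D_v A x) w = dotc ('D_w A x) v.

Local Notation mu := (@lebesgue_measure R).

(** The one-form [v |-> dotc (A x) v] integrated along the segment from the center of the ball. *)
Definition line_integral (x : 'cV[R]_m) : R :=
  \int[mu]_(t in `[0, 1]) dotc (A (a + t *: (x - a))) (x - a).

Let Ai i (x : 'cV[R]_m) : R := A x i ord0.
Let DAi v i (x : 'cV[R]_m) : R := 'D_v A x i ord0.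

Let sAi i x : `|x - a| < d -> smooth_at (Ai i) x.
Proof. by move=> xd; apply: smooth_at_entry; exact: sA. Qed.

Let sDAi v i x : `|x - a| < d -> smooth_at (DAi v i) x.
Proof. by move=> xd; apply: smooth_at_entry; apply: smooth_at_derive; exact: sA. Qed.

Let DAiE v i x : `|x - a| < d -> 'D_v (Ai i) x = DAi v i x.
Proof.
by move=> xd; rewrite /DAi derive_entry //; exact/smooth_at_differentiable/sA.
Qed.

Let integrable01 (g : R -> R) :
  (forall t, 0 <= t <= 1 -> derivable g t 1) ->
  mu.-integrable `[0, 1]%classic (EFin \o g).
Proof.
move=> dg; apply: continuous_compact_integrable; first exact: segment_compact.
by apply: derivable_within_continuous => t; rewrite in_itv /= => /dg.
Qed.

Lemma is_derive_line_integral x v : `|x - a| < d ->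
  is_derive x v line_integral (dotc (A x) v).
Proof.
move=> xd; apply/is_derive_line0.
(* For [|s| < u], the point [x + s v] and its segment to [a] stay in the ball. *)
pose u := (d - `|x - a|) / (`|v| + 1).
have n0 : 0 < `|v| + 1 by rewrite ltr_wpDl.
have u0 : 0 < u by rewrite divr_gt0 // subr_gt0.
pose xi s t := a + t *: (x - a) + s *: (t *: v).
have xiE s t : xi s t = a + t *: (x + s *: v - a).
  by apply/matrixP => i j; rewrite /xi !mxE; ring.
have xid (s t : R) : - u < s < u -> 0 <= t <= 1 -> `|xi s t - a| < d.
  move=> su /andP[t0 t1]; rewrite xiE addrAC subrr add0r normrZ ger0_norm //.
  apply: (@le_lt_trans _ _ `|x + s *: v - a|); first by rewrite ler_piMl.
  rewrite addrAC; apply: le_lt_trans (ler_normD _ _) _.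
  rewrite normrZ -ltrBrDl; apply: (@le_lt_trans _ _ (`|s| * (`|v| + 1))).
    by rewrite ler_wpM2l // lerDl.
  by rewrite -ltr_pdivlMr // ltr_norml.
have s0u : - u < 0 < u by rewrite oppr_lt0 u0.
pose f s t := \sum_i Ai i (xi s t) * (x - a + s *: v) i ord0.
pose f' s t := \sum_i (Ai i (xi s t) * v i ord0 +
  (x - a + s *: v) i ord0 * (t * DAi v i (xi s t))).
have df1 (s t : R) : - u < s < u -> 0 <= t <= 1 -> is_derive s (1 : R) (f ^~ t) (f' s t).
  move=> su t01; have xist := xid _ _ su t01.
  have -> : f ^~ t = \sum_i (fun s => Ai i (xi s t) * (x - a + s *: v) i ord0).
    by apply/funext => s'; rewrite fct_sumE.
  apply: is_derive_sum => i.
  have d1 : is_derive s (1 : R) (fun s => Ai i (xi s t)) (t * DAi v i (xi s t)).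
    have sAx := sAi i xist.
    have := is_derive_line (smooth_at_differentiable sAx).
    by rewrite derive_scale ?DAiE //; exact: smooth_at_differentiable.
  have d2 : is_derive s (1 : R) (fun s => (x - a + s *: v) i ord0) (v i ord0).
    have -> : (fun s => (x - a + s *: v) i ord0) =
        (fun s => (x - a) i ord0 + s * v i ord0).
      by apply/funext => s'; rewrite !mxE.
    apply: is_derive_eq; rewrite add0r scaler0 add0r [_ *: _]mulr1.
    by rewrite mul1r.
  by apply: is_derive_eq.
have df2 (s t : R) (w : 'cV[R]_m) : - u < s < u -> 0 <= t <= 1 -> 
    is_derive t (1 : R) (fun t => \sum_i Ai i (xi s t) * w i ord0)
      (\sum_i w i ord0 * DAi (x + s *: v - a) i (xi s t)).
  move=> su t01; have := xid _ _ su t01; rewrite xiE => xist.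
  have -> : (fun t => \sum_i Ai i (xi s t) * w i ord0) =
      \sum_i (fun t => Ai i (a + t *: (x + s *: v - a)) * w i ord0).
    by apply/funext => t'; rewrite fct_sumE; apply: eq_bigr => i _; rewrite xiE.
  apply: is_derive_sum => i.
  have d1 := is_derive_line (smooth_at_differentiable (sAi i xist)).
  rewrite DAiE // in d1.
  by apply: is_derive_eq; rewrite scaler0 add0r.
have EF (s : R) : line_integral (x + s *: v) = \int[mu]_(t in `[0, 1]) f s t.
  apply: eq_Rintegral => t _; rewrite /dotc /f; apply: eq_bigr => i _.
  by rewrite -xiE addrAC.
(* Closedness turns the derivative of the integrand along [v] into the [t]-derivative of [Fv], so
   its integral is [Fv 1 - Fv 0]. *)
pose Fv (t : R) : R := t * (\sum_i Ai i (xi 0 t) * v i ord0).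
have dF2 (t : R) : 0 <= t <= 1 -> is_derive t (1 : R) Fv (f' 0 t).
  move=> t01; have := df2 0 t v s0u t01 => d2.
  apply: is_derive_eq; rewrite [_ *: 1]mulr1 /f'.
  rewrite addrC big_split /=; congr (_ + _).
  have H := clA v (x - a) (xid _ _ s0u t01); rewrite scale0r !addr0.
  transitivity (t * dotc ('D_(x - a) A (xi 0 t)) v).
    by congr (t * _); apply: eq_bigr => i _; rewrite mulrC.
  by rewrite -H /dotc mulr_sumr; apply: eq_bigr => i _; rewrite mulrA mulrC.
have mB : measurable (`[0%R, 1%R]%classic : set R) by exact: measurable_itv.
have [K bK] := bDA v.
have Kx0 : 0 <= K.
  have := bK a; rewrite subrr normr0 => /(_ (le_lt_trans (normr_ge0 _) xd)).
  exact: le_trans.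
have Mx0 : 0 <= M by apply: le_trans (bA xd).
(* A constant bound on the [s]-derivative of the integrand, used as dominating function for
   differentiation under the integral. *)
pose K0 : R := \sum_(i < m) (M * `|v| + (`|x - a| + u * `|v|) * K).
have K00 : 0 <= K0.
  apply: sumr_ge0 => i _; apply: addr_ge0; first exact: mulr_ge0.
  by apply: mulr_ge0 => //; apply: addr_ge0 => //; apply: mulr_ge0 => //; exact: ltW.
have I0 : `]- u, u[%classic (0 : R) by rewrite /= in_itv.
have intf s : `]- u, u[%classic s -> mu.-integrable `[0%R, 1%R]%classic (EFin \o f s).
  rewrite /= in_itv /= => su; apply: integrable01 => t t01.
  by have [] := df2 s t (x - a + s *: v) su t01.
have derf1 s t : `]- u, u[%classic s -> `[0%R, 1%R]%classic t -> derivable (f ^~ t) s 1.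
  by rewrite /= !in_itv /= => su t01; have [] := df1 s t su t01.
have intG : mu.-integrable `[0%R, 1%R]%classic (EFin \o (fun=> K0)).
  by apply: integrable01 => t _; exact: derivable_cst.
have G_ub s t : `]- u, u[%classic s -> `[0%R, 1%R]%classic t ->
    `|partial1of2 f s t| <= K0.
  rewrite /= !in_itv /= => su t01; rewrite partial1of2E.
  have [_ ->] := df1 s t su t01; apply: le_trans (ler_norm_sum _ _ _) _.
  have xist := xid _ _ su t01; have /andP[t0 t1] := t01.
  apply: ler_sum => i _; apply: le_trans (ler_normD _ _) _.
  apply: lerD; rewrite normrM ler_pM //.
  - exact: le_trans (mx_entry_le _ _ _) (bA xist).
  - exact: mx_entry_le.
  - apply: le_trans (mx_entry_le _ _ _) _; apply: le_trans (ler_normD _ _) _.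
    rewrite lerD2l normrZ ler_wpM2r // ltW // ltr_norml; exact: su.
  - rewrite normrM ger0_norm //.
    apply: le_trans (_ : 1 * K <= K); last by rewrite mul1r.
    by apply: ler_pM => //; exact: le_trans (mx_entry_le _ _ _) (bK _ xist).
have G0 (t : R) : 0 <= (fun=> K0) t by [].
have := @derivable_under_integral _ _ _ mu f _ mB 0 (- u) u I0 intf derf1 _ G0 intG G_ub.
have := @differentiation_under_integral _ _ _ mu f _ mB 0 (- u) u I0 intf derf1 _ G0 intG G_ub.
rewrite derive1E => DF dF.
have EF' : (fun s : R => line_integral (x + s *: v)) =
    (fun s => \int[mu]_(t in `[0, 1]) f s t) by apply/funext.
rewrite EF'; apply: DeriveDef => //; apply: etrans DF _.
have Ef' t : `[0%R, 1%R]%classic t -> partial1of2 f 0 t = f' 0 t.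
  by rewrite /= in_itv /= => t01; rewrite partial1of2E; have [_ ->] := df1 0 t s0u t01.
transitivity (\int[mu]_(t in `[0, 1]) f' 0 t).
  by apply: eq_Rintegral => t /set_mem /Ef'.
have cf' : {within `[0, 1], continuous (f' 0)}.
  apply: derivable_within_continuous => t; rewrite in_itv /= => t01.
  have xist := xid _ _ s0u t01.
  have line (g : 'cV[R]_m -> R) : smooth_at g (xi 0 t) ->
      derivable (fun t => g (xi 0 t)) t 1.
    rewrite xiE => /smooth_at_differentiable/is_derive_line[dg _].
    suff -> : (fun t => g (xi 0 t)) = (fun t => g (a + t *: (x + 0 *: v - a))) by [].
    by apply/funext => t'; rewrite xiE.
  rewrite (_ : f' 0 = \sum_i (fun t => (Ai i (xi 0 t) * v i ord0 +
      (x - a + 0 *: v) i ord0 * (t * DAi v i (xi 0 t))))); last first.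
    by apply/funext => t'; rewrite fct_sumE.
  apply: derivable_sum => i; apply: derivableD.
    by apply: derivableM; [exact: line (sAi i xist)|exact: derivable_cst].
  apply: derivableM; first exact: derivable_cst.
  by apply: derivableM; [exact: derivable_id|exact: line (sDAi v i xist)].
rewrite /Rintegral (continuous_FTC2 (F := Fv)) //=.
- rewrite /Fv mul1r mul0r subr0; apply: eq_bigr => i _.
  by rewrite xiE scale1r scale0r addr0 (addrC a) subrK.
- have dcF (t : R) : 0 <= t <= 1 ->{for t, continuous Fv}.
    move=> /dF2[dFt _]; apply: differentiable_continuous.
    exact/derivable1_diffP.
  split=> [t|//|].
  + by rewrite in_itv /= => /andP[/ltW t0 /ltW t1]; have [] := dF2 t; rewrite ?t0.
  + by apply: cvg_at_right_filter; apply: dcF; rewrite lexx ler01.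
  + by apply: cvg_at_left_filter; apply: dcF; rewrite lexx ler01.
- move=> t; rewrite in_itv /= => /andP[/ltW t0 /ltW t1].
  by rewrite derive1E; have [|_ ->] := dF2 t; rewrite ?t0.
Qed.

End poincare.

Lemma dotcDr m (u v w : 'cV[R]_m) : dotc u (v + w) = dotc u v + dotc u w.
Proof. by rewrite /dotc -big_split /=; apply: eq_bigr => i _; rewrite mxE mulrDr. Qed.

Lemma dotcZr m (u v : 'cV[R]_m) c : dotc u (c *: v) = c * dotc u v.
Proof. by rewrite /dotc mulr_sumr; apply: eq_bigr => i _; rewrite mxE mulrCA. Qed.

Lemma dotcBl m (u v w : 'cV[R]_m) : dotc (u - v) w = dotc u w - dotc v w.
Proof. by rewrite /dotc -sumrB; apply: eq_bigr => i _; rewrite !mxE mulrBl. Qed.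

Lemma dotc_le m (u v : 'cV[R]_m) : `|dotc u v| <= m%:R * `|u| * `|v|.
Proof.
apply: le_trans (ler_norm_sum _ _ _) _.
apply: (@le_trans _ _ (\sum_(i < m) `|u| * `|v|)).
  by apply: ler_sum => i _; rewrite normrM ler_pM // mx_entry_le.
by rewrite sumr_const card_ord -mulrA mulr_natl.
Qed.

Fact dotc_is_linear m (u : 'cV[R]_m) : linear (dotc u).
Proof. by move=> c v w; rewrite dotcDr dotcZr. Qed.

(** Directional derivatives alone do not give differentiability. Here they come from a field
    continuous at [a], and the mean value theorem bounds the remainder uniformly in the
    direction. *)
Lemma differentiable_partial m (f : 'cV[R]_m -> R) (A : 'cV[R]_m -> 'cV[R]_m) a d :
  0 < d -> (forall x v, `|x - a| < d -> is_derive x v f (dotc (A x) v)) ->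
  {for a, continuous A} -> differentiable f a.
Proof.
move=> d0 df cA.
pose lM := GRing.isLinear.Build _ _ _ _ _ (dotc_is_linear (A a)).
pose L : {linear 'cV[R]_m -> R} := HB.pack (dotc (A a)) lM.
have cL : continuous L by exact: linear_col_continuous.
have fL : f \o shift a = cst (f a) + L +o_ 0 id.
  apply/eqaddoP => e e0.
  have e'0 : 0 < e / m.+1%:R by rewrite divr_gt0.
  have [d' d'0 Ad'] : exists2 d', 0 < d' &
      forall x, `|x - a| < d' -> `|A a - A x| < e / m.+1%:R.
    by apply: near_ball; move/cvgrPdist_lt : cA; exact.
  have : \forall h \near (0 : 'cV[R]_m), `|h| < Num.min d d'.
    by apply: nbhs0_lt; rewrite lt_min d0.
  apply: filterS => h; rewrite lt_min => /andP[hd hd'].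
  have hb (t r : R) : 0 <= t <= 1 -> `|h| < r -> `|a + t *: h - a| < r.
    move=> /andP[t0 t1]; rewrite addrAC subrr add0r normrZ ger0_norm //.
    by apply: le_lt_trans; rewrite ler_piMl.
  pose g (t : R) : R := f (a + t *: h).
  have dg (t : R) : 0 <= t <= 1 -> is_derive t (1 : R) g (dotc (A (a + t *: h)) h).
    move=> t01; have /is_derive_line0 := df _ h (hb _ _ t01 hd).
    rewrite -{1}(subrr t) => D0.
    have Dt : is_derive t (1 : R) (fun s : R => s - t) 1.
      by apply: is_derive_eq; rewrite subr0.
    have := @is_derive1_comp R (fun s : R => f (a + t *: h + s *: h))
      (fun s : R => s - t) t _ _ D0 Dt; rewrite mulr1.
    rewrite (_ : _ \o _ = g) //; apply/funext => s.
    by rewrite /g /= -addrA -scalerDl (addrC t) subrK.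
  have [||c] := @MVT_segment R g (fun t => dotc (A (a + t *: h)) h) 0 1 ler01.
  - by move=> t; rewrite in_itv /= => /andP[/ltW t0 /ltW t1]; apply: dg; rewrite t0.
  - apply: derivable_within_continuous => t; rewrite in_itv /= => t01.
    by have [] := dg t t01.
  rewrite in_itv /= /g scale1r scale0r addr0 subr0 mulr1 => c01 E.
  rewrite (_ : (_ - _) h = f (a + h) - f a - dotc (A a) h); last first.
    by rewrite !fctE /= [h + a]addrC opprD addrA.
  rewrite E -dotcBl.
  apply: le_trans (dotc_le _ _) _; rewrite ler_wpM2r //.
  have := Ad' _ (hb _ _ c01 hd'); rewrite distrC => /ltW/(ler_wpM2l (ler0n R m)).
  move=> /le_trans; apply; rewrite mulrCA ger_pMr // ler_pdivrMr // mul1r.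
  by rewrite ler_nat.
apply/diff_locallyP; have dE := diff_unique cL fL.
by rewrite dE.
Qed.

Lemma poincare m (A : 'cV[R]_m -> 'cV[R]_m) a : smooth_at A a ->
  (\forall x \near a, forall v w, dotc ('D_v A x) w = dotc ('D_w A x) v) ->
  exists f d, 0 < d /\ forall x, `|x - a| < d ->
    smooth_at f x /\ forall v, 'D_v f x = dotc (A x) v.
Proof.
move=> sA /near_ball[d1 d10 cl].
have [U [oU Ua sU]] := sA.
have [d2 d20 dU] : exists2 d, 0 < d & forall x, `|x - a| < d -> U x.
  by apply: near_ball; exact: open_nbhs_nbhs.
have bound (f : 'cV[R]_m -> 'cV[R]_m) : smooth_at f a ->
    exists2 d, 0 < d & exists K, forall x, `|x - a| < d -> `|f x| <= K.
  move=> sf; have [d d0 fd] : exists2 d, 0 < d &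
      forall x, `|x - a| < d -> `|f a - f x| < 1.
    by apply: near_ball; have /cvgrPdist_lt := smooth_at_continuous sf; apply.
  exists d => //; exists (`|f a| + 1) => x /fd /ltW fx.
  rewrite -[f x](subrK (f a)) addrC; apply: le_trans (ler_normD _ _) _.
  by rewrite lerD2l distrC.
have [d3 d30 [M AM]] := bound _ sA.
have [d4 d40 D4] : exists2 d, 0 < d & forall i, exists K, forall x, `|x - a| < d ->
    `|'D_(delta_mx i ord0) A x| <= K.
  have sD i := smooth_at_derive (delta_mx i ord0 : 'cV[R]_m) sA.
  pose dd i := projT1 (cid2 (bound _ (sD i))).
  have ddP i : 0 < dd i /\ exists K, forall x, `|x - a| < dd i ->
      `|'D_(delta_mx i ord0) A x| <= K by rewrite /dd; case: cid2.
  exists (\big[Num.min/1]_i dd i).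
    by apply/bigmin_gtP; split=> // i _; exact: (ddP i).1.
  move=> i; have [_ [K iK]] := ddP i; exists K => x xd; apply: iK.
  by apply: lt_le_trans xd _; exact: bigmin_le.
pose d := Num.min (Num.min d1 d2) (Num.min d3 d4).
have d0 : 0 < d by rewrite !lt_min d10 d20 d30 d40.
have dP x : `|x - a| < d -> [/\ `|x - a| < d1, `|x - a| < d2, `|x - a| < d3 & `|x - a| < d4].
  by rewrite !lt_min => /andP[/andP[-> ->] /andP[-> ->]].
have sAd x : `|x - a| < d -> smooth_at A x.
  by move=> /dP[_ /dU Ux _ _]; exists U.
have bA x : `|x - a| < d -> `|A x| <= M by move=> /dP[_ _ /AM].
have bDA v : exists K, forall x, `|x - a| < d -> `|'D_v A x| <= K.
  pose K i := projT1 (cid (D4 i)).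
  have KP i x : `|x - a| < d4 -> `|'D_(delta_mx i ord0) A x| <= K i.
    by rewrite /K; case: cid => k; exact.
  exists (\sum_i `|v i ord0| * K i) => x xd.
  rewrite derive_col_sum; last exact/smooth_at_differentiable/sAd.
  apply: le_trans (ler_norm_sum _ _ _) _; apply: ler_sum => i _.
  by rewrite normrZ ler_wpM2l // KP //; have [] := dP _ xd.
have clA x v w : `|x - a| < d -> dotc ('D_v A x) w = dotc ('D_w A x) v.
  by move=> /dP[xd1 _ _ _]; exact: cl.
have df x v (xd : `|x - a| < d) := is_derive_line_integral sAd bA bDA clA v xd.
move: (line_integral A a) df => F df.
exists F, d; split=> // x xd; split; last first.
  by move=> v; have [_ ->] := df x v xd.
have dfx y : `|y - a| < d -> differentiable F y.
  move=> yd.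
  have [r r0 rd] : exists2 r : R, 0 < r & forall z, `|z - y| < r -> `|z - a| < d.
    exists (d - `|y - a|); first by rewrite subr_gt0.
    move=> z zd; rewrite -(subrK y z) -addrA; apply: le_lt_trans (ler_normD _ _) _.
    by rewrite -ltrBrDr.
  have cA : {for y, continuous A} by exact/smooth_at_continuous/sAd.
  have dfr z v (zr : `|z - y| < r) := df z v (rd z zr).
  exact: differentiable_partial r0 dfr cA.
pose B := [set y : 'cV[R]_m | `|y - a| < d].
have oB : open B.
  rewrite (_ : B = ball a d); first exact: ball_open.
  by apply/funext => y; rewrite mx_norm_ball /ball_ /B /= distrC.
exists B; split=> // k; case: k => [|k].
  by move=> y yd; apply: differentiable_continuous; exact: dfx.
split=> [y yd|v]; first exact: dfx.
apply: (@Ck_eq _ _ _ _ _ (\sum_i (fun y => A y i ord0 * v i ord0))) => //.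
  by move=> y yd; rewrite fct_sumE; have [_ ->] := df y v yd.
apply: Ck_sum => // i; apply: Ck_mul => //; last exact: smooth_on_cst.
by apply: Ck_entry => //; apply: Ck_sub (sU k) => y /dP[_ /dU].
Qed.
End mean_value.

(** * Lie groups in coordinates *)

Local Opaque derive.

(** * Chain rules for functions of stacked columns *)

Section chain_rule.
Context {R : realType}.
Implicit Types V W : normedModType R.

Lemma derive_chain V W W' (g : V -> W) (f : W -> W') x v :
  differentiable g x -> differentiable f (g x) ->
  'D_v (fun y => f (g y)) x = 'D_('D_v g x) f (g x).
Proof.
move=> dg df; have dfg : differentiable (fun y => f (g y)) x.
  exact: (differentiable_comp dg df).
rewrite (deriveE _ dfg) (deriveE _ dg) (deriveE _ df).
by rewrite (diff_comp dg df).
Qed.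

Lemma smooth_at_col V m n (p : V -> 'cV[R]_m) (q : V -> 'cV[R]_n) x :
  smooth_at p x -> smooth_at q x -> smooth_at (fun y => col_mx (p y) (q y)) x.
Proof.
move=> sp sq; have := smooth_at_postlin (@col_pair_continuous R m n) (smooth_at_pair sp sq).
exact.
Qed.

Lemma derive_lin V W W' (L : {linear W -> W'}) (f : V -> W) x v :
  continuous L -> differentiable f x ->
  'D_v (fun y => L (f y)) x = L ('D_v f x).
Proof.
move=> cL df; rewrite derive_chain //; last exact: linear_differentiable.
by rewrite deriveE ?diff_lin //; exact: linear_differentiable.
Qed.

Lemma derive_col V m n (p : V -> 'cV[R]_m) (q : V -> 'cV[R]_n) x v :
  differentiable p x -> differentiable q x ->
  'D_v (fun y => col_mx (p y) (q y)) x = col_mx ('D_v p x) ('D_v q x).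
Proof.
move=> dp dq; have dpq := differentiable_pair dp dq.
have := derive_lin v (@col_pair_continuous R m n) dpq.
rewrite /col_pair /= => ->; rewrite deriveE // diff_pair //=.
by rewrite !deriveE.
Qed.

(** A function of two columns is encoded on the stacked column [col_mx]; its partial derivatives are
    those along [col_mx v 0] and [col_mx 0 v]. *)
Lemma derive_chain2 V W m n (p : V -> 'cV[R]_m) (q : V -> 'cV[R]_n)
    (f : 'cV[R]_(m + n) -> W) x v :
  smooth_at p x -> smooth_at q x -> smooth_at f (col_mx (p x) (q x)) ->
  'D_v (fun y => f (col_mx (p y) (q y))) x =
  'D_(col_mx ('D_v p x) ('D_v q x)) f (col_mx (p x) (q x)).
Proof.
move=> sp sq sf; rewrite (derive_chain (g := fun y => col_mx (p y) (q y))).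
- by rewrite derive_col //; exact: smooth_at_differentiable.
- exact/smooth_at_differentiable/smooth_at_col.
- exact: smooth_at_differentiable.
Qed.

Lemma derive_cstE V W (w : W) (x v : V) : 'D_v (fun=> w) x = 0.
Proof. exact: derive_cst. Qed.

Lemma derive_slice2 m n W (f : 'cV[R]_(m + n) -> W) x y v :
  smooth_at f (col_mx x y) ->
  'D_v (fun y => f (col_mx x y)) y = 'D_(col_mx 0 v) f (col_mx x y).
Proof.
move=> sf; have sx : smooth_at (fun _ : 'cV[R]_n => x) y by exact: smooth_at_cst.
have := @derive_chain2 _ _ _ _ (fun=> x) id f y v sx (smooth_at_id y) sf.
by rewrite derive_cstE derive_id.
Qed.

Lemma derive_slice1 m n W (f : 'cV[R]_(m + n) -> W) x y v :
  smooth_at f (col_mx x y) ->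
  'D_v (fun x => f (col_mx x y)) x = 'D_(col_mx v 0) f (col_mx x y).
Proof.
move=> sf; have sy : smooth_at (fun _ : 'cV[R]_m => y) x by exact: smooth_at_cst.
have := @derive_chain2 _ _ _ _ id (fun=> y) f x v (smooth_at_id x) sy sf.
by rewrite derive_cstE derive_id.
Qed.

Lemma derive_near V W (f g : V -> W) x v : (\forall y \near x, f y = g y) ->
  'D_v f x = 'D_v g x.
Proof.
have [->|v0] := eqVneq v 0; first by rewrite !derive0.
by move=> fg; exact: near_eq_derive.
Qed.

Lemma smooth_at_sum V W (I : finType) (f : I -> V -> W) x :
  (forall i, smooth_at (f i) x) -> smooth_at (fun y => \sum_i f i y) x.
Proof.
move=> sf; rewrite (_ : (fun y => _) = \sum_i f i); last first.
  by apply/funext => y; rewrite fct_sumE.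
elim/big_ind: _ => [|g h sg sh|i _] //; first exact: (smooth_at_cst (0 : W)).
exact: smooth_atD.
Qed.

Lemma derive_mulmx V m n p (F : V -> 'M[R]_(m, n)) (G : V -> 'M[R]_(n, p)) x v :
  smooth_at F x -> smooth_at G x ->
  'D_v (fun y => F y *m G y) x = 'D_v F x *m G x + F x *m 'D_v G x.
Proof.
move=> sF sG; have sFG := smooth_at_mulmx sF sG.
apply/matrixP => i j; rewrite derive_entry; last exact: smooth_at_differentiable.
rewrite !mxE -big_split /=.
rewrite (_ : (fun y => _) = \sum_k ((fun y => F y i k) * (fun y => G y k j))); last first.
  by apply/funext => y; rewrite mxE fct_sumE.
have sf k := smooth_at_entry i k sF; have sg k := smooth_at_entry k j sG.
have df k : derivable (fun y => F y i k) x v.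
  exact/diff_derivable/smooth_at_differentiable/sf.
have dg k : derivable (fun y => G y k j) x v.
  exact/diff_derivable/smooth_at_differentiable/sg.
rewrite derive_sum => [|k]; last exact: derivableM.
apply: eq_bigr => k _; rewrite deriveM //.
rewrite !derive_entry; [|exact: smooth_at_differentiable..].
by rewrite addrC; congr (_ + _); exact: mulrC.
Qed.

End chain_rule.

(** * Smooth maps in charts *)

Section smooth_maps.
Context {R : realType}.

Lemma Ck_local (V W : normedModType R) k (A : set V) (f : V -> W) :
  (forall x, A x -> exists B, [/\ open B, B x & Ck k B f]) -> Ck k A f.
Proof.
elim: k f => [|k IHk] f H /=.
  by move=> x /H[B [_ Bx]]; exact.
split=> [x /H[B [_ Bx [+ _]]]|v]; first exact.
by apply: IHk => x /H[B [oB Bx [_ Cf]]]; exists B; split=> //; exact: Cf.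
Qed.

Variables (m n p : nat) (M : manifoldType R m) (N : manifoldType R n)
  (P : manifoldType R p).

Lemma smooth_mapP (f : M -> N) : smooth_map f <->
  continuous f /\ forall x c d, atlas c -> atlas d -> cdom c x -> cdom d (f x) ->
    smooth_at (d \o f \o cinv c) (c x).
Proof.
split=> -[cf sf]; split=> //.
  move=> x c d ac ad cx dx; exists (ccod c `&` cinv c @^-1` (f @^-1` cdom d)).
  split; [exact: smooth_dom_open| |exact: sf].
  by split; [exact: cfun_cod|rewrite /= cfunK].
move=> c d ac ad k; apply: Ck_local => y [cy dy].
have [B [oB By sB]] := sf (cinv c y) c d ac ad (cinv_dom cy) dy.
by rewrite cinvK // in By; exists B.
Qed.

End smooth_maps.

Section smooth_map_constructions.
Context {R : realType}.

Lemma chart_near m (M : manifoldType R m) (c : chart R m M) x (A : set M) :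
  cdom c x -> (\forall y \near x, A y) -> \forall y \near c x, A (cinv c y).
Proof.
move=> cx Ax; have cc := cfun_cod cx.
have := cinv_continuous cc; rewrite /prop_for /continuous_at cfunK //.
exact.
Qed.

Lemma cdom_near (T : topologicalType) m (c : chart R m T) x :
  cdom c x -> \forall y \near x, cdom c y.
Proof. by move=> cx; apply: open_nbhs_nbhs; split=> //; exact: cdom_open. Qed.

Lemma smooth_map_comp m n p (M : manifoldType R m) (N : manifoldType R n)
    (P : manifoldType R p) (f : M -> N) (g : N -> P) :
  smooth_map f -> smooth_map g -> smooth_map (fun x => g (f x)).
Proof.
move=> /smooth_mapP[cf sf] /smooth_mapP[cg sg]; apply/smooth_mapP; split.
  by move=> x; apply: continuous_comp; [exact: cf|exact: cg].
move=> x c d ac ad cx dx; have [b ab bx] := @atlas_cover R n N (f x).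
have s1 := sf x c b ac ab cx bx; have s2 := sg (f x) b d ab ad bx dx.
have := smooth_at_comp (g := b \o f \o cinv c) (f := d \o g \o cinv b) s1.
rewrite /= cfunK // => /(_ s2); apply: smooth_at_eq.
have : \forall y \near x, cdom b (f y) by apply: cf; exact: cdom_near.
by move=> /(chart_near cx); apply: filterS => y /= /cfunK ->.
Qed.

Lemma smooth_map_id m (M : manifoldType R m) : smooth_map (@id M).
Proof.
split; first by move=> x A.
move=> c d ac ad; have := @atlas_smooth R m M c d ac ad; exact.
Qed.

Lemma smooth_map_cst m n (M : manifoldType R m) (N : manifoldType R n) (y : N) :
  smooth_map (fun _ : M => y).
Proof.
by apply/smooth_mapP; split=> [|x c d ac ad cx dy];
  [exact: cst_continuous|exact: smooth_at_cst].
Qed.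

Lemma smooth_map_pair m n p (M : manifoldType R m) (N : manifoldType R n)
    (P : manifoldType R p) (f : M -> N) (g : M -> P) :
  smooth_map f -> smooth_map g -> smooth_map (fun x => (f x, g x) : N * P).
Proof.
move=> /smooth_mapP[cf sf] /smooth_mapP[cg sg]; apply/smooth_mapP; split.
  by move=> x; apply: cvg_pair; [exact: cf|exact: cg].
move=> x c _ ac [[d1 d2] [/= ad1 ad2] <-] cx [/= dx1 dx2].
exact: smooth_at_col (sf x c d1 ac ad1 cx dx1) (sg x c d2 ac ad2 cx dx2).
Qed.

Lemma smooth_map_fst m n (M : manifoldType R m) (N : manifoldType R n) :
  smooth_map (fun x : M * N => x.1).
Proof.
apply/smooth_mapP; split; first by move=> x; exact: cvg_fst.
move=> x _ d [[c1 c2] [/= ac1 ac2] <-] ad [/= cx1 cx2] dx.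
have /smooth_mapP[_ /(_ x.1 c1 d ac1 ad cx1 dx) s] := smooth_map_id M.
apply: (smooth_at_comp (g := usubmx) (f := d \o id \o cinv c1)).
  exact/smooth_at_lin/usubmx_continuous.
by rewrite /= /col_pair /= col_mxKu.
Qed.

Lemma smooth_map_snd m n (M : manifoldType R m) (N : manifoldType R n) :
  smooth_map (fun x : M * N => x.2).
Proof.
apply/smooth_mapP; split; first by move=> x; exact: cvg_snd.
move=> x _ d [[c1 c2] [/= ac1 ac2] <-] ad [/= cx1 cx2] dx.
have /smooth_mapP[_ /(_ x.2 c2 d ac2 ad cx2 dx) s] := smooth_map_id N.
apply: (smooth_at_comp (g := dsubmx) (f := d \o id \o cinv c2)).
  exact/smooth_at_lin/dsubmx_continuous.
by rewrite /= /col_pair /= col_mxKd.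
Qed.

Lemma smooth_mulg m n (M : manifoldType R m) (G : lieGroupType R n) (f g : M -> G) :
  smooth_map f -> smooth_map g -> smooth_map (fun x => (f x * g x)%g).
Proof.
move=> sf sg; exact: (smooth_map_comp (smooth_map_pair sf sg) (@mulg_smooth R n G)).
Qed.

Lemma smooth_invg m n (M : manifoldType R m) (G : lieGroupType R n) (f : M -> G) :
  smooth_map f -> smooth_map (fun x => (f x)^-1%g).
Proof. by move=> sf; exact: (smooth_map_comp sf (@invg_smooth R n G)). Qed.

Lemma smooth_conjg n (G : lieGroupType R n) (g : G) :
  smooth_map (fun x : G => (g * x * g^-1)%g).
Proof.
have sg := @smooth_map_cst _ _ G G g.
have sg' := @smooth_map_cst _ _ G G g^-1%g.
exact: smooth_mulg (smooth_mulg sg (smooth_map_id G)) sg'.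
Qed.

End smooth_map_constructions.

Section near2.
Context {R : realType}.

Lemma col_mx_norm_lt m n (u : 'cV[R]_m) (v : 'cV[R]_n) d :
  `|u| < d -> `|v| < d -> `|col_mx u v| < d.
Proof.
move=> ud vd; apply: (@le_lt_trans _ _ (Num.max `|u| `|v|)); last by rewrite gt_max ud.
apply: mx_norm_le => [|i j]; first by rewrite le_max normr_ge0.
rewrite le_max; case: (split_ordP i) => k ->; rewrite ?col_mxEu ?col_mxEd mx_entry_le //.
by rewrite orbT.
Qed.

Lemma near2_ball m n (a : 'cV[R]_m) (b : 'cV[R]_n) (P : 'cV[R]_(m + n) -> Prop) :
  (\forall z \near col_mx a b, P z) ->
  exists2 d, 0 < d & forall x y, `|x - a| < d -> `|y - b| < d -> P (col_mx x y).
Proof.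
move=> /near_ball[d d0 dP]; exists d => // x y xd yd; apply: dP.
by rewrite opp_col_mx add_col_mx; exact: col_mx_norm_lt.
Qed.

Lemma ball_near (V : normedModType R) (a : V) d (P : V -> Prop) : 0 < d ->
  (forall x, `|x - a| < d -> P x) -> \forall x \near a, P x.
Proof.
move=> d0 dP; apply/nbhs_ballP; exists d => //= x; rewrite -ball_normE /= distrC.
exact: dP.
Qed.

End near2.

(** * Tangent maps at the identity *)

Section tangent.
Context {R : realType}.

Definition based n (G : lieGroupType R n) (c : chart R n G) :=
  atlas c /\ cdom c 1%g.

Lemma chart1_based n (G : lieGroupType R n) : based (chart1 G).
Proof. by split; rewrite /chart1; case: cid2. Qed.

(** The differential at 1 of a map sending 1 to 1, when [c] and [d] are charts around the
    identities. *)
Definition tmap m n (G : lieGroupType R m) (H : lieGroupType R n)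
    (c : chart R m G) (d : chart R n H) (f : G -> H) (v : 'cV[R]_m) : 'cV[R]_n :=
  'D_v (fun y => d (f (cinv c y))) (c 1%g).

Lemma coord_smooth m n (M : manifoldType R m) (H : lieGroupType R n)
    (c : chart R m M) (d : chart R n H) (f : M -> H) x :
  atlas c -> cdom c x -> based d -> smooth_map f -> f x = 1%g ->
  smooth_at (fun y => d (f (cinv c y))) (c x).
Proof.
move=> ac cx [ad d1] /smooth_mapP[_ sf] fx; apply: (sf x c d) => //.
by rewrite fx.
Qed.

Lemma coord_near m n (M : manifoldType R m) (H : lieGroupType R n)
    (c : chart R m M) (d : chart R n H) (f : M -> H) x :
  cdom c x -> based d -> smooth_map f -> f x = 1%g ->
  \forall y \near c x, cinv d (d (f (cinv c y))) = f (cinv c y).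
Proof.
move=> cx [ad d1] [cf _] fx.
have : \forall y \near x, cdom d (f y) by apply: cf; rewrite fx; exact: cdom_near.
by move=> /(chart_near cx); apply: filterS => y /= /cfunK.
Qed.

Variables (l m n : nat) (F : lieGroupType R l) (G : lieGroupType R m)
  (H : lieGroupType R n).
Variables (b : chart R l F) (c : chart R m G) (d : chart R n H).
Hypotheses (bb : based b) (bc : based c) (bd : based d).

Lemma tmap_smooth (f : G -> H) : smooth_map f -> f 1%g = 1%g ->
  smooth_at (fun y => d (f (cinv c y))) (c 1%g).
Proof. by case: bc => ac c1; exact: coord_smooth. Qed.

Lemma tmap_is_linear (f : G -> H) : smooth_map f -> f 1%g = 1%g ->
  linear (tmap c d f).
Proof.
move=> sf f1 a u v; have df := smooth_at_differentiable (tmap_smooth sf f1).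
by rewrite /tmap derive_addv // derive_scale.
Qed.

Lemma tmap_comp (f : F -> G) (g : G -> H) : smooth_map f -> smooth_map g ->
  f 1%g = 1%g -> g 1%g = 1%g ->
  forall v, tmap b d (fun x => g (f x)) v = tmap c d g (tmap b c f v).
Proof.
move=> sf sg f1 g1 v; rewrite /tmap.
transitivity ('D_v (fun y => (d \o g \o cinv c) (c (f (cinv b y)))) (b 1%g)).
  apply: derive_near.
  by have := coord_near bb.2 bc sf f1; apply: filterS => y /= ->.
have s1 : smooth_at (fun y => c (f (cinv b y))) (b 1%g).
  by case: bb => ab b1; exact: coord_smooth.
rewrite derive_chain; [|exact: smooth_at_differentiable|].
  by rewrite (cfunK bb.2) f1.
rewrite (cfunK bb.2) f1; exact: smooth_at_differentiable (tmap_smooth sg g1).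
Qed.

End tangent.

(** * The adjoint action and the bracket in a chart *)

Section lie_coordinates.
Context {R : realType} (n : nat) (G : lieGroupType R n) (c : chart R n G).
Hypothesis bc : based c.
Let e := c 1%g.

Lemma tmap_id v : tmap c c id v = v.
Proof.
rewrite /tmap -[RHS](derive_id e v); apply: derive_near.
have := open_nbhs_nbhs (conj (@ccod_open _ _ _ c) (cfun_cod bc.2)).
by apply: filterS => y /cinvK.
Qed.

(** [Ad] for any chart at the identity instead of [chart1]: the semidirect product is computed in a
    product chart. *)
Definition AdC (g : G) : 'cV[R]_n -> 'cV[R]_n := tmap c c (fun x => g * x * g^-1)%g.

Definition bracketC (X Y : 'cV[R]_n) : 'cV[R]_n :=
  'D_X (fun x => AdC (cinv c x) Y) e.

Let conj1 g : (g * 1 * g^-1 = 1 :> G)%g. Proof. by rewrite mulg1 mulgV. Qed.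

Lemma AdC_is_linear g : linear (AdC g).
Proof. exact: (tmap_is_linear bc bc (smooth_conjg g) (conj1 g)). Qed.

Lemma AdCM g h v : AdC (g * h)%g v = AdC g (AdC h v).
Proof.
rewrite /AdC -(tmap_comp bc bc bc) //; [|exact: smooth_conjg..].
by congr (tmap _ _ _ v); apply/funext => x; rewrite invgM !mulgA.
Qed.

Lemma AdC1 v : AdC 1%g v = v.
Proof.
rewrite -[RHS]tmap_id; congr (tmap _ _ _ v); apply/funext => x.
by rewrite mul1g invg1 mulg1.
Qed.

Section two_variables.
Variables (f : G * G -> G).
Hypotheses (sf : smooth_map f) (f1 : f (1%g, 1%g) = 1%g).

Definition coord2 (z : 'cV[R]_(n + n)) : 'cV[R]_n :=
  c (f (cinv c (usubmx z), cinv c (dsubmx z))).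

Lemma coord2_smooth : smooth_at coord2 (col_mx e e).
Proof.
have ac2 : @atlas R (n + n)%N (G * G)%type (prod_chart c c).
  by exists (c, c) => //; split; exact: bc.1.
have := @coord_smooth R (n + n) n (G * G)%type G (prod_chart c c) c f (1%g, 1%g) ac2.
by apply=> //; split; exact: bc.2.
Qed.

Lemma coord2_near : \forall z \near col_mx e e,
  cinv c (coord2 z) = f (cinv c (usubmx z), cinv c (dsubmx z)).
Proof.
have := @coord_near R (n + n) n (G * G)%type G (prod_chart c c) c f (1%g, 1%g).
by apply=> //; split; exact: bc.2.
Qed.

Lemma coord2E x y : coord2 (col_mx x y) = c (f (cinv c x, cinv c y)).
Proof. by rewrite /coord2 col_mxKu col_mxKd. Qed.

Lemma coord2_ball : exists2 d, 0 < d & forall x y, `|x - e| < d -> `|y - e| < d ->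
  smooth_at coord2 (col_mx x y) /\
  cinv c (coord2 (col_mx x y)) = f (cinv c x, cinv c y).
Proof.
pose P z := smooth_at coord2 z /\
  cinv c (coord2 z) = f (cinv c (usubmx z), cinv c (dsubmx z)).
have : \forall z \near col_mx e e, P z.
  near=> z; split; near: z; last exact: coord2_near.
  exact: smooth_at_nbhs coord2_smooth.
move=> /near2_ball[d d0 dP]; exists d => // x y xd yd.
by have [s] := dP x y xd yd; rewrite col_mxKu col_mxKd.
Unshelve. all: by end_near. Qed.

End two_variables.

Let fst2 := @smooth_map_fst R n n G G.
Let snd2 := @smooth_map_snd R n n G G.

Definition mulC : 'cV[R]_(n + n) -> 'cV[R]_n := coord2 (fun p => p.1 * p.2)%g.
Definition conjC : 'cV[R]_(n + n) -> 'cV[R]_n := coord2 (fun p => p.1 * p.2 * p.1^-1)%g.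
Definition ldivC : 'cV[R]_(n + n) -> 'cV[R]_n := coord2 (fun p => p.1^-1 * p.2)%g.

Lemma smul2 : smooth_map (fun p : G * G => p.1 * p.2)%g.
Proof. exact: mulg_smooth. Qed.

Lemma sconj2 : smooth_map (fun p : G * G => p.1 * p.2 * p.1^-1)%g.
Proof. exact: smooth_mulg smul2 (smooth_invg fst2). Qed.

Lemma sldiv2 : smooth_map (fun p : G * G => p.1^-1 * p.2)%g.
Proof. exact: smooth_mulg (smooth_invg fst2) snd2. Qed.

Let cinv_e : cinv c e = 1%g. Proof. exact: cfunK bc.2. Qed.

Lemma chart_ball : exists2 d, 0 < d & forall x, `|x - e| < d -> c (cinv c x) = x.
Proof.
apply: near_ball; have := open_nbhs_nbhs (conj (@ccod_open _ _ _ c) (cfun_cod bc.2)).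
by apply: filterS => y /cinvK.
Qed.

Lemma AdC_coord x v : smooth_at conjC (col_mx x e) ->
  AdC (cinv c x) v = 'D_(col_mx 0 v) conjC (col_mx x e).
Proof.
move=> s; rewrite /AdC /tmap.
have -> : (fun y => c (cinv c x * cinv c y * (cinv c x)^-1)%g) =
    (fun y => conjC (col_mx x y)) by apply/funext => y; rewrite /conjC coord2E.
exact: derive_slice2.
Qed.

Lemma conjC_ball : exists2 d, 0 < d & forall x, `|x - e| < d ->
  smooth_at conjC (col_mx x e).
Proof.
have [|d d0 dP] := coord2_ball sconj2; first by rewrite /= mulg1 mulgV.
by exists d => // x xd; have [|//] := dP x e xd; rewrite subrr normr0.
Qed.

Lemma AdC_smooth Y : smooth_at (fun x => AdC (cinv c x) Y) e.
Proof.
have [d d0 dP] := conjC_ball.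
apply: (@smooth_at_eq _ _ _ (fun x => 'D_(col_mx 0 Y) conjC (col_mx x e))).
  by apply: (ball_near d0) => x /dP s; rewrite AdC_coord.
pose D : 'cV[R]_(n + n) -> 'cV[R]_n := 'D_(col_mx 0 Y) conjC.
have s1 : smooth_at (fun x : 'cV[R]_n => col_mx x e) e.
  by apply: smooth_at_col; [exact: smooth_at_id|exact: smooth_at_cst].
have s2 : smooth_at D (col_mx e e).
  by apply: smooth_at_derive; apply: dP; rewrite subrr normr0.
exact: (smooth_at_comp s1 s2).
Qed.

Definition Admx (g : G) : 'M[R]_n := \matrix_(i, j) AdC g (delta_mx j ord0) i ord0.

Lemma AdmxE g v : AdC g v = Admx g *m v.
Proof.
pose lM := GRing.isLinear.Build _ _ _ _ _ (AdC_is_linear g).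
pose L : {linear 'cV[R]_n -> 'cV[R]_n} := HB.pack (AdC g) lM.
rewrite [LHS](linear_col_sum L); apply/colP => i.
rewrite !mxE summxE; apply: eq_bigr => j _.
by rewrite !mxE mulrC; congr (_ * v _ _); rewrite (ord1 _).
Qed.

Lemma mx_ext m (A B : 'M[R]_(m, n)) : (forall v : 'cV[R]_n, A *m v = B *m v) -> A = B.
Proof.
move=> AB; apply/matrixP => i j; have := AB (delta_mx j ord0).
by rewrite -!colE => /colP/(_ i); rewrite !mxE.
Qed.

Lemma AdmxM g h : Admx (g * h)%g = Admx g *m Admx h.
Proof. by apply: mx_ext => v; rewrite -mulmxA -!AdmxE AdCM. Qed.

Lemma Admx1 : Admx 1%g = 1%:M.
Proof. by apply: mx_ext => v; rewrite -AdmxE AdC1 mul1mx. Qed.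

Lemma Admx_smooth : smooth_at (fun x => Admx (cinv c x)) e.
Proof.
apply: smooth_at_mx => i j.
have := smooth_at_entry i ord0 (AdC_smooth (delta_mx j ord0)).
suff -> : (fun y => Admx (cinv c y) i j) =
    (fun y => AdC (cinv c y) (delta_mx j ord0) i ord0) by [].
by apply/funext => y; rewrite mxE.
Qed.

Definition dmx k (tau : G -> 'M[R]_k) (X : 'cV[R]_n) : 'M[R]_k :=
  'D_X (fun x => tau (cinv c x)) e.

Lemma bracketE X Y : bracketC X Y = dmx Admx X *m Y.
Proof.
rewrite /bracketC (_ : (fun x => _) = (fun x => Admx (cinv c x) *m Y)); last first.
  by apply/funext => x; rewrite AdmxE.
rewrite (derive_mulmx (G := fun=> Y)); [|exact: Admx_smooth|exact: smooth_at_cst].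
by rewrite derive_cstE mulmx0 addr0.
Qed.

Section representations.
Variables (k : nat) (tau : G -> 'M[R]_k).
Hypotheses (tauM : forall g h, tau (g * h)%g = tau g *m tau h)
  (tau1 : tau 1%g = 1%:M) (stau : smooth_at (fun x => tau (cinv c x)) e).

Lemma dmx_is_linear : linear (dmx tau).
Proof.
move=> a u v; have df := smooth_at_differentiable stau.
by rewrite /dmx derive_addv // derive_scale.
Qed.

Lemma dmx_curve m (f : 'cV[R]_m -> G) p v : smooth_at (fun x => c (f x)) p ->
  f p = 1%g -> (\forall x \near p, cdom c (f x)) ->
  'D_v (fun x => tau (f x)) p = dmx tau ('D_v (fun x => c (f x)) p).
Proof.
move=> sf fp nf.
transitivity ('D_v (fun x => tau (cinv c (c (f x)))) p).
  by apply: derive_near; move: nf; apply: filterS => x /cfunK ->.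
rewrite (derive_chain (g := fun x => c (f x)) (f := fun x => tau (cinv c x))).
- by rewrite /dmx fp.
- exact: smooth_at_differentiable.
- by rewrite fp; exact: smooth_at_differentiable.
Qed.

Lemma dmx_Ad g X : dmx tau (AdC g X) *m tau g = tau g *m dmx tau X.
Proof.
have sg := smooth_conjg g.
have H := @dmx_curve n (fun x => g * cinv c x * g^-1)%g e X.
have s1 := tmap_smooth bc bc sg (conj1 g).
have {H}H := H s1.
have nd : \forall x \near e, cdom c (g * cinv c x * g^-1)%g.
  have : \forall x \near (1%g : G), cdom c (g * x * g^-1)%g.
    by apply: sg.1; rewrite conj1; exact: cdom_near bc.2.
  by move=> /(chart_near bc.2).
rewrite /AdC /tmap -H //; last by rewrite cinv_e conj1.
have -> : (fun x => tau (g * cinv c x * g^-1)%g) =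
    (fun x => tau g *m tau (cinv c x) *m tau g^-1%g).
  by apply/funext => x; rewrite !tauM.
have scst (A : 'M[R]_k) : smooth_at (fun=> A) e by exact: smooth_at_cst.
rewrite (derive_mulmx (G := fun=> tau g^-1%g)) //; last exact: smooth_at_mulmx.
rewrite (derive_mulmx (F := fun=> tau g)) // !derive_cstE mulmx0 mul0mx add0r addr0.
by rewrite -!mulmxA -tauM mulVg tau1 mulmx1.
Qed.

(** Differentiate [dmx (Ad x Y) *m tau x = tau x *m dmx Y] at [x = 1] in the direction [X]. *)
Lemma dmx_bracket X Y : dmx tau (bracketC X Y) =
  dmx tau X *m dmx tau Y - dmx tau Y *m dmx tau X.
Proof.
have D : (fun x => dmx tau (AdC (cinv c x) Y) *m tau (cinv c x)) =
    (fun x => tau (cinv c x) *m dmx tau Y).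
  by apply/funext => x; rewrite dmx_Ad.
have := congr1 (fun f => 'D_X f e) D; have sA := AdC_smooth Y.
pose lM := GRing.isLinear.Build _ _ _ _ _ dmx_is_linear.
pose L : {linear 'cV[R]_n -> 'M[R]_k} := HB.pack (dmx tau) lM.
have cL : continuous L by exact: linear_col_continuous.
rewrite (derive_mulmx (F := fun x => dmx tau (AdC (cinv c x) Y))) //; last first.
  exact: (smooth_at_postlin cL sA).
rewrite (derive_mulmx (G := fun=> dmx tau Y)) //; last exact: smooth_at_cst.
rewrite derive_cstE mulmx0 addr0 (derive_lin (L := L)) //; last first.
  exact: smooth_at_differentiable.
have E1 : tau (cinv c e) = 1%:M by rewrite cinv_e.
have E2 : AdC (cinv c e) Y = Y by rewrite cinv_e AdC1.
rewrite E1 E2 => H.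
have <- : dmx tau (bracketC X Y) *m 1%:M + dmx tau Y *m dmx tau X =
  dmx tau X *m dmx tau Y by exact: H.
by rewrite mulmx1 addrK.
Qed.

End representations.

Local Opaque dmx Admx AdC bracketC.

(** The Jacobi identity in this form holds because [ad] is the differential of the representation
    [Ad]. *)
Lemma bracketC_ad X Y Z : bracketC (bracketC X Y) Z =
  bracketC X (bracketC Y Z) - bracketC Y (bracketC X Z).
Proof.
rewrite [LHS]bracketE (dmx_bracket AdmxM Admx1 Admx_smooth) mulmxBl.
rewrite (bracketE Y Z) (bracketE X Z).
rewrite (bracketE X (_ *m Z)).
rewrite (bracketE Y (_ *m Z)).
by move: (dmx Admx X) (dmx Admx Y) => A B; rewrite -2!mulmxA.
Qed.

End lie_coordinates.

Lemma AdCE (R : realType) n (G : lieGroupType R n) (c : chart R n G) (g : G) v :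
  AdC c g v = 'D_v (fun y => c (g * cinv c y * g^-1)%g) (c 1%g).
Proof. by []. Qed.
Lemma bracketCE (R : realType) n (G : lieGroupType R n) (c : chart R n G) X Y :
  bracketC c X Y = 'D_X (fun x => AdC c (cinv c x) Y) (c 1%g).
Proof. by []. Qed.
Lemma dmxE (R : realType) n (G : lieGroupType R n) (c : chart R n G) k (tau : G -> 'M[R]_k) X :
  dmx c tau X = 'D_X (fun x => tau (cinv c x)) (c 1%g).
Proof. by []. Qed.
Lemma lie_bracketE (R : realType) n (G : lieGroupType R n) :
  @lie_bracket R n G = bracketC (chart1 G).
Proof. by []. Qed.

Local Opaque dmx Admx AdC bracketC.

(** * Second derivatives of the product and antisymmetry of the bracket *)

Section moving_direction.
Context {R : realType}.

Lemma near_smooth_at (V W X : normedModType R) (g : V -> W) (f : W -> X) x :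
  smooth_at g x -> smooth_at f (g x) -> \forall y \near x, smooth_at f (g y).
Proof. by move=> sg sf; exact: (smooth_at_continuous sg (smooth_at_nbhs sf)). Qed.

(** A product rule: ['D_(a y) f (g y)] is the Jacobian matrix of [f] at [g y] applied to [a y]. *)
Lemma derive_moving m k p (g : 'cV[R]_m -> 'cV[R]_k) (a : 'cV[R]_m -> 'cV[R]_k)
    (f : 'cV[R]_k -> 'cV[R]_p) x v :
  smooth_at g x -> smooth_at a x -> smooth_at f (g x) ->
  'D_v (fun y => 'D_(a y) f (g y)) x =
  'D_('D_v a x) f (g x) + 'D_('D_v g x) ('D_(a x) f) (g x).
Proof.
move=> sg sa sf; pose J z : 'M[R]_(p, k) := \matrix_(i, j) 'D_(delta_mx j ord0) f z i ord0.
have JE z w : smooth_at f z -> 'D_w f z = J z *m w.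
  move=> sz; rewrite derive_col_sum; last exact: smooth_at_differentiable.
  apply/colP => i; rewrite summxE !mxE; apply: eq_bigr => j _.
  by rewrite !mxE mulrC.
have sJ : smooth_at J (g x).
  apply: smooth_at_mx => i j.
  have := smooth_at_entry i ord0 (smooth_at_derive (delta_mx j ord0) sf).
  suff -> : (fun y => J y i j) = (fun y => 'D_(delta_mx j ord0) f y i ord0) by [].
  by apply/funext => y; rewrite mxE.
have sJg : smooth_at (fun y => J (g y)) x by exact: smooth_at_comp sg sJ.
have ng : \forall y \near x, smooth_at f (g y).
  exact: near_smooth_at.
transitivity ('D_v (fun y => J (g y) *m a y) x).
  by apply: derive_near; move: ng; apply: filterS => y /JE ->.
rewrite derive_mulmx // addrC -JE //; congr (_ + _).
have scst : smooth_at (fun=> a x) x by exact: smooth_at_cst.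
transitivity ('D_v (fun y => J (g y) *m a x) x).
  by rewrite (derive_mulmx v sJg scst) derive_cstE mulmx0 addr0.
transitivity ('D_v (fun y => 'D_(a x) f (g y)) x).
  by apply: derive_near; move: ng; apply: filterS => y /JE ->.
rewrite (derive_chain (f := 'D_(a x) f)) //; first exact: smooth_at_differentiable.
exact/smooth_at_differentiable/smooth_at_derive.
Qed.

End moving_direction.

Section antisymmetry.
Context {R : realType} (n : nat) (G : lieGroupType R n) (c : chart R n G).
Hypothesis bc : based c.
Let e := c 1%g.
Let m := mulC c.

Lemma cinv_base : cinv c e = 1%g. Proof. exact: cfunK bc.2. Qed.

Lemma in_ball0 (d : R) (x : 'cV[R]_n) : 0 < d -> `|x - x| < d.
Proof. by rewrite subrr normr0. Qed.

Lemma mulC_ball : exists2 d, 0 < d & forall x y, `|x - e| < d -> `|y - e| < d ->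
  [/\ smooth_at m (col_mx x y), cinv c (m (col_mx x y)) = (cinv c x * cinv c y)%g,
      c (cinv c x) = x & m (col_mx x y) = c (cinv c x * cinv c y)%g].
Proof.
have [|d1 d10 dP] := coord2_ball bc (smul2 G); first by rewrite /= mulg1.
have [d2 d20 dQ] := chart_ball bc.
exists (Num.min d1 d2); first by rewrite lt_min d10.
move=> x y; rewrite !lt_min => /andP[x1 x2] /andP[y1 y2].
by have [? ?] := dP _ _ x1 y1; split=> //; [exact: dQ|rewrite /m /mulC coord2E].
Qed.

Lemma mulCe : \forall x \near e, m (col_mx x e) = x.
Proof.
have [d d0 dP] := mulC_ball; apply: (ball_near d0) => x xd.
by have [_ _ cx ->] := dP x e xd (in_ball0 _ d0); rewrite cinv_base mulg1.
Qed.

Lemma muleC : \forall x \near e, m (col_mx e x) = x.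
Proof.
have [d d0 dP] := mulC_ball; apply: (ball_near d0) => x xd.
have [_ _ _ ->] := dP e x (in_ball0 _ d0) xd; have [_ _ cx _] := dP x e xd (in_ball0 _ d0).
by rewrite cinv_base mul1g.
Qed.

Lemma mulC_smooth : smooth_at m (col_mx e e).
Proof. by have [d d0 dP] := mulC_ball; have [] := dP e e (in_ball0 _ d0) (in_ball0 _ d0). Qed.

Lemma mulC_derive1 v : 'D_(col_mx v 0) m (col_mx e e) = v.
Proof.
rewrite -derive_slice1; last exact: mulC_smooth.
by rewrite (derive_near (g := id)) ?derive_id //; exact: mulCe.
Qed.

Lemma mulC_derive2 v : 'D_(col_mx 0 v) m (col_mx e e) = v.
Proof.
rewrite -derive_slice2; last exact: mulC_smooth.
by rewrite (derive_near (g := id)) ?derive_id //; exact: muleC.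
Qed.

Definition mulC2 (X Y : 'cV[R]_n) : 'cV[R]_n :=
  'D_(col_mx X 0) ('D_(col_mx 0 Y) m) (col_mx e e).

(** Differentiate [(x y x^-1) x = x y] in [y] at 1, then in [x] at 1: the left side yields the
    bracket plus [mulC2 Y X], the right side [mulC2 X Y]. *)
Lemma bracket_mulC2 X Y : bracketC c X Y = mulC2 X Y - mulC2 Y X.
Proof.
have sAd := AdC_smooth bc Y.
pose a (x : 'cV[R]_n) : 'cV[R]_(n + n) := col_mx (AdC c (cinv c x) Y) 0.
have sa : smooth_at a e by apply: smooth_at_col => //; exact: smooth_at_cst.
have se : smooth_at (fun x : 'cV[R]_n => col_mx e x) e.
  by apply: smooth_at_col; [exact: smooth_at_cst|exact: smooth_at_id].
have sm := mulC_smooth.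
have E : \forall x \near e, 'D_(a x) m (col_mx e x) = 'D_(col_mx 0 Y) m (col_mx x e).
  have [d1 d10 dP1] := mulC_ball.
  have [|d2 d20 dP2] := coord2_ball bc (sconj2 G); first by rewrite /= mulg1 mulgV.
  have d0 : 0 < Num.min d1 d2 by rewrite lt_min d10.
  apply: (ball_near d0) => x; rewrite lt_min => /andP[x1 x2].
  have [smxe _ _ _] := dP1 x e x1 (in_ball0 _ d10).
  have [smex _ _ _] := dP1 e x (in_ball0 _ d10) x1.
  have [sK _] := dP2 x e x2 (in_ball0 _ d20).
  pose p y := c (cinv c x * cinv c y * (cinv c x)^-1)%g.
  have pK y : p y = conjC c (col_mx x y) by rewrite /conjC coord2E.
  have pe : p e = e by rewrite /p cinv_base mulg1 mulgV.
  have sp : smooth_at p e.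
    have s1 : smooth_at (fun y : 'cV[R]_n => col_mx x y) e.
      by apply: smooth_at_col; [exact: smooth_at_cst|exact: smooth_at_id].
    have := smooth_at_comp s1 sK.
    suff -> : p = (fun y => conjC c (col_mx x y)) by [].
    by apply/funext.
  rewrite -(derive_slice2 Y smxe).
  transitivity ('D_Y (fun y => m (col_mx (p y) x)) e).
    have sx : smooth_at (fun _ : 'cV[R]_n => x) e by exact: smooth_at_cst.
    have smp : smooth_at m (col_mx (p e) x) by rewrite pe.
    have H := derive_chain2 Y sp sx smp; apply: etrans (esym H).
    by rewrite derive_cstE pe /a; congr ('D_(col_mx _ _) _ _).
  apply: derive_near.
  have : \forall y \near e, `|p y - e| < d1.
    have := smooth_at_continuous sp; rewrite /prop_for /continuous_at pe.
    move=> /cvgrPdist_lt/(_ _ d10); apply: filterS => y.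
    by rewrite distrC.
  have : \forall y \near e, `|y - e| < Num.min d1 d2 by exact: (ball_near d0).
  apply: filterS2 => y; rewrite lt_min => /andP[y1 y2] pyd.
  have [_ _ _ ->] := dP1 (p y) x pyd x1.
  have [_ _ _ ->] := dP1 x y x1 y1.
  have [_ cp] := dP2 x y x2 y2.
  by rewrite pK cp /= mulgVK.
have := derive_near X E.
rewrite (derive_moving X se sa sm).
have -> : 'D_X (fun x => 'D_(col_mx 0 Y) m (col_mx x e)) e = mulC2 X Y.
  exact: (derive_slice1 X (smooth_at_derive (col_mx 0 Y) sm)).
have scst (w : 'cV[R]_n) : differentiable (fun _ : 'cV[R]_n => w) e.
  exact: differentiable_cst.
have -> : 'D_X (fun x : 'cV[R]_n => col_mx e x) e = col_mx 0 X.
  have did := smooth_at_differentiable (smooth_at_id e).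
  by rewrite (derive_col X (scst e) did) derive_cstE derive_id.
have -> : 'D_X a e = col_mx (bracketC c X Y) 0.
  by rewrite (derive_col X (smooth_at_differentiable sAd) (scst 0)) derive_cstE.
have -> : a e = col_mx Y 0 by rewrite /a cinv_base (AdC1 bc).
rewrite mulC_derive1 (derive_swap _ _ sm) -/(mulC2 Y X) => <-.
by rewrite addrK.
Qed.

Lemma bracketCC X Y : bracketC c X Y = - bracketC c Y X.
Proof. by rewrite !bracket_mulC2 opprB. Qed.

End antisymmetry.

(** * Locally constant functions *)

Section locally_constant.
Context {R : realType} (n : nat) (G : lieGroupType R n) (c : chart R n G).
Hypothesis bc : based c.
Let e := c 1%g.

(** Only derivatives at the identity are assumed to vanish. Writing [y g = (y x^-1) (x g)] turns the
    derivative at a nearby [x] into a derivative at 1 of another translate. *)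
Lemma derive0_locally_constant (f : G -> R) :
  (forall g, smooth_at (fun y => f (cinv c y * g)%g) e) ->
  (forall g v, 'D_v (fun y => f (cinv c y * g)%g) e = 0) ->
  forall g, \forall x \near g, f x = f g.
Proof.
move=> sf Df.
have srdiv : smooth_map (fun p : G * G => p.1 * p.2^-1)%g.
  exact: smooth_mulg (smooth_map_fst G G) (smooth_invg (smooth_map_snd G G)).
have [|d d0 dP] := coord2_ball bc srdiv; first by rewrite /= mulgV.
have D0 g x : `|x - e| < d -> smooth_at (fun y => f (cinv c y * g)%g) x /\
    forall v, 'D_v (fun y => f (cinv c y * g)%g) x = 0.
  move=> xd; pose r y := coord2 c (fun p => p.1 * p.2^-1)%g (col_mx y x).
  have rx : r x = e by rewrite /r coord2E /= mulgV.
  have sr : smooth_at r x.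
    have s1 : smooth_at (fun y : 'cV[R]_n => col_mx y x) x.
      by apply: smooth_at_col; [exact: smooth_at_id|exact: smooth_at_cst].
    by have := smooth_at_comp s1 (dP x x xd xd).1.
  pose h y := f (cinv c y * (cinv c x * g))%g.
  have E : \forall y \near x, h (r y) = f (cinv c y * g)%g.
    have : \forall y \near x, `|y - e| < d.
      have := ball_near (a := x) (d := d - `|x - e|) (P := fun y => `|y - e| < d).
      apply; first by rewrite subr_gt0.
      move=> y yd; rewrite -(subrK x y) -addrA; apply: le_lt_trans (ler_normD _ _) _.
      by rewrite -ltrBrDr.
    apply: filterS => y yd; rewrite /h /r (dP y x yd xd).2 /=.
    by rewrite mulgA mulgVK.
  have sh : smooth_at h (r x) by rewrite rx; exact: sf.
  have shr : smooth_at (fun y => h (r y)) x.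
    pose hm (y : 'cV[R]_n) : 'cV[R]_1 := \col_(_ < 1) h y.
    have shm : smooth_at hm (r x).
      apply: smooth_at_mx => i j; suff -> : (fun y => hm y i j) = h by [].
      by apply/funext => y; rewrite mxE.
    have := smooth_at_entry ord0 ord0 (smooth_at_comp sr shm).
    suff -> : (fun y => hm (r y) ord0 ord0) = (fun y => h (r y)) by [].
    by apply/funext => y; rewrite mxE.
  split=> [|v]; first exact: smooth_at_eq E shr.
  rewrite -(derive_near v E) (derive_chain (f := h)); [|exact: smooth_at_differentiable..].
  by rewrite rx; exact: Df.
have loc (g : G) y : `|y - e| < d -> f (cinv c y * g)%g = f g.
  move=> yd; have sg x xd := (D0 g x xd).1; have dg x v xd := (D0 g x xd).2 v.
  rewrite (ball_derive0_cst sg dg yd (in_ball0 _ d0)).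
  by rewrite (cinv_base bc) mul1g.
move=> g.
have n1 : \forall u \near (1%g : G), cdom c u /\ `|c u - e| < d.
  have nd := cdom_near bc.2.
  have := cfun_continuous bc.2 => /cvgrPdist_lt/(_ _ d0) nc.
  by near=> u; split; near: u => //; move: nc; apply: filterS => u; rewrite distrC.
have : \forall x \near g, cdom c (x * g^-1)%g /\ `|c (x * g^-1)%g - e| < d.
  have [ct _] := smooth_mulg (smooth_map_id G) (@smooth_map_cst _ _ _ G G g^-1%g).
  have := ct g; rewrite /continuous_at mulgV => ctg; exact: (ctg _ n1).
apply: filterS => x [cx xd].
by rewrite -(loc g _ xd) cfunK // mulgVK.
Unshelve. all: by end_near. Qed.

End locally_constant.

Lemma locally_constant_connected (T : topologicalType) (U : Type) (f : T -> U) :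
  connected [set: T] -> (forall x, \forall y \near x, f y = f x) ->
  forall x y, f x = f y.
Proof.
move=> cT lf x y.
have oF z : open [set w | f w = f z].
  by rewrite openE => w /= wz; rewrite /interior /= -wz; exact: lf.
have : [set w | f w = f x] = [set: T].
  apply: cT; first by exists x.
  - by exists [set w | f w = f x]; rewrite ?setTI.
  - exists [set w | f w = f x]; rewrite ?setTI // -[X in closed X]setCK.
    apply: open_closedC; rewrite openE => w /= wx; apply: filterS (lf w).
    by move=> z /= -> .
by move=> H; have : [set: T] y by []; rewrite -H /= => ->.
Qed.

Lemma dotcN (R : realType) m (u v : 'cV[R]_m) : dotc u (- v) = - dotc u v.
Proof. by rewrite -scaleN1r dotcZr mulN1r. Qed.

Lemma dotc_add_congr (R : realType) m (l u v w : 'cV[R]_m) :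
  dotc l v = dotc l w -> - dotc l (u + v) = - dotc l (u + w).
Proof. by rewrite !dotcDr => ->. Qed.

(** * Integrating an invariant functional *)

Section local_homomorphism.
Context {R : realType} (n : nat) (G : lieGroupType R n) (c : chart R n G).
Hypothesis bc : based c.
Let e := c 1%g.
Let m := mulC c.
Let g := ldivC c.
Variable lam : 'cV[R]_n.
Hypothesis lam_bracket : forall X Y, dotc lam (bracketC c X Y) = 0.
Hypothesis lam_Ad : forall h v, dotc lam (AdC c h v) = dotc lam v.

Let bl d x := `|x - e| < d.

Let ball_ge (d : R) x : bl d x -> \forall y \near x, bl d y.
Proof.
move=> xd; apply: (ball_near (d := d - `|x - e|)); first by rewrite subr_gt0.
move=> y yd; rewrite /bl -(subrK x y) -addrA; apply: le_lt_trans (ler_normD _ _) _.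
by rewrite -ltrBrDr.
Qed.

Lemma coordinate_ball : exists2 d, 0 < d & forall x y, bl d x -> bl d y ->
  [/\ smooth_at m (col_mx x y) /\ cinv c (m (col_mx x y)) = (cinv c x * cinv c y)%g,
      m (col_mx x y) = c (cinv c x * cinv c y)%g, c (cinv c x) = x,
      smooth_at g (col_mx x y) /\ cinv c (g (col_mx x y)) = ((cinv c x)^-1 * cinv c y)%g &
      g (col_mx x y) = c ((cinv c x)^-1 * cinv c y)%g].
Proof.
have [d1 d10 dP] := mulC_ball bc.
have [|d2 d20 dQ] := coord2_ball bc (sldiv2 G); first by rewrite /= mulVg.
exists (Num.min d1 d2); first by rewrite lt_min d10.
move=> x y; rewrite /bl !lt_min => /andP[x1 x2] /andP[y1 y2].
have [? ? ? ?] := dP _ _ x1 y1; have [? ?] := dQ _ _ x2 y2.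
by split=> //; rewrite /g /ldivC coord2E.
Qed.

Let d := s2val (cid2 coordinate_ball).
Let d0 : 0 < d. Proof. by rewrite /d; case: cid2. Qed.
Let dP : forall x y, bl d x -> bl d y ->
  [/\ smooth_at m (col_mx x y) /\ cinv c (m (col_mx x y)) = (cinv c x * cinv c y)%g,
      m (col_mx x y) = c (cinv c x * cinv c y)%g, c (cinv c x) = x,
      smooth_at g (col_mx x y) /\ cinv c (g (col_mx x y)) = ((cinv c x)^-1 * cinv c y)%g &
      g (col_mx x y) = c ((cinv c x)^-1 * cinv c y)%g].
Proof. by rewrite /d; case: cid2. Qed.

Let ed : bl d e. Proof. by rewrite /bl subrr normr0. Qed.
Let ce : cinv c e = 1%g. Proof. exact: cinv_base. Qed.
Let sm x y : bl d x -> bl d y -> smooth_at m (col_mx x y).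
Proof. by move=> xd yd; have [[]] := dP xd yd. Qed.
Let sg x y : bl d x -> bl d y -> smooth_at g (col_mx x y).
Proof. by move=> xd yd; have [_ _ _ []] := dP xd yd. Qed.
Let cm x y : bl d x -> bl d y -> cinv c (m (col_mx x y)) = (cinv c x * cinv c y)%g.
Proof. by move=> xd yd; have [[]] := dP xd yd. Qed.
Let cg x y : bl d x -> bl d y -> cinv c (g (col_mx x y)) = ((cinv c x)^-1 * cinv c y)%g.
Proof. by move=> xd yd; have [_ _ _ []] := dP xd yd. Qed.
Let mE x y : bl d x -> bl d y -> m (col_mx x y) = c (cinv c x * cinv c y)%g.
Proof. by move=> xd yd; have [] := dP xd yd. Qed.
Let gE x y : bl d x -> bl d y -> g (col_mx x y) = c ((cinv c x)^-1 * cinv c y)%g.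
Proof. by move=> xd yd; have [] := dP xd yd. Qed.
Let cK x : bl d x -> c (cinv c x) = x.
Proof. by move=> xd; have [] := dP xd ed. Qed.
Let mxe x : bl d x -> m (col_mx x e) = x.
Proof. by move=> xd; rewrite mE // ce mulg1 cK. Qed.
Let gxx x : bl d x -> g (col_mx x x) = e.
Proof. by move=> xd; rewrite gE // mulVg. Qed.

Let s2 (x y : 'cV[R]_n) : smooth_at (fun y : 'cV[R]_n => col_mx x y) y.
Proof. by apply: smooth_at_col; [exact: smooth_at_cst|exact: smooth_at_id]. Qed.

Let smx x y : bl d x -> bl d y -> smooth_at (fun y => m (col_mx x y)) y.
Proof. by move=> xd yd; exact: smooth_at_comp (s2 x y) (sm xd yd). Qed.
Let sgx x y : bl d x -> bl d y -> smooth_at (fun y => g (col_mx x y)) y.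
Proof. by move=> xd yd; exact: smooth_at_comp (s2 x y) (sg xd yd). Qed.

Let near_m x y : bl d x -> bl d y -> bl d (m (col_mx x y)) ->
  \forall z \near y, bl d (m (col_mx x z)).
Proof.
by move=> xd yd md; exact: (smooth_at_continuous (smx xd yd) (ball_ge md)).
Qed.

Let near_g x : bl d x -> \forall z \near x, bl d (g (col_mx x z)).
Proof.
move=> xd; have := smooth_at_continuous (sgx xd xd).
rewrite /prop_for /continuous_at gxx // => cgx; exact: (cgx _ (ball_ge ed)).
Qed.

(** The left-invariant vector field with value [V] at 1. *)
Let EV V x : 'cV[R]_n := 'D_(col_mx 0 V) m (col_mx x e).

Let sEV V x : bl d x -> smooth_at (EV V) x.
Proof.
move=> xd; have s1 : smooth_at (fun x : 'cV[R]_n => col_mx x e) x.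
  by apply: smooth_at_col; [exact: smooth_at_id|exact: smooth_at_cst].
exact: (smooth_at_comp s1 (smooth_at_derive (col_mx 0 V) (sm xd ed))).
Qed.

(** The Maurer-Cartan form: it translates [v] from [x] back to 1 and is inverse to [EV]. *)
Let dg x v : 'cV[R]_n := 'D_(col_mx 0 v) g (col_mx x x).

Let dg_EV V x : bl d x -> dg x (EV V x) = V.
Proof.
move=> xd; have xmd : bl d (m (col_mx x e)) by rewrite mxe.
rewrite /dg -[RHS](derive_id e V).
have sgm : smooth_at (fun y => g (col_mx x y)) (m (col_mx x e)) by exact: sgx.
transitivity ('D_V (fun y => g (col_mx x (m (col_mx x y)))) e).
  rewrite (derive_chain (g := fun y => m (col_mx x y)) (f := fun y => g (col_mx x y))).
  - rewrite (derive_slice2 V (sm xd ed)) -/(EV V x) mxe //.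
    by rewrite (derive_slice2 _ (sg xd xd)).
  - exact/smooth_at_differentiable/smx.
  - exact: smooth_at_differentiable.
apply: derive_near; have := near_m xd ed xmd.
have := ball_ge ed; apply: filterS2 => y yd myd.
by rewrite gE // cm // mulKg cK.
Qed.

Let EV_dg x v : bl d x -> EV (dg x v) x = v.
Proof.
move=> xd; rewrite -[RHS](derive_id x v) /EV.
have smg : smooth_at (fun y => m (col_mx x y)) (g (col_mx x x)).
  by rewrite gxx //; exact: smx.
transitivity ('D_v (fun y => m (col_mx x (g (col_mx x y)))) x).
  rewrite (derive_chain (g := fun y => g (col_mx x y)) (f := fun y => m (col_mx x y))).
  - rewrite (derive_slice2 v (sg xd xd)) -/(dg x v) gxx //.
    by rewrite (derive_slice2 _ (sm xd ed)).
  - exact/smooth_at_differentiable/sgx.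
  - exact: smooth_at_differentiable.
apply: derive_near; have := near_g xd.
have := ball_ge xd; apply: filterS2 => y yd gyd.
by rewrite mE // cg // mulVKg cK.
Qed.

Let EV_mul V x y : bl d x -> bl d y -> bl d (m (col_mx x y)) ->
  EV V (m (col_mx x y)) = 'D_(col_mx 0 (EV V y)) m (col_mx x y).
Proof.
move=> xd yd md; have yed : bl d (m (col_mx y e)) by rewrite mxe.
rewrite /EV -(derive_slice2 V (sm md ed)).
rewrite -(derive_slice2 V (sm yd ed)) -(derive_slice2 _ (sm xd yd)).
have sxm : smooth_at (fun y => m (col_mx x y)) (m (col_mx y e)).
  by rewrite mxe //; exact: smx.
transitivity ('D_V (fun z => m (col_mx x (m (col_mx y z)))) e); last first.
  rewrite (derive_chain (g := fun z => m (col_mx y z)) (f := fun y => m (col_mx x y))).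
  - by rewrite mxe.
  - exact/smooth_at_differentiable/smx.
  - exact: smooth_at_differentiable.
apply: derive_near; have := near_m yd ed yed.
have := ball_ge ed; apply: filterS2 => z zd mzd.
by rewrite (mE md zd) (mE xd mzd) (cm xd yd) (cm yd zd) mulgA.
Qed.

Let EVe V : EV V e = V. Proof. exact: mulC_derive2. Qed.

(** The first term on the right is symmetric in [V] and [W]. Antisymmetrizing thus leaves the
    left-invariant field of the bracket, by [bracket_mulC2]. *)
Let D_EV V W x : bl d x -> 'D_(EV W x) (EV V) x =
  'D_(col_mx 0 W) ('D_(col_mx 0 V) m) (col_mx x e) + EV (mulC2 c W V) x.
Proof.
move=> xd; have xmd : bl d (m (col_mx x e)) by rewrite mxe.
have sEm : smooth_at (EV V) (m (col_mx x e)) by exact: sEV.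
transitivity ('D_W (fun y => EV V (m (col_mx x y))) e).
  rewrite (derive_chain (g := fun y => m (col_mx x y)) (f := EV V)).
  - by rewrite (derive_slice2 W (sm xd ed)) -/(EV W x) mxe.
  - exact/smooth_at_differentiable/smx.
  - exact: smooth_at_differentiable.
transitivity ('D_W (fun y => 'D_(col_mx 0 (EV V y)) m (col_mx x y)) e).
  apply: derive_near; have := near_m xd ed xmd.
  by have := ball_ge ed; apply: filterS2 => y yd myd; exact: EV_mul.
have sa : smooth_at (fun y => col_mx 0 (EV V y) : 'cV[R]_(n + n)) e.
  by apply: smooth_at_col; [exact: smooth_at_cst|exact: sEV].
have scst (w : 'cV[R]_n) : differentiable (fun _ : 'cV[R]_n => w) e.
  exact: differentiable_cst.
rewrite (derive_moving W (s2 x e) sa (sm xd ed)).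
rewrite (derive_col W (scst 0) (smooth_at_differentiable (sEV V ed))).
have did := smooth_at_differentiable (smooth_at_id e).
rewrite (derive_col W (scst x) did) !derive_cstE derive_id EVe addrC.
have -> : 'D_W (EV V) e = mulC2 c W V.
  exact: (derive_slice1 W (smooth_at_derive (col_mx 0 V) (sm ed ed))).
by [].
Qed.

(** The left-invariant one-form with value [lam] at 1. *)
Let A x : 'cV[R]_n := \col_i dotc lam (dg x (delta_mx i ord0)).

Let dotcA x v : bl d x -> dotc (A x) v = dotc lam (dg x v).
Proof.
move=> xd; have dgx w : dg x w = 'D_w (fun y => g (col_mx x y)) x.
  by rewrite (derive_slice2 w (sg xd xd)).
rewrite [in RHS]dgx derive_col_sum; last exact/smooth_at_differentiable/sgx.
rewrite /dotc; under [RHS]eq_bigr do rewrite summxE mulr_sumr.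
rewrite exchange_big /=; apply: eq_bigr => i _; rewrite mxE mulr_suml.
by apply: eq_bigr => j _; rewrite mxE -dgx; ring.
Qed.

Let sdotc (u v : 'cV[R]_n -> 'cV[R]_n) x : smooth_at u x -> smooth_at v x ->
  smooth_at (fun y => dotc (u y) (v y)) x.
Proof.
move=> su sv; apply: smooth_at_sum => i.
by apply: smooth_atM; exact: smooth_at_entry.
Qed.

Let ddotc (u v : 'cV[R]_n -> 'cV[R]_n) x w : smooth_at u x -> smooth_at v x ->
  'D_w (fun y => dotc (u y) (v y)) x = dotc ('D_w u x) (v x) + dotc (u x) ('D_w v x).
Proof.
move=> su sv; rewrite /dotc -big_split /=.
rewrite (_ : (fun y => _) = \sum_i ((fun y => u y i ord0) * (fun y => v y i ord0))); last first.
  by apply/funext => y; rewrite fct_sumE.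
have du i : derivable (fun y => u y i ord0) x w.
  exact/diff_derivable/smooth_at_differentiable/smooth_at_entry.
have dv i : derivable (fun y => v y i ord0) x w.
  exact/diff_derivable/smooth_at_differentiable/smooth_at_entry.
rewrite derive_sum => [|i]; last exact: derivableM.
apply: eq_bigr => i _; rewrite deriveM //.
rewrite !derive_entry; [|exact: smooth_at_differentiable..].
by rewrite addrC; congr (_ + _); exact: mulrC.
Qed.

Let sA x : bl d x -> smooth_at A x.
Proof.
move=> xd; apply: smooth_at_mx => i j.
pose D : 'cV[R]_(n + n) -> 'cV[R]_n := 'D_(col_mx 0 (delta_mx i ord0)) g.
have s1 : smooth_at (fun x : 'cV[R]_n => col_mx x x) x.
  by apply: smooth_at_col; exact: smooth_at_id.
have s3 : smooth_at D (col_mx x x) by exact: smooth_at_derive (sg xd xd).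
have := sdotc (smooth_at_cst lam x) (smooth_at_comp s1 s3).
suff -> : (fun y => A y i j) = (fun y => dotc lam (D (col_mx y y))) by [].
by apply/funext => y; rewrite mxE.
Qed.

(** Left-invariant fields exhaust the tangent vectors at each point, and the form is constant on
    them. Its exterior derivative on two of them is, up to sign, [lam] of a bracket. *)
Let closedA x v w : bl d x -> dotc ('D_v A x) w = dotc ('D_w A x) v.
Proof.
move=> xd.
have key V W : dotc ('D_(EV W x) A x) (EV V x) = - dotc lam (dg x ('D_(EV W x) (EV V) x)).
  apply/eqP; rewrite -subr_eq0 opprK -dotcA // -ddotc; [|exact: sA|exact: sEV].
  apply/eqP; rewrite -[RHS](derive_cstE (dotc lam V) x (EV W x)).
  apply: derive_near; have := ball_ge xd; apply: filterS => y yd.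
  by rewrite dotcA // dg_EV.
have dgD u u' : dg x (u + u') = dg x u + dg x u'.
  have dx := smooth_at_differentiable (sgx xd xd).
  by rewrite /dg -!(derive_slice2 _ (sg xd xd)) derive_addv.
suff H V W : dotc ('D_(EV W x) A x) (EV V x) = dotc ('D_(EV V x) A x) (EV W x).
  have [W vE] : exists W, EV W x = v by exists (dg x v); exact: EV_dg.
  have [V wE] : exists V, EV V x = w by exists (dg x w); exact: EV_dg.
  by case: _ / vE; case: _ / wE; exact: H.
apply: etrans (key V W) _; apply: etrans (esym (key W V)).
have E1 V' W' : dg x ('D_(EV W' x) (EV V') x) =
    dg x ('D_(col_mx 0 W') ('D_(col_mx 0 V') m) (col_mx x e)) + mulC2 c W' V'.
  apply: etrans (congr1 (dg x) (D_EV V' W' xd)) _; apply: etrans (dgD _ _) _.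
  by congr (_ + _); exact: dg_EV.
apply: etrans (congr1 (fun u => - dotc lam u) (E1 V W)) _.
apply: etrans _ (esym (congr1 (fun u => - dotc lam u) (E1 W V))).
have -> := derive_swap (col_mx 0 W) (col_mx 0 V) (sm xd ed).
apply: dotc_add_congr; apply/eqP; rewrite -subr_eq0 -(dotcN lam) -dotcDr.
by rewrite -bracket_mulC2 // lam_bracket.
Qed.

Lemma local_primitive : exists f r, 0 < r /\ r <= d /\ forall x, bl r x ->
  smooth_at f x /\ forall V, 'D_(EV V x) f x = dotc lam V.
Proof.
have [|f [r [r0 fr]]] := poincare (sA ed).
  by have := ball_ge ed; apply: filterS => x xd v w; exact: closedA.
exists f, (Num.min r d); split; first by rewrite lt_min r0.
split=> [|x]; first by rewrite ge_min lexx orbT.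
rewrite /bl lt_min => /andP[xr xd]; have [sf Df] := fr x xr.
by split=> // V; rewrite Df dotcA // dg_EV.
Qed.

(** A primitive of a left-invariant form changes by a constant under left translation, hence is
    additive up to its value at 1. Ad-invariance of [lam] makes it invariant under conjugation near
    1 in the same way. *)
Lemma local_homomorphism : exists f : 'cV[R]_n -> R, exists2 r, 0 < r &
  [/\ forall x, bl r x -> smooth_at f x,
      forall v, 'D_v f e = dotc lam v,
      forall x y, bl r x -> bl r y ->
        f (c (cinv c x * cinv c y)%g) - f e = (f x - f e) + (f y - f e) &
      forall h, \forall x \near e, f (c (h * cinv c x * h^-1)%g) = f x].
Proof.
have [f [r [r0 [rd fr]]]] := local_primitive.
have br x : bl r x -> bl d x by move=> xr; exact: lt_le_trans xr rd.
have er : bl r e by rewrite /bl subrr normr0.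
have [r1 r10 mr1] : exists2 r1, 0 < r1 & forall x y, bl r1 x -> bl r1 y ->
    bl r (m (col_mx x y)).
  apply: (near2_ball (P := fun z => bl r (m z))).
  have := smooth_at_continuous (mulC_smooth bc).
  rewrite /prop_for /continuous_at -/m (mxe ed) => cm'; exact: (cm' _ (ball_ge er)).
pose r2 := Num.min r r1.
have r20 : 0 < r2 by rewrite lt_min r0.
have b2 x : bl r2 x -> bl r x /\ bl r1 x by rewrite /bl lt_min => /andP[].
have sfm (g' : 'cV[R]_n -> 'cV[R]_n) y : smooth_at g' y -> smooth_at f (g' y) ->
    smooth_at (fun z => f (g' z)) y.
  move=> sg' sf; pose fm (y : 'cV[R]_n) : 'cV[R]_1 := \col_(_ < 1) f y.
  have sfm : smooth_at fm (g' y).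
    apply: smooth_at_mx => i j; suff -> : (fun y => fm y i j) = f by [].
    by apply/funext => z; rewrite mxE.
  have := smooth_at_entry ord0 ord0 (smooth_at_comp sg' sfm).
  suff -> : (fun y => fm (g' y) ord0 ord0) = (fun y => f (g' y)) by [].
  by apply/funext => z; rewrite mxE.
have diffB (p q : 'cV[R]_n -> R) y v : smooth_at p y -> smooth_at q y ->
    'D_v p y = 'D_v q y -> smooth_at (fun z => p z - q z) y /\
    'D_v (fun z => p z - q z) y = 0.
  move=> sp sq pq; split.
    have sN : smooth_at (fun z => (-1 : R) * q z) y.
      by apply: smooth_atM => //; exact: smooth_at_cst.
    have := smooth_atD sp sN.
    suff -> : (fun y => p y + -1 * q y) = (fun y => p y - q y) by [].
    by apply/funext => z; rewrite mulN1r.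
  rewrite deriveB; [|exact/diff_derivable/smooth_at_differentiable..].
  by rewrite pq subrr.
exists f, r2 => //; split=> [x /b2[xr _]|v|x y xr2 yr2|h].
- exact: (fr x xr).1.
- by have [_ /(_ v)] := fr e er; rewrite EVe.
- have [xr xr1] := b2 _ xr2.
  pose k y := f (m (col_mx x y)) - f y.
  have kP z : bl r2 z -> smooth_at k z /\ forall v, 'D_v k z = 0.
    move=> /b2[zr zr1]; have mr := mr1 _ _ xr1 zr1.
    have sfxm : smooth_at (fun y => f (m (col_mx x y))) z.
      by apply: sfm; [exact: smx (br _ xr) (br _ zr)|exact: (fr _ mr).1].
    have Dv v : 'D_v (fun y => f (m (col_mx x y))) z = 'D_v f z.
      rewrite (derive_chain (g := fun y => m (col_mx x y)) (f := f)); last 1 first.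
      - exact: smooth_at_differentiable (fr _ mr).1.
      - rewrite (derive_slice2 _ (sm (br _ xr) (br _ zr))).
        rewrite -[v](EV_dg v (br _ zr)) -(EV_mul _ (br _ xr) (br _ zr) (br _ mr)).
        by rewrite (fr _ mr).2 (fr _ zr).2.
      - exact: smooth_at_differentiable (smx (br _ xr) (br _ zr)).
    split=> [|v]; first exact: (diffB _ _ _ 0 sfxm (fr _ zr).1 (Dv 0)).1.
    exact: (diffB _ _ _ v sfxm (fr _ zr).1 (Dv v)).2.
  have er2 : bl r2 e by rewrite /bl subrr normr0.
  have := ball_derive0_cst (fun z zr => (kP z zr).1) (fun z v zr => (kP z zr).2 v) yr2 er2.
  have [yr _] := b2 _ yr2.
  rewrite /k (mxe (br _ xr)) mE; [|exact: br..].
  by move=> /eqP; rewrite subr_eq => /eqP ->; ring.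
- pose F y := c (h * cinv c y * h^-1)%g.
  have F1 : (h * 1 * h^-1 = 1 :> G)%g by rewrite mulg1 mulgV.
  have sF := tmap_smooth bc bc (smooth_conjg h) F1.
  have Fe : F e = e by rewrite /F ce F1.
  have nF := coord_near bc.2 bc (smooth_conjg h) F1.
  have [r3 r30 r3P] : exists2 r3, 0 < r3 & forall y, bl r3 y ->
      [/\ smooth_at F y, bl r2 (F y) & cinv c (F y) = (h * cinv c y * h^-1)%g].
    apply: (near_ball (P := fun y => [/\ smooth_at F y, bl r2 (F y) & _])).
    have cF : {for e, continuous F} := smooth_at_continuous sF.
    have er2 : bl r2 e by rewrite /bl subrr normr0.
    have n2 : \forall y \near e, bl r2 (F y).
      move: cF; rewrite /prop_for /continuous_at Fe => cF'.
      exact: (cF' _ (ball_ge er2)).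
    near=> y; split; [near: y; exact: smooth_at_nbhs sF|by near: y|by near: y].
  pose r4 := Num.min r2 r3.
  have r40 : 0 < r4 by rewrite lt_min r20.
  have b4 x : bl r4 x -> [/\ bl r x, bl r1 x & bl r3 x].
    by rewrite /bl /r4 /r2 !lt_min => /andP[/andP[-> ->] ->].
  pose k y := f (F y) - f y.
  have kP z : bl r4 z -> smooth_at k z /\ forall v, 'D_v k z = 0.
    move=> /b4[zr zr1 zr3]; have [sFz Fz2 cFz] := r3P _ zr3.
    have [Fzr _] := b2 _ Fz2.
    have sfF : smooth_at (fun y => f (F y)) z by apply: sfm => //; exact: (fr _ Fzr).1.
    (* Conjugation by [h] carries the left-invariant field of [V] to that of [Ad h V]. *)
    have DF V : 'D_(EV V z) F z = EV (AdC c h V) (F z).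
      rewrite {1}/EV -(derive_slice2 V (sm (br _ zr) ed)).
      have sFm : smooth_at F (m (col_mx z e)) by rewrite mxe //; exact: br.
      have Fzd := br _ Fzr.
      have smF : smooth_at (fun y => m (col_mx (F z) y)) (F e) by rewrite Fe; exact: smx.
      transitivity ('D_V (fun y => m (col_mx (F z) (F y))) e); last first.
        rewrite (derive_chain (g := F) (f := fun y => m (col_mx (F z) y))).
        - by rewrite Fe (derive_slice2 _ (sm Fzd ed)).
        - exact: smooth_at_differentiable.
        - exact: smooth_at_differentiable.
      transitivity ('D_V (fun y => F (m (col_mx z y))) e).
        rewrite (derive_chain (g := fun y => m (col_mx z y)) (f := F)).
        - by rewrite mxe //; exact: br.
        - exact/smooth_at_differentiable/smx/ed/br.
        - exact: smooth_at_differentiable.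
      have zed : bl d (m (col_mx z e)) by rewrite mxe; exact: br.
      have n3 : \forall y \near e, bl r3 y by apply: (ball_near r30).
      apply: derive_near; have := n3; have := ball_ge ed; apply: filterS2 => y yd y3.
      have [_ Fy2 cFy] := r3P _ y3; have [Fyr _] := b2 _ Fy2.
      rewrite (mE Fzd (br _ Fyr)) cFz cFy {1}/F (cm (br _ zr) yd).
      by rewrite !mulgA mulgVK.
    have Dv v : 'D_v (fun y => f (F y)) z = 'D_v f z.
      rewrite (derive_chain (g := F) (f := f)); last 1 first.
      - exact: smooth_at_differentiable (fr _ Fzr).1.
      - rewrite -[v](EV_dg v (br _ zr)) DF (fr _ Fzr).2 (fr _ zr).2.
        exact: lam_Ad.
      - exact: smooth_at_differentiable.
    split=> [|v]; first exact: (diffB _ _ _ 0 sfF (fr _ zr).1 (Dv 0)).1.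
    exact: (diffB _ _ _ v sfF (fr _ zr).1 (Dv v)).2.
  have er4 : bl r4 e by rewrite /bl subrr normr0.
  apply: (ball_near r40) => x xr4.
  have := ball_derive0_cst (fun z zr => (kP z zr).1) (fun z v zr => (kP z zr).2 v) xr4 er4.
  rewrite /k Fe subrr => /eqP; rewrite subr_eq0 => /eqP; exact.
Unshelve. all: by end_near. Qed.

End local_homomorphism.

(** As [T] is a mere proposition, a matrix of maximal rank with columns in [T] stands for a basis.
    The lemma turns spanning questions into questions about functionals. *)
Lemma prop_subspace_full (F : fieldType) n (T : 'cV[F]_n -> Prop) : T 0 ->
  (forall v w, T v -> T w -> T (v + w)) -> (forall a v, T v -> T (a *: v)) ->
  (forall l : 'rV[F]_n, (forall w, T w -> l *m w = 0) -> l = 0) ->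
  forall w, T w.
Proof.
move=> T0 TD TZ Tl.
pose P r := `[< exists m (A : 'M[F]_(n, m)), (forall j, T (col j A)) /\ \rank A = r >].
have exP : exists r, P r.
  by exists 0%N; apply/asboolP; exists 0%N, 0; rewrite mxrank0; split=> // -[].
have ubP r : P r -> (r <= n)%N.
  by move=> /asboolP[m [A [_ <-]]]; exact: rank_leq_row.
case: (ex_maxnP exP ubP) => r /asboolP[m [A [TA rA]]] rmax.
have TAv (v : 'cV_m) : T (A *m v).
  have -> : A *m v = \sum_j v j 0 *: col j A.
    apply/colP => i; rewrite summxE !mxE; apply: eq_bigr => j _.
    by rewrite !mxE mulrC.
  by elim/big_ind: _ => // j _; exact: TZ.
have TsubA w : T w -> (w^T <= A^T)%MS.
  move=> Tw; apply: contrapT => /negP wA.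
  suff : (\rank (row_mx A w) <= r)%N.
    rewrite -mxrank_tr tr_row_mx -rA -[\rank A]mxrank_tr => le_rk.
    have AB : (A^T <= col_mx A^T w^T)%MS by rewrite -addsmxE addsmxSl.
    have := mxrank_leqif_sup AB => -[_ /esym].
    rewrite eqn_leq le_rk (mxrankS AB) -addsmxE addsmx_sub submx_refl /=.
    by move=> wA'; rewrite wA' in wA.
  apply: rmax; apply/asboolP; exists (m + 1)%N, (row_mx A w); split=> // j.
  case: (split_ordP j) => k ->; first by rewrite colKl.
  by rewrite colKr; have -> : col k w = w by apply/colP => i; rewrite mxE !ord1.
have fullA : row_full A^T.
  rewrite -sub1mx; apply/negPn/negP => nfull.
  have : cokermx A^T != 0 by rewrite cokermx_eq0 -sub1mx.
  move=> /eqP; apply; apply/matrixP => i j.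
  suff l0 : (col j (cokermx A^T))^T = 0.
    by have := congr1 (fun M : 'rV_n => M 0 i) l0; rewrite !mxE.
  apply: Tl => w /TsubA /submxP[D wE].
  apply: trmx_inj; rewrite trmx_mul trmxK wE -mulmxA trmx0.
  by rewrite colE [A^T *m _]mulmxA mulmx_coker mul0mx mulmx0.
move=> w; have /submxP[D wE] : (w^T <= A^T)%MS by exact: submx_full.
have -> : w = A *m D^T by apply: trmx_inj; rewrite trmx_mul trmxK.
exact: TAv.
Qed.

(** * Invariant functionals *)

Section no_trivial_constituent.
Context {R : realType} {n N : nat} {G : lieGroupType R n} (rho : sl_rep N G).

(** The kernel of [l] meets each irreducible constituent in a subrepresentation, which is everything
    or 0. In the latter case [rho g *m w - w], killed by [l], is 0, and the constituent is
    trivial. *)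
Lemma no_trivial_constituent_functional (l : 'rV[R]_N) :
  no_trivial_constituent rho ->
  (forall g (v : 'cV_N), l *m (rho g *m v) = l *m v) -> l = 0.
Proof.
move=> [k [W [[irrW _ sumW] ntW]]] linv.
pose f : {linear 'cV[R]_N -> 'cV[R]_1} := mulmx l.
pose K := lker (linfun f).
have KE v : (v \in K) = (l *m v == 0) by rewrite memv_ker lfunE.
have WK i : (W i <= K)%VS.
  have [subW W0 Wirr] := irrW i.
  have subU : subrep rho (W i :&: K)%VS.
    move=> g w; rewrite !memv_cap !KE => /andP[wW lw].
    by rewrite subW //= linv.
  have [U0|UW] := Wirr _ subU (capvSl _ _); last by rewrite -UW capvSr.
  case: (ntW i) => g w wW; apply/eqP; rewrite -subr_eq0 -memv0 -U0 memv_cap KE.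
  by rewrite mulmxBr linv subrr eqxx andbT memvB // subW.
have fullK : (fullv <= K)%VS by rewrite -sumW; apply/subv_sumP => i _; exact: WK.
apply/rowP => j; have /subvP/(_ (delta_mx j 0) (memvf _)) := fullK.
by rewrite KE -colE => /eqP/colP/(_ 0); rewrite !mxE.
Qed.
End no_trivial_constituent.

Section semisimple_lie.
Context {R : realType} (n : nat) (G : lieGroupType R n).
Local Notation c := (chart1 G).
Let bc : based c := chart1_based G.

Lemma bracketC_linearr (X : 'cV[R]_n) : linear (bracketC c X).
Proof. by move=> a Y Z; rewrite !bracketE // mulmxDr -scalemxAr. Qed.
Lemma bracketC_linearl (Y : 'cV[R]_n) : linear ((bracketC c)^~ Y).
Proof.
move=> a X X'; rewrite !(bracketCC bc _ Y) bracketC_linearr opprD scalerN.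
by [].
Qed.
End semisimple_lie.

(** * The differential of a morphism of Lie groups *)

Section morphism.
Context {R : realType} (d n : nat) (H : lieGroupType R d) (S : lieGroupType R n).
Variables (b : chart R d H) (c : chart R n S) (theta : H -> S).
Hypotheses (bb : based b) (bc : based c) (mth : lie_morphism theta).
Local Notation e := (b 1%g).

Lemma lie_morphismM x y : theta (x * y)%g = (theta x * theta y)%g.
Proof. exact: mth.1. Qed.
Lemma lie_morphism1 : theta 1%g = 1%g.
Proof. by apply: (mulgI (theta 1%g)); rewrite -lie_morphismM !mulg1. Qed.
Lemma lie_morphismV x : theta x^-1%g = (theta x)^-1%g.
Proof. by apply: (mulgI (theta x)); rewrite -lie_morphismM !mulgV lie_morphism1. Qed.

Lemma tmap_AdC h X : tmap b c theta (AdC b h X) = AdC c (theta h) (tmap b c theta X).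
Proof.
have sth := mth.2; have th1 := lie_morphism1.
have sH := @smooth_conjg R d H h; have sS := @smooth_conjg R n S (theta h).
have E (k : nat) (K : lieGroupType R k) (g : K) : (g * 1 * g^-1)%g = 1%g.
  by rewrite mulg1 mulgV.
apply: etrans (esym (tmap_comp bb bb bc sH sth (E _ _ _) th1 X)) _.
apply: etrans _ (tmap_comp bb bc bc sth sS th1 (E _ _ _) X).
by congr (tmap b c _ X); apply/funext => x; rewrite !lie_morphismM lie_morphismV.
Qed.

Lemma tmap_linear : linear (tmap b c theta).
Proof. exact: tmap_is_linear mth.2 lie_morphism1. Qed.

Definition tmx : 'M[R]_(n, d) := \matrix_(i, j) tmap b c theta (delta_mx j 0) i 0.

Lemma tmxE v : tmx *m v = tmap b c theta v.
Proof.
rewrite [in RHS](matrix_sum_delta v); apply/colP => i.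
under eq_bigr do rewrite big_ord1.
rewrite (lin_sum tmap_linear) summxE !mxE; apply: eq_bigr => j _.
by rewrite (linZ tmap_linear) !mxE mulrC.
Qed.

Lemma theta_smooth : smooth_at (fun y => c (theta (cinv b y))) e.
Proof. exact: tmap_smooth mth.2 lie_morphism1. Qed.

Lemma theta_near : \forall y \near e, cdom c (theta (cinv b y)).
Proof.
apply: (chart_near (A := fun x => cdom c (theta x)) bb.2).
by apply: mth.2.1; apply: cdom_near; rewrite lie_morphism1; exact: bc.2.
Qed.

Lemma dmx_theta k (tau : S -> 'M[R]_k) X :
  smooth_at (fun x => tau (cinv c x)) (c 1%g) ->
  'D_X (fun x => tau (theta (cinv b x))) e = dmx c tau (tmx *m X).
Proof.
move=> stau; rewrite tmxE.
apply: etrans (dmx_curve (f := fun x => theta (cinv b x)) stau X _ _ _) _.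
- exact: theta_smooth.
- by rewrite (cinv_base bb) lie_morphism1.
- exact: theta_near.
- by [].
Qed.

Lemma tmx_AdC h X : tmx *m AdC b h X = AdC c (theta h) (tmx *m X).
Proof. by rewrite !tmxE tmap_AdC. Qed.

Lemma tmx_bracket X Y : tmx *m bracketC b X Y = bracketC c (tmx *m X) (tmx *m Y).
Proof.
have sAd := AdC_smooth bb Y.
rewrite [RHS]bracketE // -(dmx_theta X (Admx_smooth bc)).
have -> : tmx *m bracketC b X Y = 'D_X (fun x => tmx *m AdC b (cinv b x) Y) e.
  apply/esym; apply: (derive_lin (L := mulmx tmx)); last exact: smooth_at_differentiable.
  exact: linear_col_continuous.
pose A := fun x => Admx c (theta (cinv b x)).
have sA : smooth_at A e.
  have st := theta_smooth; have sAm : smooth_at (fun x => Admx c (cinv c x)) (c (theta (cinv b e))).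
    by rewrite (cinv_base bb) lie_morphism1; exact: Admx_smooth.
  apply: smooth_at_eq (smooth_at_comp st sAm).
  apply: filterS theta_near => y cy; by rewrite cfunK.
have -> : (fun x => tmx *m AdC b (cinv b x) Y) = (fun x => A x *m (tmx *m Y)).
  by apply/funext => x; rewrite tmx_AdC AdmxE.
rewrite (derive_mulmx _ sA (smooth_at_cst _ _)) derive_cstE mulmx0 addr0.
by [].
Qed.
End morphism.

(** * The Lie algebra of the semidirect product *)

Section semidirect_lie_algebra.
Context {R : realType} (n N : nat) (G : lieGroupType R n) (rho : sl_rep N G).
Local Notation S := (semidirect rho).
Local Notation cG := (chart1 G).
Local Notation eG := (cG 1%g).

(** The two factors occupy separate blocks of coordinates here, whereas [chart1] of the semidirect
    product is an arbitrary choice. *)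
Definition sd_chart : chart R (n + N) S := prod_chart cG (cV_chart N).

Lemma sd_chart_based : based sd_chart.
Proof.
have [ac c1] := chart1_based G; split; last by split.
by exists (cG, cV_chart N).
Qed.

Lemma sd_chart1 : sd_chart 1%g = col_mx eG 0. Proof. by []. Qed.

Lemma rho_smooth : smooth_at (fun x => rho (cinv cG x)) eG.
Proof.
exists (ccod cG); split; [exact: ccod_open|exact: cfun_cod (chart1_based G).2|].
exact: (@sl_rep_smooth _ _ _ _ rho cG (chart1_based G).1).
Qed.

Lemma lin_conjC_smooth (g : G) : smooth_at (fun y => cG (g * cinv cG y * g^-1)%g) eG.
Proof.
apply: (tmap_smooth (chart1_based G) (chart1_based G) (smooth_conjg g)).
by rewrite mulg1 mulgV.
Qed.

Lemma sd_AdC (g : G) X Y :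
  AdC sd_chart ((g, 0) : S) (col_mx X Y) = col_mx (AdC cG g X) (rho g *m Y).
Proof.
pose p (z : 'cV[R]_(n + N)) := cG (g * cinv cG (usubmx z) * g^-1)%g.
pose q (z : 'cV[R]_(n + N)) := rho g *m dsubmx z.
have su (z : 'cV[R]_(n + N)) : smooth_at (fun z : 'cV[R]_(n + N) => usubmx z) z.
  by apply: (smooth_at_lin (L := usubmx)); exact: usubmx_continuous.
have sd (z : 'cV[R]_(n + N)) : smooth_at (fun z : 'cV[R]_(n + N) => dsubmx z) z.
  by apply: (smooth_at_lin (L := dsubmx)); exact: dsubmx_continuous.
have sc : smooth_at (fun y => cG (g * cinv cG y * g^-1)%g) (usubmx (col_mx eG 0 : 'cV[R]_(n + N))).
  by rewrite col_mxKu; exact: lin_conjC_smooth.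
have sp : smooth_at p (col_mx eG 0) by exact: (smooth_at_comp (su _) sc).
have sq : smooth_at q (col_mx eG 0) by exact: (smooth_at_mulmx (smooth_at_cst _ _) (sd _)).
transitivity ('D_(col_mx X Y) (fun z => col_mx (p z) (q z)) (col_mx eG 0)).
  have E z : sd_chart (((g, 0) : S) * cinv sd_chart z * ((g, 0) : S)^-1)%g =
      col_mx (p z) (q z).
    rewrite /sd_chart -[LHS]/(col_mx (cG (g * cinv cG (usubmx z) * g^-1)%g)
      (rho (g^-1)^-1%g *m (rho (cinv cG (usubmx z))^-1%g *m 0 + dsubmx z) + - (rho g *m 0))).
    by rewrite invgK !mulmx0 add0r oppr0 addr0.
  by rewrite AdCE -sd_chart1 (funext E).
apply: etrans (derive_col _ (smooth_at_differentiable sp) (smooth_at_differentiable sq)) _.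
have dlin k (L : {linear 'cV[R]_(n + N) -> 'cV[R]_k}) : continuous L ->
    'D_(col_mx X Y) (fun z => L z) (col_mx eG 0 : 'cV[R]_(n + N)) = L (col_mx X Y).
  move=> cL; apply: etrans (derive_lin (f := id) _ cL _) _; first exact: smooth_at_differentiable (smooth_at_id _).
  by rewrite derive_id.
apply: (f_equal2 col_mx).
  apply: etrans (derive_chain _ (smooth_at_differentiable (su _)) (smooth_at_differentiable sc)) _.
  have -> : 'D_(col_mx X Y) (fun z => usubmx z) (col_mx eG 0 : 'cV[R]_(n + N)) = X.
    by apply: etrans (dlin _ usubmx _) _; [exact: usubmx_continuous|exact: col_mxKu].
  by rewrite AdCE col_mxKu.
apply: etrans (derive_mulmx _ (smooth_at_cst _ _) (sd _)) _.
have -> : 'D_(col_mx X Y) (fun z => dsubmx z) (col_mx eG 0 : 'cV[R]_(n + N)) = Y.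
  by apply: etrans (dlin _ dsubmx _) _; [exact: dsubmx_continuous|exact: col_mxKd].
by rewrite derive_cstE mul0mx add0r.
Qed.

Lemma sd_bracket X X' Y' :
  bracketC sd_chart (col_mx X 0) (col_mx X' Y') =
  col_mx (bracketC cG X X') (dmx cG rho X *m Y').
Proof.
rewrite bracketCE.
have sA : smooth_at (fun x => AdC sd_chart (cinv sd_chart x) (col_mx X' Y')) (col_mx eG 0).
  exact: (AdC_smooth sd_chart_based).
apply: etrans (esym (derive_slice1 X sA)) _.
have E x : AdC sd_chart (cinv sd_chart (col_mx x 0)) (col_mx X' Y') =
    col_mx (AdC cG (cinv cG x) X') (rho (cinv cG x) *m Y').
  have -> : cinv sd_chart (col_mx x 0) = ((cinv cG x, 0) : S).
    by rewrite /sd_chart -[LHS]/(cinv cG (usubmx (col_mx x 0)), dsubmx (col_mx x 0)) col_mxKu col_mxKd.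
  exact: sd_AdC.
rewrite (funext E).
have s1 := AdC_smooth (chart1_based G) X'.
have s2 := smooth_at_mulmx rho_smooth (smooth_at_cst Y' eG).
apply: etrans (derive_col _ (smooth_at_differentiable s1) (smooth_at_differentiable s2)) _.
apply: (f_equal2 col_mx); first by rewrite bracketCE.
apply: etrans (derive_mulmx _ rho_smooth (smooth_at_cst _ _)) _.
by rewrite derive_cstE mulmx0 addr0 dmxE.
Qed.
End semidirect_lie_algebra.

Section semisimple_lie_algebra.
Context {R : realType} (n : nat) (G : lieGroupType R n).
Local Notation c := (chart1 G).
Let bc : based c := chart1_based G.
Hypothesis ssG : semisimple G.

Let ss (I : {vspace 'cV[R]_n}) : ideal (bracketC c) I ->
  (exists k, iter k (derived (bracketC c)) I = 0%VS) -> I = 0%VS.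
Proof. by rewrite -lie_bracketE; exact: ssG. Qed.

Lemma lie_derived_full : derived (bracketC c) fullv = fullv.
Proof.
exact: (derived_full (bracketC_linearl G) (bracketC_linearr G) (bracketC_ad bc) ss).
Qed.

Lemma lie_reynolds k (t : 'cV[R]_n -> 'M[R]_k) : linear t ->
  (forall X Y, t (bracketC c X Y) = t X *m t Y - t Y *m t X) ->
  exists E : 'M[R]_k, (forall X, E *m t X = 0) /\
    forall v : 'cV_k, (forall X, t X *m v = 0) -> E *m v = v.
Proof.
exact: (reynolds_operator (bracketC_linearl G) (bracketC_linearr G) (bracketC_ad bc) ss).
Qed.

(** Differentiating the invariance shows that [l] kills brackets, and these span a semisimple
    algebra. *)
Lemma Ad_functional (l : 'rV[R]_n) : (forall g X, l *m AdC c g X = l *m X) -> l = 0.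
Proof.
move=> linv.
have lbr X Y : l *m bracketC c X Y = 0.
  have := derive_lin (L := mulmx l) X (linear_col_continuous (L := mulmx l))
    (smooth_at_differentiable (AdC_smooth bc Y)).
  rewrite -bracketCE => <-.
  have E x : l *m AdC c (cinv c x) Y = l *m Y by exact: linv.
  by rewrite (funext E) derive_cstE.
have lX (X : 'cV_n) : l *m X = 0.
  have : X \in derived (bracketC c) fullv by rewrite lie_derived_full memvf.
  apply: (derived_ind (P := fun X => l *m X = 0)).
  - exact: mulmx0.
  - by move=> Y Z lY lZ; rewrite mulmxDr lY lZ addr0.
  - by move=> a Y lY; rewrite -scalemxAr lY scaler0.
  - by move=> Y Z _ _; exact: lbr.
by apply/rowP => j; have /colP/(_ 0) := lX (delta_mx j 0); rewrite -colE !mxE.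
Qed.
End semisimple_lie_algebra.

Lemma smooth_at_near (R : realType) (V W : normedModType R) (f : V -> W) x (P : W -> Prop) :
  smooth_at f x -> (\forall y \near f x, P y) -> \forall y \near x, P (f y).
Proof. by move=> sf nP; exact: (smooth_at_continuous sf nP). Qed.

(** * Neighbourhoods of the identity and countable ranges *)

Section lie_group_topology.
Context {R : realType} (n : nat) (G : lieGroupType R n).

Lemma mulgr_continuous (x : G) : continuous (fun y : G => (y * x)%g).
Proof. have [cf _] := smooth_mulg (@smooth_map_id R n G) (smooth_map_cst G x); exact: cf. Qed.

Lemma mulgl_continuous (x : G) : continuous (fun y : G => (x * y)%g).
Proof. have [cf _] := smooth_mulg (smooth_map_cst G x) (@smooth_map_id R n G); exact: cf. Qed.

Lemma invg_continuous : continuous (fun y : G => (y^-1)%g).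
Proof. have [cf _] := smooth_invg (@smooth_map_id R n G); exact: cf. Qed.

Lemma conjg_near1 (x : G) (A : set G) :
  (\forall y \near 1%g, A y) -> \forall y \near 1%g, A (x * y * x^-1)%g.
Proof.
move=> nA; apply: (smooth_conjg x).1.
by rewrite mulg1 mulgV.
Qed.

Lemma near1_mulr (x : G) (A : set G) :
  (\forall y \near 1%g, A y) -> \forall y \near x, A (y * x^-1)%g.
Proof. by move=> nA; apply: (@mulgr_continuous x^-1%g x); rewrite mulgV. Qed.

Lemma near1_mull (x : G) (A : set G) :
  (\forall y \near 1%g, A y) -> \forall y \near x, A (x^-1 * y)%g.
Proof. by move=> nA; apply: (@mulgl_continuous x^-1%g x); rewrite mulVg. Qed.

Lemma near1_invg (A : set G) :
  (\forall y \near 1%g, A y) -> \forall y \near 1%g, A (y^-1)%g.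
Proof. by move=> nA; apply: (@invg_continuous 1%g); rewrite invg1. Qed.

Lemma near1_mulg (A : set G) : (\forall y \near 1%g, A y) ->
  exists2 B : set G, (\forall y \near 1%g, B y) & forall x y, B x -> B y -> A (x * y)%g.
Proof.
move=> nA; have := (@smul2 R n G).1 (1%g, 1%g).
rewrite /= => /(_ A); rewrite mulg1 => /(_ nA) [[B C] /= [nB nC] BCA].
exists (B `&` C); first exact: filterI.
by move=> x y [Bx _] [_ Cy]; apply: (BCA (x, y)).
Qed.

Lemma subgroup_near1_full (K : set G) : connected [set: G] -> is_subgroup K ->
  (\forall x \near 1%g, K x) -> forall x, K x.
Proof.
move=> cG [K1 KM KV] nK x; apply/asboolP.
rewrite (@locally_constant_connected _ bool (fun y => `[< K y >]) cG _ x 1%g).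
  exact/asboolP.
move=> y; have := near1_mulr y nK; apply: filterS => z Kzy; apply: asbool_equiv_eq.
split=> Kz; last by have := KM _ _ Kzy Kz; rewrite -mulgA mulVg mulg1.
by have := KM _ _ (KV _ Kzy) Kz; rewrite invgM invgK -mulgA mulVg mulg1.
Qed.

(** By second countability every value is taken at the chosen point of some basic open set. *)
Lemma countable_range (T : Type) (f : G -> T) :
  (forall x, \forall y \near x, f y = f x) -> countable (range f).
Proof.
move=> fl; have [B cB [oB bB]] := @manifold_second_countable R n G.
pose pt (b : set G) : G := xget 1%g b.
apply: (@sub_countable _ _ _ B) => //.
apply: card_le_trans (card_image_le (fun b => f (pt b)) B).
apply: subset_card_le => _ [x _ <-].
have [b /= [Bb bx] fb] := bB x _ (fl x); exists b => //.
have bpt : b (pt b) by apply: (xgetPex 1%g); exists x.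
exact: fb.
Qed.
End lie_group_topology.

(** The image is an interval, and a countable interval has Lebesgue measure 0. *)
Lemma countable_connected_cst_in (R : realType) (T : topologicalType) (A : set T)
    (f : T -> R) : connected A -> {within A, continuous f} -> countable (f @` A) ->
  forall x y, A x -> A y -> f x = f y.
Proof.
move=> cA cf countf.
have itv : is_interval (f @` A).
  by apply/connected_intervalP; exact: connected_continuous_connected.
suff H x y : A x -> A y -> ~~ (f x < f y).
  by move=> x y Ax Ay; apply/eqP; rewrite eq_le !leNgt !H.
move=> Ax Ay; apply/negP => fxy; have sub : `[f x, f y] `<=` f @` A.
  move=> z; rewrite /= in_itv /= => /andP[z1 z2].
  by apply: (itv (f x) (f y)); [exists x|exists y|rewrite z1 z2].
have := countable_lebesgue_measure0 (sub_countable (subset_card_le sub) countf).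
rewrite lebesgue_measure_itv /= lte_fin fxy => /eqP.
by rewrite -EFinB eqe subr_eq0 gt_eqF.
Qed.

Lemma countable_connected_cst (R : realType) (T : topologicalType) (f : T -> R) :
  connected [set: T] -> continuous f -> countable (range f) ->
  forall x y, f x = f y.
Proof.
move=> cT cf countf x y; apply: (countable_connected_cst_in cT _ countf) => //.
exact: continuous_subspaceT.
Qed.

Lemma path_connected_connected (R : realType) (T : topologicalType) (x : T) :
  (forall y, exists gamma : R -> T,
    [/\ {within `[0, 1], continuous gamma}, gamma 0 = x & gamma 1 = y]) ->
  connected [set: T].
Proof.
move=> paths.
pose D (g : R -> T) := {within `[0, 1], continuous g} /\ g 0 = x.
have -> : [set: T] = \bigcup_(g in D) (g @` `[0, 1]).
  apply/seteqP; split=> // y _; have [g [cg g0 g1]] := paths y.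
  by exists g => //; exists 1 => //=; rewrite in_itv /= ler01 lexx.
apply: bigcup_connected.
  by exists x => g [_ g0]; exists 0 => //=; rewrite in_itv /= ler01 lexx.
move=> g [cg _]; apply: connected_continuous_connected => //.
exact: segment_connected.
Qed.

(** * Perfectness of a connected semisimple group *)

Section perfect_semisimple.
Context {R : realType} (n : nat) (G : lieGroupType R n).
Local Notation c := (chart1 G).
Local Notation e := (c 1%g).
Let bc : based c := chart1_based G.

Lemma derive_mulC (V : normedModType R) (p q : V -> 'cV[R]_n) x v :
  smooth_at p x -> smooth_at q x -> p x = e -> q x = e ->
  'D_v (fun y => mulC c (col_mx (p y) (q y))) x = 'D_v p x + 'D_v q x.
Proof.
move=> sp sq px qx; have sm : smooth_at (mulC c) (col_mx (p x) (q x)).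
  by rewrite px qx; exact: mulC_smooth.
apply: etrans (derive_chain2 _ sp sq sm) _; rewrite px qx in sm *.
rewrite -[RHS](f_equal2 +%R (mulC_derive1 bc _) (mulC_derive2 bc _)).
apply: etrans _ (derive_addv _ _ (smooth_at_differentiable sm)).
by rewrite add_col_mx addr0 add0r.
Qed.

Lemma smooth_commg (a : G) : smooth_map (fun y : G => [~ a, y]%g).
Proof.
apply: smooth_mulg; first exact: smooth_map_cst.
apply: smooth_mulg; last by apply: smooth_mulg; [exact: smooth_map_cst|exact: smooth_map_id].
exact: smooth_invg (@smooth_map_id R n G).
Qed.

(** With the convention [[~ a, y] = a^-1 y^-1 a y], one has [a y a^-1 = y (a [~ a, y] a^-1)];
    differentiate this in [y] at 1. *)
Lemma tmap_commg (a : G) X :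
  AdC c a (tmap c c (fun y : G => [~ a, y]%g) X) = AdC c a X - X.
Proof.
pose f (y : G) := (a * [~ a, y] * a^-1)%g.
have sa := smooth_commg a; have sf := smooth_map_comp sa (smooth_conjg a).
have f1 : f 1%g = 1%g by rewrite /f commg1 mulg1 mulgV.
have E : AdC c a (tmap c c (fun y : G => [~ a, y]%g) X) = tmap c c f X.
  have a1 : (a * 1 * a^-1)%g = 1%g by rewrite mulg1 mulgV.
  exact: (esym (tmap_comp bc bc bc sa (smooth_conjg a) (commg1 a) a1 X)).
have fE y : (a * y * a^-1)%g = (y * f y)%g.
  by rewrite /f /commg /conjg !mulgA mulgK mulgV mul1g.
suff -> : AdC c a X = X + tmap c c f X by rewrite E addrC addKr.
have sf' := tmap_smooth bc bc sf f1.
have fe : c (f (cinv c e)) = e by rewrite (cinv_base bc) f1.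
apply: etrans _ (etrans (derive_mulC X (smooth_at_id e) sf' erefl fe) _); last first.
  by rewrite derive_id.
rewrite AdCE; apply: derive_near.
have := coord_near bc.2 bc sf f1; apply: filterS => y yE.
apply: etrans _ (esym (coord2E c (fun p => p.1 * p.2)%g _ _)).
by rewrite yE fE.
Qed.

Section commutator_subgroup.
Variable K : set G.
Hypotheses (sK : is_subgroup K) (commK : forall x y, K [~ x, y]%g).

(* [K] contains a germ at [1] of a parametrized family with differential [A]. *)
Let Tan (A : 'M[R]_n) := exists F : 'cV[R]_n -> 'cV[R]_n,
  [/\ smooth_at F 0, F 0 = e, \forall t \near (0 : 'cV[R]_n), K (cinv c (F t)) &
      forall v, 'D_v F 0 = A *m v].

Let TanD A B : Tan A -> Tan B -> Tan (A + B).
Proof.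
move=> [F [sF F0 KF dF]] [F' [sF' F'0 KF' dF']].
have sm : smooth_at (mulC c) (col_mx (F 0) (F' 0)) by rewrite F0 F'0; exact: mulC_smooth.
have sc := smooth_at_col sF sF'.
exists (fun t => mulC c (col_mx (F t) (F' t))); split.
- exact: (smooth_at_comp sc sm).
- by rewrite F0 F'0; exact: (nbhs_singleton (mulCe bc)).
- have [d d0 mP] := mulC_ball bc.
  have nF : \forall t \near (0 : 'cV[R]_n), `|F t - e| < d.
    apply: (smooth_at_near (P := fun x => `|x - e| < d) sF).
    by rewrite F0; apply: (ball_near d0).
  have nF' : \forall t \near (0 : 'cV[R]_n), `|F' t - e| < d.
    apply: (smooth_at_near (P := fun x => `|x - e| < d) sF').
    by rewrite F'0; apply: (ball_near d0).
  apply: filterS (filterI (filterI KF KF') (filterI nF nF')) => t [[K1 K2] [b1 b2]].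
  by have [_ -> _ _] := mP _ _ b1 b2; case: sK => _ + _; exact.
- by move=> v; rewrite (derive_mulC _ sF sF' F0 F'0) dF dF' mulmxDl.
Qed.

Let Tan0 : Tan 0.
Proof.
exists (cst e); split=> //; first exact: smooth_at_cst.
  by apply: (ball_near ltr01) => t _; rewrite /= (cinv_base bc); case: sK.
by move=> v; rewrite mul0mx; exact: derive_cstE.
Qed.

(** Commutators supply the rank-one differentials [w *m r], and products of such families add the
    differentials up to the identity matrix. *)
Let T (w : 'cV[R]_n) := forall r : 'rV[R]_n, Tan (w *m r).

Let T_comm a Y : T (tmap c c (fun y : G => [~ a, y]%g) Y).
Proof.
(* The parameter [t] moves [y] in [[~ a, y]] from 1 along [Y] alone, by the scalar [r *m t]. *)
move=> r; pose L (t : 'cV[R]_n) : 'cV[R]_n := Y *m r *m t + e.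
have sL : smooth_at L 0.
  apply: smooth_atD; last exact: smooth_at_cst.
  by apply: (smooth_at_lin (L := mulmx (Y *m r))); exact: linear_col_continuous.
have L0 : L 0 = e by rewrite /L mulmx0 add0r.
have sa := smooth_commg a; have a1 := commg1 a.
have sc := tmap_smooth bc bc sa a1; rewrite -L0 in sc.
exists (fun t => c [~ a, cinv c (L t)]%g); split.
- exact: (smooth_at_comp sL sc).
- by rewrite L0 (cinv_base bc) commg1.
- have nc := coord_near bc.2 bc sa a1; rewrite -L0 in nc.
  by apply: filterS (smooth_at_near sL nc) => t /= ->.
- move=> v; apply: etrans (derive_chain _ (smooth_at_differentiable sL) (smooth_at_differentiable sc)) _.
  have -> : 'D_v L 0 = (r *m v) 0 0 *: Y.
    have dl : 'D_v (fun t => Y *m r *m t) 0 = Y *m r *m v.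
      apply: etrans (derive_lin (L := mulmx (Y *m r)) (f := id) _ _ _) _.
      - exact: linear_col_continuous.
      - exact: (smooth_at_differentiable (smooth_at_id _)).
      - by rewrite derive_id.
    have d1 : derivable (fun t : 'cV[R]_n => Y *m r *m t) 0 v.
      apply/diff_derivable/smooth_at_differentiable/(smooth_at_lin (L := mulmx (Y *m r))).
      exact: linear_col_continuous.
    have d2 : derivable (cst e : 'cV[R]_n -> 'cV[R]_n) 0 v by exact: derivable_cst.
    apply: etrans (deriveD d1 d2) _; rewrite dl derive_cst addr0 -mulmxA.
    by rewrite {1}[r *m v]mx11_scalar mul_mx_scalar.
  apply: etrans (derive_scale _ _ (smooth_at_differentiable sc)) _.
  rewrite L0 -mulmxA [in RHS](mx11_scalar (r *m v)) mul_mx_scalar.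
  by [].
Qed.

Hypothesis Adfree : forall l : 'rV[R]_n, (forall g X, l *m AdC c g X = l *m X) -> l = 0.

Let T_full w : T w.
Proof.
apply: (prop_subspace_full (T := T)) => [r|v v' Tv Tv' r|a v Tv r|l lT].
- by rewrite mul0mx.
- by rewrite mulmxDl; exact: TanD.
- by rewrite -scalemxAl scalemxAr; exact: Tv.
(* Commutators with [g^-1] give the directions [X - Ad g X], so a functional killing [T] is
   Ad-invariant. *)
- apply: Adfree => g X; have := lT _ (T_comm g^-1%g X).
  have := congr1 (AdC c g) (tmap_commg g^-1%g X).
  have gK Y : AdC c g (AdC c g^-1%g Y) = Y.
    by apply: etrans (esym (AdCM bc _ _ _)) _; rewrite mulgV; exact: AdC1.
  rewrite gK => ->; rewrite (linB (AdC_is_linear bc g)) gK mulmxBr.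
  by move=> /subr0_eq.
Qed.

(** A germ in [K] with identity differential covers a neighbourhood of 1, by [local_surjection]. *)
Lemma commutators_near1 : \forall x \near 1%g, K x.
Proof.
have [F [sF F0 KF dF]] : Tan 1%:M.
  have -> : 1%:M = \sum_(i < n) delta_mx i 0 *m (delta_mx 0 i : 'rV[R]_n).
    rewrite (mx1_sum_delta R n); apply: eq_bigr => i _.
    by rewrite mul_delta_mx.
  by elim/big_ind: _ => // i _; exact: T_full.
have [C [d [C0 d0 surj]]] : exists C d : R, [/\ 0 < C, 0 < d &
    forall z, `|z - F 0| < d -> exists2 x, `|x - 0| <= C * `|z - F 0| & F x = z].
  apply: (local_surjection (B := 1%:M) sF) => w.
  by rewrite dF !mul1mx.
have [r r0 rK] := near_ball KF.
have nz : \forall z \near e, K (cinv c z).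
  apply: (ball_near (d := Num.min d (r / C))); first by rewrite lt_min d0 divr_gt0.
  move=> z; rewrite lt_min => /andP[zd zr]; rewrite -F0 in zd zr.
  have [x xz <-] := surj z zd; apply: rK; apply: le_lt_trans xz _.
  by rewrite mulrC -ltr_pdivlMr.
have [_ c1] := bc.
have nc : \forall x \near 1%g, K (cinv c (c x)).
  exact: (cfun_continuous c1 nz).
apply: filterS (filterI nc (cdom_near c1)) => x [+ cx].
by rewrite cfunK.
Qed.
End commutator_subgroup.

Lemma semisimple_perfect : connected [set: G] -> semisimple G -> perfect G.
Proof.
move=> cG ssG K sK commK; apply/seteqP; split=> // x _.
apply: (subgroup_near1_full cG sK); apply: (commutators_near1 sK commK).
by move=> l; exact: Ad_functional.
Qed.
End perfect_semisimple.

(** * The Heisenberg extension *)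

Section smooth_bilinear.
Context {R : realType}.

Lemma smooth_map_cV2 k l m (f : 'cV[R]_k * 'cV[R]_l -> 'cV[R]_m) :
  (forall z : 'cV[R]_(k + l), smooth_at (fun z => f (usubmx z, dsubmx z)) z) ->
  smooth_map f.
Proof.
move=> sf; apply/smooth_mapP; split.
  move=> x; have E : f = (fun z => f (usubmx z, dsubmx z)) \o @col_pair R k l.
    by apply/funext => -[u v] /=; rewrite /col_pair /= col_mxKu col_mxKd.
  rewrite E; apply: continuous_comp; first exact: col_pair_continuous.
  exact: smooth_at_continuous (sf _).
move=> x c d [[c1 c2] [/= -> ->] <-] -> _ _; exact: sf.
Qed.

Let su k l (z : 'cV[R]_(k + l)) : smooth_at (fun z : 'cV[R]_(k + l) => usubmx z) z.
Proof. by apply: (smooth_at_lin (L := usubmx)); exact: usubmx_continuous. Qed.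
Let sd k l (z : 'cV[R]_(k + l)) : smooth_at (fun z : 'cV[R]_(k + l) => dsubmx z) z.
Proof. by apply: (smooth_at_lin (L := dsubmx)); exact: dsubmx_continuous. Qed.

Lemma smooth_addv m k (M : manifoldType R m) (f g : M -> 'cV[R]_k) :
  smooth_map f -> smooth_map g -> smooth_map (fun x => f x + g x).
Proof.
move=> sf sg; have s2 : smooth_map (fun p : 'cV[R]_k * 'cV[R]_k => p.1 + p.2).
  by apply: smooth_map_cV2 => z /=; apply: smooth_atD; [exact: su|exact: sd].
exact: (smooth_map_comp (smooth_map_pair sf sg) s2).
Qed.

Lemma smooth_oppv m k (M : manifoldType R m) (f : M -> 'cV[R]_k) :
  smooth_map f -> smooth_map (fun x => - f x).
Proof.
move=> sf; have s2 : smooth_map (fun p : 'cV[R]_k * 'cV[R]_k => - p.1).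
  apply: smooth_map_cV2 => z /=.
  have E : (fun z : 'cV[R]_(k + k) => - usubmx z) = (fun z => (- 1%:M : 'M[R]_k) *m usubmx z).
    by apply/funext => w; rewrite mulNmx mul1mx.
  by rewrite E; apply: smooth_at_mulmx; [exact: smooth_at_cst|exact: su].
exact: (smooth_map_comp (smooth_map_pair sf sf) s2).
Qed.

Lemma smooth_form m k (M : manifoldType R m) (Q : 'M[R]_k) (f g : M -> 'cV[R]_k) :
  smooth_map f -> smooth_map g -> smooth_map (fun x => (f x)^T *m Q *m g x).
Proof.
move=> sf sg; have s2 : smooth_map (fun p : 'cV[R]_k * 'cV[R]_k => p.1^T *m Q *m p.2).
  apply: smooth_map_cV2 => z /=; apply: smooth_at_mulmx; last exact: sd.
  apply: smooth_at_mulmx; last exact: smooth_at_cst.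
  apply: smooth_at_mx => i j.
  have E : (fun y : 'cV[R]_(k + k) => (usubmx y)^T i j) = (fun y => (usubmx y) j i).
    by apply/funext => y; rewrite mxE.
  by rewrite E; exact: (smooth_at_entry _ _ (su z)).
exact: (smooth_map_comp (smooth_map_pair sf sg) s2).
Qed.
End smooth_bilinear.

(** * The extension attached to an invariant form *)

Record invariant_form (R : realType) (n N : nat) (G : lieGroupType R n)
    (rho : sl_rep N G) := InvariantForm {
  form_mx :> 'M[R]_N ;
  form_anti : forall x y : 'cV[R]_N, x^T *m form_mx *m y = - (y^T *m form_mx *m x) ;
  form_inv : forall g (x y : 'cV[R]_N),
    (rho g *m x)^T *m form_mx *m (rho g *m y) = x^T *m form_mx *m y }.

(** The phantom argument [Q] enters the group law through its cocycle. *)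
Definition heisenberg (R : realType) (n N : nat) (G : lieGroupType R n)
  (rho : sl_rep N G) (Q : invariant_form rho) : Type :=
  (semidirect rho * 'cV[R]_1)%type.

Section heisenberg_extension.
Context {R : realType} (n N : nat) (G : lieGroupType R n) (rho : sl_rep N G)
  (Q : invariant_form rho).
Local Notation S := (semidirect rho).
Local Notation H := (heisenberg Q).

HB.instance Definition _ := Manifold.copy H (S * 'cV[R]_1)%type.

Definition cocycle (s t : S) : 'cV[R]_1 := (rho (t.1^-1)%g *m s.2)^T *m Q *m t.2.
Definition heis_mul (p q : H) : H := ((p.1 * q.1)%g, p.2 + q.2 + cocycle p.1 q.1).
Definition heis_one : H := (1%g, 0).
Definition heis_inv (p : H) : H := ((p.1^-1)%g, - p.2).

Lemma form_diag (x : 'cV[R]_N) : x^T *m Q *m x = 0.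
Proof.
apply/eqP; have /eqP := form_anti Q x x.
by rewrite -subr_eq0 opprK -mulr2n -scaler_nat scaler_eq0 pnatr_eq0.
Qed.

(** Expanding both sides, the terms that differ are equal by invariance of the form under
    [rho (t.1)^-1]. Associativity of [heis_mul] amounts to this identity. *)
Lemma cocycle_eq r s t : cocycle r s + cocycle (r * s)%g t =
  cocycle s t + cocycle r (s * t)%g.
Proof.
rewrite /cocycle /= invgM sl_repM !mulmxDr linearD /= !mulmxDl.
rewrite -[rho (t.1)^-1%g *m rho _ *m r.2]mulmxA form_inv.
by rewrite addrA addrC.
Qed.

Lemma cocycleVl s : cocycle s^-1%g s = 0.
Proof.
rewrite /cocycle /= mulmxN mulmxA -sl_repM mulVg sl_rep1 mul1mx.
by rewrite linearN /= !mulNmx form_diag oppr0.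
Qed.

Lemma cocycleVr s : cocycle s s^-1%g = 0.
Proof. by rewrite /cocycle /= invgK mulmxN form_diag oppr0. Qed.

Lemma cocycle1l s : cocycle 1%g s = 0.
Proof. by rewrite /cocycle /= mulmx0 trmx0 !mul0mx. Qed.

Lemma cocycle1r s : cocycle s 1%g = 0.
Proof. by rewrite /cocycle /= mulmx0. Qed.

Fact heis_mulA : associative heis_mul.
Proof.
move=> p q r; rewrite /heis_mul /= mulgA; congr (_, _).
have E (x y z a b a' b' : 'cV[R]_1) : a + b = a' + b' ->
    x + (y + z + a') + b' = x + y + a + z + b.
  by move=> /matrixP ab; apply/matrixP => i j; have := ab i j; rewrite !mxE; lra.
exact: E (cocycle_eq _ _ _).
Qed.
Fact heis_mul1g : left_id heis_one heis_mul.
Proof. by move=> [s r]; rewrite /heis_mul /= mul1g add0r cocycle1l addr0. Qed.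
Fact heis_mulg1 : right_id heis_one heis_mul.
Proof. by move=> [s r]; rewrite /heis_mul /= mulg1 cocycle1r !addr0. Qed.
Fact heis_mulVg : left_inverse heis_one heis_inv heis_mul.
Proof. by move=> [s r]; rewrite /heis_mul /= mulVg cocycleVl addr0 addNr. Qed.
Fact heis_mulgV : right_inverse heis_one heis_inv heis_mul.
Proof. by move=> [s r]; rewrite /heis_mul /= mulgV cocycleVr addr0 subrr. Qed.

HB.instance Definition _ :=
  isGroup.Build H heis_mulA heis_mul1g heis_mulg1 heis_mulVg heis_mulgV.

Let sfst : smooth_map (fun p : H => p.1 : S).
Proof. exact: (@smooth_map_fst R _ _ S 'cV[R]_1). Qed.
Let ssnd : smooth_map (fun p : H => p.2 : 'cV[R]_1).
Proof. exact: (@smooth_map_snd R _ _ S 'cV[R]_1). Qed.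

Fact heis_invg_smooth : smooth_map (fun x : H => x^-1%g).
Proof. exact: (smooth_map_pair (smooth_invg sfst) (smooth_oppv ssnd)). Qed.

Lemma smooth_cocycle m (M : manifoldType R m) (f g : M -> S) :
  smooth_map f -> smooth_map g -> smooth_map (fun x => cocycle (f x) (g x)).
Proof.
move=> sf sg.
have sG : smooth_map (fun s : S => s.1 : G) by exact: (@smooth_map_fst R _ _ G 'cV[R]_N).
have sV : smooth_map (fun s : S => s.2 : 'cV[R]_N) by exact: (@smooth_map_snd R _ _ G 'cV[R]_N).
(* [rho (g^-1) *m x] is the vector part of the product [(1, x) (g, 0)], so its smoothness follows
   from that of the group law. *)
have s1 : smooth_map (fun x => (1%g, (f x).2) : S).
  exact: (smooth_map_pair (smooth_map_cst M (1%g : G)) (smooth_map_comp sf sV)).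
have s2 : smooth_map (fun x => ((g x).1, 0) : S).
  exact: (smooth_map_pair (smooth_map_comp sg sG) (smooth_map_cst M (0 : 'cV[R]_N))).
have s3 := smooth_map_comp (smooth_mulg s1 s2) sV.
have := smooth_form Q s3 (smooth_map_comp sg sV).
congr smooth_map; apply/funext => x; rewrite /cocycle.
congr (_^T *m _ *m _); exact: (addr0 (rho ((g x).1)^-1%g *m (f x).2)).
Qed.

Fact heis_mulg_smooth : smooth_map (fun p : H * H => (p.1 * p.2)%g).
Proof.
have s1 : smooth_map (fun p : H * H => p.1) by exact: smooth_map_fst.
have s2 : smooth_map (fun p : H * H => p.2) by exact: smooth_map_snd.
have s11 := smooth_map_comp s1 sfst; have s21 := smooth_map_comp s2 sfst.
have s12 := smooth_map_comp s1 ssnd; have s22 := smooth_map_comp s2 ssnd.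
exact: (smooth_map_pair (smooth_mulg s11 s21)
  (smooth_addv (smooth_addv s12 s22) (smooth_cocycle s11 s21))).
Qed.

HB.instance Definition _ :=
  Manifold_Group_isLieGroup.Build R (n + N + 1)%N H heis_mulg_smooth heis_invg_smooth.

Definition heis_proj (p : H) : S := p.1.

Lemma heis_proj_central : central_extension heis_proj.
Proof.
split.
- by split; [|exact: sfst].
- by move=> s; exists (s, 0).
- move=> [s r]; rewrite /hom_kernel /heis_proj /= => -> [s' r'].
  by congr (_, _); rewrite /= ?mul1g ?mulg1 // cocycle1l cocycle1r !addr0 addrC.
Qed.

Lemma heis_kernel : hom_kernel heis_proj <> [set 1%g].
Proof.
move=> kE; have : hom_kernel heis_proj ((1%g, 1) : H) by [].
rewrite kE => -[] /colP/(_ 0); rewrite !mxE => /eqP.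
by rewrite eqxx oner_eq0.
Qed.
End heisenberg_extension.

(** * Perfectness of the extension *)

Section heisenberg_perfect.
Context {R : realType} (n N : nat) (G : lieGroupType R n) (rho : sl_rep N G)
  (Q : invariant_form rho).
Local Notation H := (heisenberg Q).
Hypotheses (perfG : perfect G) (rho_nt : no_trivial_constituent rho).
Hypothesis Q0 : exists x y : 'cV[R]_N, x^T *m Q *m y <> 0.

Let E (g : G) (x : 'cV[R]_N) (r : 'cV[R]_1) : H := ((g, x), r).

Let EM g x r h y s : (E g x r * E h y s)%g =
  E (g * h)%g (rho h^-1%g *m x + y) (r + s + (rho h^-1%g *m x)^T *m Q *m y).
Proof. by []. Qed.

Lemma heis_perfect : perfect H.
Proof.
move=> K [K1 KM KV] commK.
(* The equation exhibits [c] as the commutator of [a] and [b]. *)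
have Kc (a b c : H) : (a * b)%g = (b * a * c)%g -> K c.
  by rewrite commgC => /mulgI <-; exact: commK.
have r1 : rho 1^-1%g = 1%:M by rewrite invg1 sl_rep1.
have Kz r : K (E 1%g 0 r).
  have [x [y /eqP xy]] := Q0; have xy0 : (x^T *m Q *m y) 0 0 != 0.
    by apply: contra xy => /eqP xy0; apply/eqP/matrixP => i j; rewrite !ord1 xy0 mxE.
  (* By antisymmetry the commutator of [t *: x] and [y] has central part twice [t] times the form at
     [x], [y]. *)
  have [t rE] : exists t, r = t *: (x^T *m Q *m y) + t *: (x^T *m Q *m y).
    move: (x^T *m Q *m y) xy0 => q q0; exists (r 0 0 / (2 * q 0 0)).
    by apply/matrixP => i j; rewrite !ord1 !mxE; field.
  apply: (Kc (E 1%g (t *: x) 0) (E 1%g y 0)).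
  rewrite !EM r1 !mul1mx mulmx0 !addr0 !add0r !mulg1 [t *: x + y]addrC; congr (E _ _ _).
  by rewrite [in RHS](form_anti Q y) linearZ /= -!scalemxAl rE addKr.
have Kr x r s : K (E 1%g x r) -> K (E 1%g x s).
  move=> Kx; have := KM _ _ Kx (Kz (s - r)).
  rewrite EM r1 !mul1mx mulmx0 !addr0 mulg1.
  by rewrite addrC subrK.
have Kx x r : K (E 1%g x r).
  (* [K] is only a group; closure under scalars is built in by asking for all multiples of [y]. *)
  suff T : forall y, (forall (a : R) s, K (E 1%g (a *: y) s)) by rewrite -[x]scale1r.
  apply: prop_subspace_full => [a s|v w Tv Tw a s|a v Tv b s|l lT].
  - by rewrite scaler0.
  - apply: (Kr _ (0 + 0 + (a *: v)^T *m Q *m (a *: w))).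
    by have := KM _ _ (Tv a 0) (Tw a 0); rewrite EM r1 mul1mx mulg1 scalerDr.
  - by rewrite scalerA.
  - apply: (no_trivial_constituent_functional rho_nt) => g v.
    suff : l *m (v - rho g *m v) = 0 by rewrite mulmxBr => /subr0_eq.
    apply: lT => a s; rewrite -[a *: _]/(a *: _) scalerBr scalemxAr.
    move: (a *: v) => {}v.
    apply: (Kr _ (- ((rho g *m v)^T *m Q *m (v - rho g *m v)))).
    (* The commutator of [g^-1] and [v] has vector part [v - rho g *m v]. *)
    apply: (Kc (E g^-1%g 0 0) (E 1%g v 0)).
    rewrite !EM r1 !mul1mx invgK !mulmx0 !addr0 !add0r trmx0 !mul0mx mul1g !mulg1.
    by rewrite addNr [rho g *m v + _]addrC subrK.
have KG g : K (E g 0 0).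
  have : [set g | K (E g 0 0)] g; last by [].
  have EG a b : (E a 0 0 * E b 0 0)%g = E (a * b)%g 0 0.
    by rewrite EM mulmx0 trmx0 !mul0mx !addr0.
  have EV a : (E a 0 0)^-1%g = E a^-1%g 0 0.
    by apply: (mulgI (E a 0 0)); rewrite EG !mulgV.
  rewrite (perfG (K := [set g | K (E g 0 0)])) //.
    split; first exact: K1.
    - by move=> a b Ka Kb; rewrite /= -EG; exact: KM.
    - by move=> a Ka; rewrite /= -EV; exact: KV.
  move=> a b; apply: (Kc (E a 0 0) (E b 0 0)).
  by rewrite !EG -commgC.
apply/seteqP; split=> // -[[g x] r] _.
have := KM _ _ (KG g) (Kx x r).
by rewrite EM mulmx0 trmx0 !mul0mx !add0r addr0 mulg1.
Qed.
End heisenberg_perfect.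

Lemma symplectic_extension (R : realType) (n N : nat) (G : lieGroupType R n)
    (rho : sl_rep N G) : perfect G -> no_trivial_constituent rho ->
  symplectic_contribution rho ->
  exists (d : nat) (H : lieGroupType R d) (theta : H -> semidirect rho),
     perfect_central_extension theta /\ hom_kernel theta <> [set 1%g].
Proof.
move=> perfG rho_nt [om [[omr oml] om_anti [w1 [w2 om12]] om_inv]].
pose Q : 'M[R]_N := \matrix_(i, j) om (delta_mx i 0) (delta_mx j 0).
have QE (x y : 'cV[R]_N) : x^T *m Q *m y = (om x y)%:M.
  apply/matrixP => i0 j0; rewrite !ord1 -mulmxA !mxE mulr1n.
  have linl y' : linear (om^~ y' : 'cV[R]_N -> R^o) by exact: oml.
  have linr x' : linear (om x' : 'cV[R]_N -> R^o) by exact: omr.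
  rewrite [x in RHS]matrix_sum_delta (lin_sum (linl _)); apply: eq_bigr => i _.
  rewrite big_ord1 (linZ (linl _)) !mxE; congr (_ * _).
  rewrite [y in RHS]matrix_sum_delta (lin_sum (linr _)); apply: eq_bigr => j _.
  by rewrite big_ord1 (linZ (linr _)) !mxE mulrC.
have anti (x y : 'cV[R]_N) : x^T *m Q *m y = - (y^T *m Q *m x).
  by rewrite !QE om_anti raddfN.
have inv g (x y : 'cV[R]_N) : (rho g *m x)^T *m Q *m (rho g *m y) = x^T *m Q *m y.
  by rewrite !QE om_inv.
pose F : invariant_form rho := InvariantForm anti inv.
exists (n + N + 1)%N, (heisenberg F), (@heis_proj _ _ _ _ _ F); split; last exact: heis_kernel.
split; first exact: heis_proj_central.
apply: heis_perfect => //; exists w1, w2; rewrite [LHS]QE => /matrixP/(_ 0 0).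
by rewrite !mxE.
Qed.

(** * Central extensions of the semidirect product *)

Lemma continuous_translate (R : realType) n (G : lieGroupType R n)
    (c : chart R n G) (f : G -> R) : based c ->
  (forall g, smooth_at (fun y => f (cinv c y * g)%g) (c 1%g)) -> continuous f.
Proof.
move=> [ac c1] sf g; have sg := smooth_at_continuous (sf g).
have nc : \forall x \near g, cdom c (x * g^-1)%g by exact: near1_mulr (cdom_near c1).
have cc : {for g, continuous (fun x => f (cinv c (c (x * g^-1)) * g)%g)}.
  apply: (continuous_comp (f := fun x => c (x * g^-1)%g) (g := fun y => f (cinv c y * g)%g)).
    apply: (continuous_comp (f := fun x => (x * g^-1)%g) (g := c)).
      exact: mulgr_continuous.
    by rewrite mulgV; exact: cfun_continuous.
  by rewrite mulgV.
have E x : cdom c (x * g^-1)%g -> f (cinv c (c (x * g^-1)) * g)%g = f x.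
  by move=> cx; rewrite cfunK // -mulgA mulVg mulg1.
rewrite /prop_for /continuous_at -(E g) ?mulgV //.
have {}E : \forall x \near g, f (cinv c (c (x * g^-1)) * g)%g = f x by apply: filterS nc.
move: cc; rewrite /prop_for /continuous_at mulgV; apply: cvg_trans.
exact: near_eq_cvg E.
Qed.

(** * The differential of a central extension and its kernel *)

Section extension.
Context {R : realType} (d n : nat) (H : lieGroupType R d) (S : lieGroupType R n).
Variables (c : chart R n S) (theta : H -> S).
Local Notation b := (chart1 H).
Local Notation e := (b 1%g).
Let bb : based b := chart1_based H.
Hypotheses (bc : based c) (cext : central_extension theta).
Let mth : lie_morphism theta. Proof. by case: cext. Qed.
Let surj s : exists h, theta h = s. Proof. by case: cext. Qed.
Let central z h : theta z = 1%g -> (z * h)%g = (h * z)%g.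
Proof. by case: cext => _ _ + z1; exact. Qed.
Hypothesis connS : connected [set: S].
Hypothesis Sfree : forall l : 'rV[R]_n,
  (forall s X, l *m AdC c s X = l *m X) -> l = 0.
Local Notation T := (tmx b c theta).

Lemma Admx_theta_smooth : smooth_at (fun y => Admx c (theta (cinv b y))) e.
Proof.
have st := theta_smooth bb bc mth.
have sAm : smooth_at (fun x => Admx c (cinv c x)) (c (theta (cinv b e))).
  by rewrite (cinv_base bb) (lie_morphism1 mth); exact: Admx_smooth.
apply: smooth_at_eq (smooth_at_comp st sAm).
by apply: filterS (theta_near bb bc mth) => y cy; rewrite cfunK.
Qed.

(* If [l] vanishes on the image, then [l (Ad (theta h) Y)] is locally constant in
   [h], so that [l (Ad s Y)] has countable range, and is constant, on [S]. *)
Lemma tmx_surjective (w : 'cV[R]_n) : exists v : 'cV[R]_d, T *m v = w.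
Proof.
apply: (prop_subspace_full (T := fun w => exists v : 'cV[R]_d, T *m v = w)).
- by exists 0; rewrite mulmx0.
- by move=> _ _ [v <-] [v' <-]; exists (v + v'); rewrite mulmxDr.
- by move=> a _ [v <-]; exists (a *: v); rewrite scalemxAr.
move=> l lT; have {}lT (v : 'cV[R]_d) : l *m (T *m v) = 0 by apply: lT; exists v.
have lbr (v : 'cV[R]_d) W : l *m bracketC c (T *m v) W = 0.
  rewrite (bracketCC bc) mulmxN; suff -> : l *m bracketC c W (T *m v) = 0 by rewrite oppr0.
  rewrite bracketCE.
  have := derive_lin (L := mulmx l) W (linear_col_continuous (L := mulmx l))
    (smooth_at_differentiable (AdC_smooth bc (T *m v))).
  move=> <-; have E x : l *m AdC c (cinv c x) (T *m v) = 0.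
    by have [h <-] := surj (cinv c x); rewrite -(tmx_AdC bb bc mth); exact: lT.
  by rewrite (funext E) derive_cstE.
apply: Sfree => s Y; pose F (s : S) : R := (l *m AdC c s Y) 0 0.
have sF g : smooth_at (fun y => F (cinv c y * g)%g) (c 1%g).
  have E y : F (cinv c y * g)%g = (l *m AdC c (cinv c y) (AdC c g Y)) 0 0.
    by rewrite /F (AdCM bc).
  rewrite (funext E); apply: smooth_at_entry; apply: smooth_at_mulmx; first exact: smooth_at_cst.
  exact: AdC_smooth.
have cF : continuous F by exact: continuous_translate bc sF.
have E h y : F (theta (cinv b y * h)%g) =
    (l *m (Admx c (theta (cinv b y)) *m AdC c (theta h) Y)) 0 0.
  by rewrite /F (lie_morphismM mth) (AdCM bc) (AdmxE bc).
have sM h : smooth_at (fun y => l *m (Admx c (theta (cinv b y)) *m AdC c (theta h) Y)) e.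
  apply: smooth_at_mulmx; first exact: smooth_at_cst.
  by apply: smooth_at_mulmx; [exact: Admx_theta_smooth|exact: smooth_at_cst].
have cR : countable (range (F \o theta)).
  apply: countable_range; apply: (derive0_locally_constant bb) => h.
    by rewrite /comp (funext (E h)); exact: smooth_at_entry.
  move=> v; rewrite /comp (funext (E h)).
  rewrite -(derive_entry v 0 0 (smooth_at_differentiable (sM h))).
  have -> : 'D_v (fun y => l *m (Admx c (theta (cinv b y)) *m AdC c (theta h) Y)) e = 0.
    apply: etrans (derive_mulmx _ (smooth_at_cst _ _) _) _.
      by apply: smooth_at_mulmx; [exact: Admx_theta_smooth|exact: smooth_at_cst].
    rewrite derive_cstE mul0mx add0r.
    rewrite (derive_mulmx _ Admx_theta_smooth (smooth_at_cst _ _)).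
    rewrite derive_cstE mulmx0 addr0 (dmx_theta bb bc mth v (Admx_smooth bc)).
    by rewrite -(bracketE bc); exact: lbr.
  by rewrite mxE.
have Fcst := countable_connected_cst connS cF _ s 1%g.
apply/matrixP => i j; rewrite !ord1 -/(F s) Fcst /F ?(AdC1 bc) //.
apply: sub_countable cR; apply: subset_card_le => _ [x _ <-].
by have [h <-] := surj x; exists h.
Qed.

Lemma tmx_right_inverse : exists B, T *m B = 1%:M.
Proof.
have [v vE] := choice (fun j => tmx_surjective (delta_mx j 0)).
exists (\matrix_(i, j) v j i 0); apply/matrixP => i j.
have /colP/(_ i) := vE j; rewrite !mxE eqxx andbT => <-.
by apply: eq_bigr => k _; rewrite !mxE.
Qed.

Local Notation f := (fun y => c (theta (cinv b y))).

Lemma theta_local_surjection : exists C r : R, [/\ 0 < C, 0 < r &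
  forall z, `|z - c 1%g| < r -> exists2 x, `|x - e| <= C * `|z - c 1%g| & f x = z].
Proof.
have fe : f e = c 1%g by rewrite (cinv_base bb) (lie_morphism1 mth).
have [B TB] := tmx_right_inverse; rewrite -fe.
apply: (local_surjection (B := B) (theta_smooth bb bc mth)) => w.
by rewrite -[LHS]/(tmap b c theta (B *m w)) -(tmxE bb bc mth) mulmxA TB mul1mx.
Qed.

(** The linear bound in the local surjection keeps the preimages inside [A]. *)
Lemma theta_open (A : set H) : (\forall h \near 1%g, A h) ->
  \forall s \near 1%g, exists2 h, A h & theta h = s.
Proof.
move=> nA; have [C [r [C0 r0 surjr]]] := theta_local_surjection.
have nA' : \forall y \near e, A (cinv b y) by exact: chart_near bb.2 nA.
have [r1 r10 rA] := near_ball (filterI nA' (theta_near bb bc mth)).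
have nz : \forall z \near c 1%g, exists2 h, A h & theta h = cinv c z.
  apply: (ball_near (d := Num.min r (r1 / C))); first by rewrite lt_min r0 divr_gt0.
  move=> z; rewrite lt_min => /andP[zr zr1].
  have [x xz fx] := surjr z zr.
  have [Ax cx] : A (cinv b x) /\ cdom c (theta (cinv b x)).
    by apply: rA; apply: le_lt_trans xz _; rewrite mulrC -ltr_pdivlMr.
  by exists (cinv b x) => //; rewrite -fx cfunK.
have [_ c1] := bc.
have nc : \forall s \near 1%g, exists2 h, A h & theta h = cinv c (c s).
  exact: (cfun_continuous c1 nz).
by apply: filterS (filterI nc (cdom_near c1)) => s [[h Ah hs] cs]; exists h; rewrite // hs cfunK.
Qed.

Lemma line_near (w : 'cV[R]_d) r : 0 < r ->
  \forall t \near (0 : R), `|t *: w + e - e| < r.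
Proof.
move=> r0; have w1 : 0 < `|w| + 1 by rewrite ltr_wpDl.
apply: (ball_near (d := r / (`|w| + 1))); first exact: divr_gt0.
move=> t; rewrite subr0 ltr_pdivlMr // => tr1.
by rewrite addrK normrZ; apply: le_lt_trans tr1; rewrite ler_wpM2l // lerDl.
Qed.

(* The curve [X] follows the preimages given by the local surjection; being
   [o(t)]-close to the base point, it is differentiable at [0] with zero
   derivative, which is all that the chain rule needs. *)
Lemma kernel_curve (w : 'cV[R]_d) : T *m w = 0 -> exists X : R -> 'cV[R]_d,
  [/\ X 0 = e, is_derive (0 : R) 1 X 0 &
      \forall t \near (0 : R), f (X t) = f (t *: w + e)].
Proof.
move=> Tw; have [C [r [C0 r0 surjr]]] := theta_local_surjection.
have fe : f e = c 1%g by rewrite (cinv_base bb) (lie_morphism1 mth).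
have sf := theta_smooth bb bc mth.
have df : derivable f e w by exact/diff_derivable/smooth_at_differentiable.
have dw : 'D_w f e = 0 by rewrite -[LHS]/(tmap b c theta w) -(tmxE bb bc mth).
(* Outside the range of the local surjection the value of [X] is arbitrary; only [t] near 0
   matters. *)
have /choice[X XP] : forall t : R, exists x : 'cV[R]_d, `|f (t *: w + e) - f e| < r ->
    `|x - e| <= C * `|f (t *: w + e) - f e| /\ f x = f (t *: w + e).
  move=> t; have [tr|_] := boolP (`|f (t *: w + e) - f e| < r); last by exists e.
  by rewrite fe in tr *; have [x x1 x2] := surjr _ tr; exists x.
have X0 : X 0 = e.
  have [] := XP 0; first by rewrite scale0r add0r subrr normr0.
  rewrite scale0r add0r subrr normr0 mulr0 normr_le0 subr_eq0 => /eqP -> _.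
  by [].
have near_r : \forall t \near (0 : R), `|f (t *: w + e) - f e| < r.
  have nf : \forall y \near e, `|f y - f e| < r.
    exact: (smooth_at_near (P := fun y => `|y - f e| < r) sf (ball_near r0 _)).
  have [r1 r10 r1P] := near_ball nf.
  by apply: filterS (line_near w r10) => t; exact: r1P.
exists X; split=> //; last by apply: filterS near_r => t /XP[].
have L : h^-1 *: ((X \o shift 0) (h *: (1 : R)) - X 0) @[h --> (0 : R)^'] --> (0 : 'cV[R]_d).
  apply/cvgr0Pnorm_lt => eps eps0.
  have L2 : h^-1 *: ((f \o shift e) (h *: w) - f e) @[h --> (0 : R)^'] --> (0 : 'cV[R]_n).
    by rewrite -dw; exact: df.
  have /cvgr0Pnorm_lt/(_ _ (divr_gt0 eps0 C0)) n2 := L2.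
  have n1 : \forall t \near (0 : R)^', `|f (t *: w + e) - f e| < r by exact: cvg_within near_r.
  apply: filterS (filterI n1 n2) => h /= [/XP[Xh _]].
  rewrite !normrZ ltr_pdivlMr // => fh; apply: le_lt_trans fh.
  rewrite addr0 /GRing.scale /= mulr1 X0 -mulrA; apply: ler_wpM2l => //.
  by rewrite mulrC.
apply: DeriveDef; first exact: (cvgP _ L).
by apply: (cvg_lim _ L); exact: norm_hausdorff.
Qed.

(** The curves [X] and [l t = t *: w + e] have the same image under [theta], so [z = X^-1 l] is
    central and [h l h^-1 = (h X h^-1) z]. The left side has velocity [Ad h w] at 0; as [X] has zero
    velocity, the right side has velocity [w]. *)
Lemma kernel_AdC (w : 'cV[R]_d) h : T *m w = 0 -> AdC b h w = w.
Proof.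
move=> Tw; have [X [X0 dX fX]] := kernel_curve Tw.
pose kap x := b (h * cinv b x * h^-1)%g.
have skap : smooth_at kap e.
  by apply: (tmap_smooth bb bb (smooth_conjg h)); rewrite mulg1 mulgV.
(* In coordinates, [Phi (x, y)] is [(h x h^-1) (x^-1 y)], to be compared with [h y h^-1]. *)
pose Phi z := mulC b (col_mx (kap (usubmx z)) (ldivC b z)).
have kape : kap e = e by rewrite /kap (cinv_base bb) mulg1 mulgV.
have ldive : ldivC b (col_mx e e) = e.
  by rewrite /ldivC coord2E /= (cinv_base bb) mulg1 invg1.
have su (z : 'cV[R]_(d + d)) : smooth_at (fun z : 'cV[R]_(d + d) => usubmx z) z.
  by apply: (smooth_at_lin (L := usubmx)); exact: usubmx_continuous.
have skap' : smooth_at kap (usubmx (col_mx e e)) by rewrite col_mxKu.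
have sldiv : smooth_at (ldivC b) (col_mx e e).
  by rewrite /ldivC; apply: (coord2_smooth bb); [exact: sldiv2|rewrite /= mulg1 invg1].
have sPhi : smooth_at Phi (col_mx e e).
  apply: (smooth_at_comp (smooth_at_col (smooth_at_comp (su _) skap') sldiv)).
  by rewrite col_mxKu kape ldive; exact: mulC_smooth.
have hh1 : (h * 1 * h^-1)%g = 1%g by rewrite mulg1 mulgV.
have nkap := coord_near bb.2 bb (smooth_conjg h) hh1.
have PhiE : exists2 r, 0 < r & forall x y, `|x - e| < r -> `|y - e| < r ->
    f x = f y -> Phi (col_mx x y) = kap y.
  have [r1 r10 kapP] := near_ball (filterI nkap (theta_near bb bc mth)).
  have [r2 r20 ldP] := coord2_ball bb (sldiv2 H) (etrans (mulg1 _) (invg1 _)).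
  exists (Num.min r1 r2); first by rewrite lt_min r10.
  move=> x y; rewrite !lt_min => /andP[x1 x2] /andP[y1 y2] fxy.
  have [kx cx] := kapP x x1; have [_ cy] := kapP y y1; have [_ ldE] := ldP x y x2 y2.
  have th : theta (cinv b x) = theta (cinv b y).
    by rewrite -[LHS](cfunK cx) fxy cfunK.
  rewrite /Phi col_mxKu /mulC coord2E /= /ldivC ldE /= {1}/kap kx /kap.
  congr (b _); set z := ((cinv b x)^-1 * cinv b y)%g.
  have -> : cinv b y = (cinv b x * z)%g by rewrite mulgA mulgV mul1g.
  have z1 : theta z = 1%g by rewrite (lie_morphismM mth) (lie_morphismV mth) th mulVg.
  move: z z1 (cinv b x) => {}z z1 k; have zh := central h^-1%g z1.
  rewrite -[LHS]mulgA -zh !mulgA; done.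
have [r r0 PhiP] := PhiE.
pose l (t : R) := t *: w + e.
have l0 : l 0 = e by rewrite /l scale0r add0r.
have X0P : differentiable X (0 : R) by apply/derivable1_diffP; exact: ex_derive.
have dl : is_derive (0 : R) 1 l w.
  have E : l = (fun s : R => e + s *: w) by apply/funext => s; rewrite /l addrC.
  rewrite E; have := @is_derive_line R _ _ id e w 0.
  rewrite derive_id; apply; exact: smooth_at_differentiable (smooth_at_id _).
have dlP : differentiable l (0 : R) by apply/derivable1_diffP; exact: ex_derive.
have nX : \forall t \near (0 : R), `|X t - e| < r.
  have cX : X t @[t --> (0 : R)] --> X 0 by exact: differentiable_continuous X0P.
  move/cvgrPdist_lt: cX => /(_ r r0); apply: filterS => t.
  by rewrite X0 distrC.
have nE : \forall t \near (0 : R), Phi (col_mx (X t) (l t)) = kap (l t).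
  by apply: filterS (filterI (filterI nX (line_near w r0)) fX) => t [[xr lr] ff]; exact: PhiP.
have dE : 'D_1 (fun t => Phi (col_mx (X t) (l t))) (0 : R) = 'D_1 (fun t => kap (l t)) 0.
  exact: derive_near.
have dR : 'D_1 (fun t => kap (l t)) (0 : R) = AdC b h w.
  have dk : differentiable kap (l 0) by rewrite l0; exact: smooth_at_differentiable.
  apply: etrans (derive_chain _ dlP dk) _.
  by rewrite (derive_val (is_derive := dl)) l0 AdCE.
have dL : 'D_1 (fun t => Phi (col_mx (X t) (l t))) (0 : R) = w.
  have dZ : differentiable (fun t => col_mx (X t) (l t)) (0 : R).
    have dp := differentiable_pair X0P dlP.
    have dc p : differentiable (@col_pair R d d) p.
      by apply: linear_differentiable; exact: col_pair_continuous.
    exact: (differentiable_comp dp (dc _)).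
  have dP : differentiable Phi (col_mx (X 0) (l 0)).
    by rewrite X0 l0; exact: smooth_at_differentiable.
  apply: etrans (derive_chain _ dZ dP) _.
  rewrite X0 l0 (derive_col _ X0P dlP).
  rewrite (derive_val (is_derive := dX)) (derive_val (is_derive := dl)).
  apply: etrans (esym (derive_slice2 _ sPhi)) _.
  transitivity ('D_w id e : 'cV[R]_d); last by rewrite derive_id.
  apply: derive_near.
  have [r2 r20 bK] := chart_ball bb; apply: (ball_near r20) => y /bK yK.
  have ldE : ldivC b (col_mx e y) = y.
    by rewrite /ldivC coord2E /= (cinv_base bb) invg1 mul1g.
  by rewrite /Phi col_mxKu kape ldE /mulC coord2E /= (cinv_base bb) mul1g.
by rewrite -dR -dE dL.
Qed.

Lemma kernel_bracket (w : 'cV[R]_d) Y : T *m w = 0 -> bracketC b w Y = 0.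
Proof.
move=> Tw; rewrite (bracketCC bb) bracketCE.
have E x : AdC b (cinv b x) w = w by exact: kernel_AdC.
by rewrite (funext E) derive_cstE oppr0.
Qed.
End extension.

(** * The form carried by a nonzero kernel *)

Section semidirect_extension.
Context {R : realType} (d n N : nat) (G : lieGroupType R n) (rho : sl_rep N G)
  (H : lieGroupType R d).
Local Notation S := (semidirect rho).
Local Notation c := (sd_chart rho).
Local Notation cG := (chart1 G).
Local Notation b := (chart1 H).
Local Notation e := (b 1%g).
Let bb : based b := chart1_based H.
Let bc : based c := sd_chart_based rho.
Let bG : based cG := chart1_based G.
Hypotheses (ssG : semisimple G) (rho_nt : no_trivial_constituent rho)
  (connG : connected [set: G]).

Lemma sd_Ad_functional (l : 'rV[R]_(n + N)) :
  (forall (s : S) X, l *m AdC c s X = l *m X) -> l = 0.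
Proof.
move=> linv; have lE (X : 'cV[R]_n) (Y : 'cV[R]_N) :
    l *m col_mx X Y = lsubmx l *m X + rsubmx l *m Y.
  by rewrite -{1}[l]hsubmxK mul_row_col.
have linv' g X Y : lsubmx l *m AdC cG g X + rsubmx l *m (rho g *m Y) =
    lsubmx l *m X + rsubmx l *m Y.
  by rewrite -!lE -(sd_AdC rho).
rewrite -[l]hsubmxK.
have -> : lsubmx l = 0.
  by apply: (Ad_functional ssG) => g X; have := linv' g X 0; rewrite !mulmx0 !addr0.
have -> : rsubmx l = 0.
  apply: (no_trivial_constituent_functional rho_nt) => g v; have := linv' g 0 v.
  by rewrite (lin0 (AdC_is_linear bG g)) !mulmx0 !add0r.
exact: row_mx0.
Qed.

Variable theta : H -> S.
Hypothesis cext : central_extension theta.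
Hypothesis connS : connected [set: S].
Let mth : lie_morphism theta. Proof. by case: cext. Qed.
Local Notation T := (tmx b c theta).

Local Opaque tmx tmap.
(** Since [p] kills brackets with lifts of [g], and [ker T] brackets to 0, [p [Y, Z]] depends only
    on the vector parts of the images of [Y] and [Z]. It defines [beta], and the two cases are
    [beta] nonzero and [beta] zero. *)
Lemma kernel_dichotomy (w0 : 'cV[R]_d) : T *m w0 = 0 -> w0 <> 0 ->
  symplectic_contribution rho \/
  exists p : 'rV[R]_d, p *m w0 <> 0 /\ forall Y Z, p *m bracketC b Y Z = 0.
Proof.
move=> Tw0 w00.
have [B TB] := tmx_right_inverse bc cext connS sd_Ad_functional.
have kbr := kernel_bracket bc cext connS sd_Ad_functional.
pose ad U : 'M[R]_d := dmx b (Admx b) U.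
have adE U Y : ad U *m Y = bracketC b U Y by rewrite /ad -(bracketE bb).
have adlin : linear ad by exact: dmx_is_linear (Admx_smooth bb).
have adbr0 U V : ad (bracketC b U V) = ad U *m ad V - ad V *m ad U.
  exact: (dmx_bracket bb (AdmxM bb) (Admx1 bb) (Admx_smooth bb)).
clearbody ad.
have brC := bracketCC bb.
have TBE (u : 'cV[R]_(n + N)) : T *m (B *m u) = u by rewrite mulmxA TB mul1mx.
(* [ad] factors through [T], so the linear lifts [lg] and [lv] need not respect brackets. *)
have adker U U' : T *m U = T *m U' -> ad U = ad U'.
  move=> TUU; apply/subr0_eq; rewrite -(linB adlin); apply: mx_ext => v.
  by rewrite adE mul0mx kbr // mulmxBr TUU subrr.
pose lg (X : 'cV[R]_n) := B *m col_mx X (0 : 'cV[R]_N).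
pose lv (y : 'cV[R]_N) := B *m col_mx (0 : 'cV[R]_n) y.
have lg_lin : linear lg.
  by move=> a X X'; rewrite /lg scalemxAr -mulmxDr scale_col_mx add_col_mx scaler0 addr0.
have lv_lin : linear lv.
  by move=> a X X'; rewrite /lv scalemxAr -mulmxDr scale_col_mx add_col_mx scaler0 addr0.
have Tlg X : T *m lg X = col_mx X 0 by exact: TBE.
have Tlv y : T *m lv y = col_mx 0 y by exact: TBE.
clearbody lg lv.
have Tbr X U : T *m bracketC b (lg X) U =
    col_mx (bracketC cG X (usubmx (T *m U))) (dmx cG rho X *m dsubmx (T *m U)).
  by rewrite (tmx_bracket bb bc mth) Tlg -{1}[T *m U]vsubmxK sd_bracket.
have adbr X X' : ad (lg (bracketC cG X X')) = ad (lg X) *m ad (lg X') - ad (lg X') *m ad (lg X).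
  by rewrite -adbr0; apply: adker; rewrite Tbr !Tlg col_mxKu col_mxKd mulmx0.
have [E [Ead Efix]] : exists E : 'M[R]_d, (forall X, E *m ad (lg X) = 0) /\
    forall v : 'cV_d, (forall X, ad (lg X) *m v = 0) -> E *m v = v.
  apply: (lie_reynolds ssG (t := fun X => ad (lg X))); last exact: adbr.
  by move=> a X X'; rewrite lg_lin adlin.
have Ew0 : E *m w0 = w0.
  by apply: Efix => X; rewrite adE (brC (lg X) w0) kbr // oppr0.
have [i wi] : exists i, w0 i 0 <> 0.
  apply: contrapT => H0; apply: w00; apply/colP => i; rewrite [RHS]mxE.
  by apply: contrapT => wi; apply: H0; exists i.
(* Every row of [E] is an invariant functional; row [i] takes on [w0], fixed by [E], the nonzero
   value [w0 i 0]. *)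
pose p : 'rV[R]_d := row i E.
have pw0 : p *m w0 <> 0.
  by rewrite -row_mul Ew0 => /rowP/(_ 0); rewrite !mxE.
have plg X Y : p *m bracketC b (lg X) Y = 0.
  by rewrite -adE mulmxA -row_mul Ead row0 mul0mx.
clearbody p.
have decomp U : ad U = ad (lg (usubmx (T *m U))) + ad (lv (dsubmx (T *m U))).
  rewrite -(linD adlin); apply: adker; rewrite mulmxDr Tlg Tlv add_col_mx addr0 add0r.
  by rewrite vsubmxK.
pose beta y z := p *m bracketC b (lv y) (lv z).
have pl Y Z : p *m bracketC b Y Z = p *m bracketC b (lv (dsubmx (T *m Y))) Z.
  have -> : bracketC b Y Z = bracketC b (lg (usubmx (T *m Y))) Z +
      bracketC b (lv (dsubmx (T *m Y))) Z.
    by rewrite -(adE Y Z) (decomp Y) mulmxDl (adE (lg _) Z) (adE (lv _) Z).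
  have pD (U V : 'cV[R]_d) : p *m U = 0 -> p *m (U + V) = p *m V.
    by move=> pU; rewrite mulmxDr pU add0r.
  exact: pD (plg _ _).
have pC U V : p *m bracketC b U V = - (p *m bracketC b V U).
  by rewrite (brC U V) mulmxN.
have pE Y Z : p *m bracketC b Y Z = beta (dsubmx (T *m Y)) (dsubmx (T *m Z)).
  apply: etrans (pl Y Z) _; apply: etrans (pC _ _) _.
  by apply: etrans (congr1 -%R (pl Z _)) _; exact: esym (pC _ _).
have [beta0|beta0] := pselect (forall y z, beta y z = 0).
  by right; exists p; split=> // Y Z; rewrite pE beta0.
left; exists (fun y z => beta y z 0 0).
have betaE y z : beta y z = p *m ad (lv y) *m lv z by rewrite -mulmxA adE.
have anti y z : beta y z = - beta z y by exact: pC.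
clearbody beta.
have linr y : linear (beta y).
  by move=> a z z'; rewrite !betaE lv_lin mulmxDr -scalemxAr.
have linl z : linear (beta^~ z).
  by move=> a y y'; rewrite !betaE lv_lin adlin mulmxDr mulmxDl -scalemxAr -scalemxAl.
(* By the Jacobi identity this sum is [p] of a bracket with [lg X]. *)
have inf_inv X y z : beta (dmx cG rho X *m y) z + beta y (dmx cG rho X *m z) = 0.
  have -> : beta (dmx cG rho X *m y) z = p *m bracketC b (bracketC b (lg X) (lv y)) (lv z).
    by rewrite pE Tbr !Tlv !col_mxKd.
  have -> : beta y (dmx cG rho X *m z) = p *m bracketC b (lv y) (bracketC b (lg X) (lv z)).
    by rewrite pE Tbr !Tlv !col_mxKd.
  by rewrite (bracketC_ad bb) mulmxBr subrK plg.
split.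
- by split=> w a y z; [rewrite linr|rewrite linl]; rewrite !mxE.
- by move=> y z; rewrite anti mxE.
- apply: contrapT => H0; apply: beta0 => y z; apply/matrixP => i0 j0.
  by rewrite !ord1 [RHS]mxE; apply: contrapT => byz; apply: H0; exists y, z.
move=> g y z.
have sr k (v : 'M[R]_(N, k)) : smooth_at (fun x => rho (cinv cG x) *m v) (cG 1%g).
  by apply: smooth_at_mulmx; [exact: rho_smooth|exact: smooth_at_cst].
pose lvM := GRing.isLinear.Build _ _ _ _ _ lv_lin.
pose Lv : {linear 'cV[R]_N -> 'cV[R]_d} := HB.pack lv lvM.
pose adM := GRing.isLinear.Build _ _ _ _ _ adlin.
pose Lad : {linear 'cV[R]_d -> 'M[R]_d} := HB.pack ad adM.
have cLv : continuous Lv by exact: linear_col_continuous.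
have cLad : continuous Lad by exact: linear_col_continuous.
pose F g y z := fun x => p *m Lad (Lv (rho (cinv cG x) *m (rho g *m y))) *m
  Lv (rho (cinv cG x) *m (rho g *m z)).
have sv k (v : 'M[R]_(N, k)) : smooth_at (fun x => rho (cinv cG x) *m v) (cG 1%g) := sr k v.
have sLv g' y' : smooth_at (fun x => Lv (rho (cinv cG x) *m (rho g' *m y'))) (cG 1%g).
  exact: (smooth_at_postlin cLv (sr _ _)).
have sA g' y' : smooth_at (fun x => p *m Lad (Lv (rho (cinv cG x) *m (rho g' *m y')))) (cG 1%g).
  apply: smooth_at_mulmx; first exact: smooth_at_cst.
  exact: (smooth_at_postlin cLad (sLv _ _)).
have sF g' y' z' : smooth_at (F g' y' z') (cG 1%g) by exact: smooth_at_mulmx (sA _ _) (sLv _ _).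
have FE g' y' z' x : beta (rho (cinv cG x * g')%g *m y') (rho (cinv cG x * g')%g *m z') =
    F g' y' z' x.
  have rE (w : 'cV[R]_N) : rho (cinv cG x * g')%g *m w = rho (cinv cG x) *m (rho g' *m w).
    by rewrite sl_repM mulmxA.
  by rewrite (rE y') (rE z') betaE.
have FE0 g' y' z' x : beta (rho (cinv cG x * g')%g *m y')
    (rho (cinv cG x * g')%g *m z') 0 0 = F g' y' z' x 0 0 by rewrite FE.
have Dr X g' (y' : 'cV[R]_N) : 'D_X (fun x => Lv (rho (cinv cG x) *m (rho g' *m y'))) (cG 1%g) =
    lv (dmx cG rho X *m (rho g' *m y')).
  apply: etrans (derive_lin _ cLv (smooth_at_differentiable (sr _ _))) _.
  rewrite -[LHS]/(lv _); congr lv.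
  apply: etrans (derive_mulmx _ (rho_smooth rho) (smooth_at_cst _ _)) _.
  by rewrite derive_cstE mulmx0 addr0 dmxE.
have DF X g' y' z' : 'D_X (F g' y' z') (cG 1%g) = 0.
  apply: etrans (derive_mulmx _ (sA _ _) (sLv _ _)) _; rewrite Dr.
  have -> : 'D_X (fun x => p *m Lad (Lv (rho (cinv cG x) *m (rho g' *m y')))) (cG 1%g) =
      p *m ad (lv (dmx cG rho X *m (rho g' *m y'))).
    apply: etrans (derive_mulmx _ (smooth_at_cst _ _) (smooth_at_postlin cLad (sLv _ _))) _.
    rewrite derive_cstE mul0mx add0r; congr (_ *m _).
    apply: etrans (derive_lin _ cLad (smooth_at_differentiable (sLv _ _))) _.
    by rewrite Dr.
  have E1 v : rho (cinv cG (cG 1%g)) *m v = v :> 'cV[R]_N.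
    by rewrite (cinv_base bG) sl_rep1 mul1mx.
  rewrite !E1 -[Lad _]/(ad _) -![Lv _]/(lv _) -!betaE; exact: inf_inv.
(* Infinitesimal invariance at every translate makes [beta] locally constant along orbits, and [G]
   is connected. *)
have lc : forall g', \forall x \near g',
    beta (rho x *m y) (rho x *m z) 0 0 = beta (rho g' *m y) (rho g' *m z) 0 0.
  apply: (derive0_locally_constant bG (f := fun g' => beta (rho g' *m y) (rho g' *m z) 0 0)) => g'.
    by rewrite (funext (FE0 g' y z)); exact: smooth_at_entry.
  move=> X; rewrite (funext (FE0 g' y z)).
  by rewrite -(derive_entry X 0 0 (smooth_at_differentiable (sF _ _ _))) DF mxE.
rewrite (locally_constant_connected connG lc g 1%g).
by rewrite sl_rep1 !mul1mx.
Qed.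
End semidirect_extension.

(** * Local homomorphisms on perfect groups *)

Section perfect_local_homomorphism.
Context {R : realType} (d : nat) (H : lieGroupType R d).
Implicit Types (A : set H) (h u : H).

(** A countable dense subgroup, enumerated by words: a letter is a chosen point of a basic open set,
    or its inverse, according to the boolean. *)
Lemma countable_dense_words : exists ev : seq (bool * nat) -> H,
  [/\ ev [::] = 1%g, forall s t, ev (s ++ t) = (ev s * ev t)%g,
      forall s, exists t, ev t = (ev s)^-1%g &
      forall h A, (\forall u \near 1%g, A u) -> exists s, A ((ev s)^-1 * h)%g].
Proof.
have [B cB [oB bB]] := @manifold_second_countable R d H.
pose pt (b : set H) : H := xget 1%g b.
have [num numI] := countable_injP _ cB.
pose g k : H := pt (xget setT [set b | B b /\ num b = k]).
have gnum b : B b -> g (num b) = pt b.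
  move=> Bb; rewrite /g; case: xgetP => [b' _ [Bb' nb]|/(_ b)[]//].
  by rewrite (numI _ _ (mem_set Bb') (mem_set Bb) nb).
pose ev (s : seq (bool * nat)) : H :=
  foldr (fun x a => ((if x.1 then g x.2 else (g x.2)^-1) * a)%g) 1%g s.
have evD s t : ev (s ++ t) = (ev s * ev t)%g.
  by elim: s => [|x s IHs] /=; rewrite ?mul1g // IHs mulgA.
exists ev; split=> //.
- elim=> [|[x k] s [t tE]]; first by exists [::]; rewrite /= invg1.
  exists (t ++ [:: (~~ x, k)]); rewrite evD tE /= invgM mulg1; congr (_ * _)%g.
  by case: x => //=; rewrite invgK.
- move=> h A nA.
  have nh : \forall x \near h, A (x^-1 * h)%g.
    have := near1_invg nA => /(near1_mull h); apply: filterS => x.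
    by rewrite invgM invgK.
  have [b /= [Bb bh] bA] := bB h _ nh.
  have bpt : b (pt b) by apply: (xgetPex 1%g); exists h.
  exists [:: (true, num b)]; rewrite /= mulg1 gnum //.
  exact: bA.
Qed.

Variables (phi : H -> R) (B : set H).
Hypotheses (nB : \forall u \near 1%g, B u)
  (phiM : forall x y, B x -> B y -> phi (x * y)%g = phi x + phi y)
  (phiJ : forall h, \forall u \near 1%g, phi (h * u * h^-1)%g = phi u).

Lemma near1I (A A' : set H) : (\forall u \near 1%g, A u) -> (\forall u \near 1%g, A' u) ->
  \forall u \near 1%g, (A `&` A') u.
Proof. exact: filterI. Qed.

(* The [h] approximated by words [s] in a countable dense set in such a way that
   [phi (s^-1 h) = 0] form a subgroup containing all commutators. *)
Lemma perfect_local_homomorphism : perfect H -> countable (phi @` B).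
Proof.
move=> perfH; have [ev [ev1 evM evV evA]] := countable_dense_words.
have B1 : B 1%g := nbhs_singleton nB.
have phi1 : phi 1%g = 0.
  have := phiM B1 B1; rewrite mulg1 => /eqP.
  by rewrite -subr_eq0 opprD addNKr oppr_eq0 => /eqP.
have nV : \forall u \near 1%g, B u /\ B u^-1%g by exact: filterI nB (near1_invg nB).
have phiV : forall u, B u /\ B u^-1%g -> phi u^-1%g = - phi u.
  move=> u [Bu Bu']; have := phiM Bu Bu'; rewrite mulgV phi1 => /eqP.
  by rewrite eq_sym addrC addr_eq0 => /eqP.
pose K h := forall A, (\forall u \near 1%g, A u) ->
  exists s, A ((ev s)^-1 * h)%g /\ phi ((ev s)^-1 * h)%g = 0.
have KT : K = [set: H].
  apply: perfH.
    split.
    - move=> A nA; exists [::]; rewrite ev1 invg1 mulg1; split=> //.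
      exact: nbhs_singleton nA.
    - move=> h k Kh Kk A nA.
      have [A2 nA2 A2M] := near1_mulg (near1I nA nB).
      have [t [[At Bt] pt0]] := Kk _ (near1I nA2 nB).
      set v := ((ev t)^-1 * k)%g in At Bt pt0.
      have nC := near1I (conjg_near1 (ev t)^-1%g (near1I nA2 nB)) (phiJ (ev t)^-1%g).
      have [s [[[As Bs] Js] ps0]] := Kh _ nC.
      exists (s ++ t); rewrite evM invgM.
      have -> : ((ev t)^-1 * (ev s)^-1 * (h * k) =
          (ev t)^-1 * ((ev s)^-1 * h) * (ev t)^-1^-1 * v)%g.
        by rewrite /v invgK !mulgA mulgK.
      split; first by have [] := A2M _ _ As At.
      by rewrite phiM // Js ps0 pt0 addr0.
    - move=> h Kh A nA.
      have nC := near1I (near1I nV (near1_invg (conjg_near1 h nA))) (near1_invg (phiJ h)).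
      have [s [[[Vs As] Js] ps0]] := Kh _ nC; have [t tE] := evV s.
      exists t; rewrite tE invgK.
      have -> : (ev s * h^-1 = h * ((ev s)^-1 * h)^-1 * h^-1)%g.
        by rewrite invgM invgK !mulgA mulgV mul1g.
      by split=> //; rewrite Js (phiV _ Vs) ps0 oppr0.
  (* [h] and [k] are approximated by words [h u^-1] and [k v^-1]. The commutator of the words
     differs from [[~ h, k]] by a product of [v] with conjugates of [u], [v^-1] and [u^-1], on which
     [phi] adds up to 0. *)
  move=> h k A nA.
  have [A1 nA1 A1M] := near1_mulg (near1I nA nB).
  have [A2 nA2 A2M] := near1_mulg (near1I nA1 nB).
  have nAB := near1I nA2 nB.
  pose w1 := (k^-1 * h^-1 * k)%g; pose w2 := ([~ h, k]^-1)%g.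
  have nCu := near1I nV (near1I (near1I (conjg_near1 k^-1%g nAB) (phiJ k^-1%g))
    (near1I (near1_invg (conjg_near1 w2 nAB)) (near1_invg (phiJ w2)))).
  have nCv := near1I (near1I nV nAB)
    (near1I (near1_invg (conjg_near1 w1 nAB)) (near1_invg (phiJ w1))).
  have [s] := evA h _ nCu; set u := ((ev s)^-1 * h)%g => -[Vu [[[Au1 Bu1] Ju1] [[Au2 Bu2] Ju2]]].
  have [t] := evA k _ nCv; set v := ((ev t)^-1 * k)%g => -[[Vv [Av Bv]] [[Av1 Bv1] Jv1]].
  have [s' s'E] := evV s; have [t' t'E] := evV t.
  have evs : ev s = (h * u^-1)%g by rewrite /u invgM invgK mulgA mulgV mul1g.
  have evt : ev t = (k * v^-1)%g by rewrite /v invgM invgK mulgA mulgV mul1g.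
  exists (s' ++ t' ++ s ++ t); rewrite !evM s'E t'E evs evt.
  clearbody u v.
  have E : ((((h * u^-1)^-1 * ((k * v^-1)^-1 * (h * u^-1 * (k * v^-1)))))^-1 * [~ h, k] =
     (v * (k^-1 * u * k^-1^-1)) * ((w1 * v^-1 * w1^-1) * (w2 * u^-1 * w2^-1)))%g.
    rewrite /w1 /w2 /commg /conjg !invgM !invgK !mulgA.
    by rewrite !mulgK mulgVK.
  rewrite E; split.
    have [] // := A1M (v * (k^-1 * u * k^-1^-1))%g ((w1 * v^-1 * w1^-1) * (w2 * u^-1 * w2^-1))%g.
      by have [] := A2M _ _ Av Au1.
    by have [] := A2M _ _ Av1 Au2.
  rewrite phiM; [|by have [] := A2M _ _ Av Au1|by have [] := A2M _ _ Av1 Au2].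
  rewrite (phiM Bv Bu1) (phiM Bv1 Bu2) Ju1 Ju2 Jv1 (phiV _ Vu) (phiV _ Vv).
  by rewrite addrACA subrr addrN addr0.
have sub : phi @` B `<=` range (phi \o ev).
  move=> _ [h Bh <-]; have : K h by rewrite KT.
  move=> /(_ _ nV)[s [Vs ps0]]; exists s => //=.
  have -> : ev s = (h * ((ev s)^-1 * h)^-1)%g by rewrite invgM invgK mulgA mulgV mul1g.
  by rewrite phiM //; [rewrite (phiV _ Vs) ps0 oppr0 addr0|case: Vs].
apply: sub_countable (subset_card_le sub) _.
by apply: sub_countable (card_image_le _ _) _; exact: countableP.
Qed.
End perfect_local_homomorphism.

(** * Functionals vanishing on brackets *)

Section invariant_functional.
Context {R : realType} (d n : nat) (H : lieGroupType R d) (S : lieGroupType R n).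
Variables (c : chart R n S) (theta : H -> S).
Local Notation b := (chart1 H).
Local Notation e := (b 1%g).
Let bb : based b := chart1_based H.
Hypotheses (bc : based c) (cext : central_extension theta)
  (connS : connected [set: S]).
Hypothesis Sfree : forall l : 'rV[R]_n,
  (forall s X, l *m AdC c s X = l *m X) -> l = 0.
Variable p : 'rV[R]_d.
Hypothesis p_bracket : forall Y Z, p *m bracketC b Y Z = 0.
Let mth : lie_morphism theta. Proof. by case: cext. Qed.

Lemma central_AdC z Y : theta z = 1%g -> AdC b z Y = Y.
Proof.
move=> z1; have zC x : (z * x * z^-1)%g = x.
  by case: cext => _ _ /(_ z z1) ->; rewrite mulgK.
rewrite AdCE (funext (fun y => congr1 b (zC (cinv b y)))).
exact: (tmap_id bb Y).
Qed.

(** Vanishing on brackets makes [p *m Ad h Y] locally constant in [h], which is not enough on a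
    possibly disconnected [H]. As the kernel acts trivially, the function descends along the open
    map [theta] to the connected group [S]. *)
Lemma functional_Ad_invariant h Y : p *m AdC b h Y = p *m Y.
Proof.
case: (cext) => _ surj _.
pose f (k : H) : R := (p *m AdC b k Y) 0 0.
have fE k y : f (cinv b y * k)%g = (p *m AdC b (cinv b y) (AdC b k Y)) 0 0.
  by rewrite /f (AdCM bb).
have sp Z : smooth_at (fun y => p *m AdC b (cinv b y) Z) e.
  by apply: smooth_at_mulmx; [exact: smooth_at_cst|exact: AdC_smooth].
have fl k : \forall x \near k, f x = f k.
  apply: (derive0_locally_constant bb) => {}k.
    by rewrite (funext (fE k)); exact: smooth_at_entry.
  move=> v; rewrite (funext (fE k)).
  rewrite -(derive_entry v 0 0 (smooth_at_differentiable (sp _))).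
  have -> : 'D_v (fun y => p *m AdC b (cinv b y) (AdC b k Y)) e = 0.
    apply: etrans (derive_mulmx _ (smooth_at_cst _ _) (AdC_smooth bb _)) _.
    by rewrite derive_cstE mul0mx add0r -bracketCE; exact: p_bracket.
  by rewrite mxE.
have fth k k' : theta k = theta k' -> f k = f k'.
  move=> kk'; rewrite /f; have -> : k = (k' * (k'^-1 * k))%g by rewrite mulgA mulgV mul1g.
  rewrite (AdCM bb) (central_AdC (z := (k'^-1 * k)%g)) //.
  by rewrite (lie_morphismM mth) (lie_morphismV mth) kk' mulVg.
have [sec secE] := choice surj.
have Fl s : \forall s' \near s, f (sec s') = f (sec s).
  pose A := [set k | f (k * sec s)%g = f (sec s)].
  have nA : \forall k \near 1%g, A k.
    have := @mulgr_continuous _ _ H (sec s) 1%g (fun x => f x = f (sec s)).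
    by rewrite mul1g => /(_ (fl _)).
  have := near1_mulr s (theta_open bc cext connS Sfree nA).
  apply: filterS => s' [k Ak ks]; rewrite -Ak; apply: fth.
  by rewrite secE (lie_morphismM mth) ks secE -mulgA mulVg mulg1.
apply/matrixP => i j; rewrite !ord1 -/(f h).
have -> : f h = f (sec (theta h)) by apply: fth; rewrite secE.
rewrite (locally_constant_connected connS Fl _ 1%g).
have -> : f (sec 1%g) = f 1%g by apply: fth; rewrite secE (lie_morphism1 mth).
by rewrite /f (AdC1 bb).
Qed.

(** The local homomorphism with differential [p] has countable range. Along the coordinate line in
    the direction [w] it is continuous, hence constant, and its derivative there is [p *m w]. *)
Lemma perfect_no_functional (w : 'cV[R]_d) : perfect H -> p *m w = 0.
Proof.
move=> perfH; pose lam := p^T.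
have lamE v : dotc lam v = (p *m v) 0 0.
  by rewrite /dotc !mxE; apply: eq_bigr => i _; rewrite mxE.
have lam_br X Y : dotc lam (bracketC b X Y) = 0 by rewrite lamE p_bracket mxE.
have lam_Ad h v : dotc lam (AdC b h v) = dotc lam v.
  by rewrite !lamE functional_Ad_invariant.
have [f [r r0 [sf Df fM fJ]]] := local_homomorphism bb lam_br lam_Ad.
pose phi (h : H) : R := f (b h) - f e.
pose B := [set h : H | cdom b h /\ `|b h - e| < r].
have c1 := bb.2.
have nB : \forall u \near 1%g, B u.
  apply: filterI; first exact: cdom_near.
  exact: (cfun_continuous c1 (ball_near r0 (P := fun y => `|y - e| < r) _)).
have phiM x y : B x -> B y -> phi (x * y)%g = phi x + phi y.
  by move=> [cx xr] [cy yr]; have := fM _ _ xr yr; rewrite !cfunK.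
have phiJ h : \forall u \near 1%g, phi (h * u * h^-1)%g = phi u.
  have nf : \forall u \near 1%g, f (b (h * cinv b (b u) * h^-1)%g) = f (b u).
    exact: (cfun_continuous c1 (fJ h)).
  apply: filterS (filterI nf (cdom_near c1)) => u [fu cu].
  by rewrite /phi; rewrite cfunK // in fu; rewrite fu.
have cB := perfect_local_homomorphism nB phiM phiJ perfH.
have [r1 r10 bK] := chart_ball bb.
pose q := Num.min r r1; have q0 : 0 < q by rewrite lt_min r0.
have [dl dl0 dlP] := near_ball (line_near H w q0).
have [dB dB0 dBP] : exists2 dB : R, 0 < dB & forall y, `|y - e| < dB -> cdom b (cinv b y).
  have [dB dB0 dBP] := near_ball (chart_near c1 (cdom_near c1)).
  by exists dB.
have [dl' dl'0 dl'P] := near_ball (line_near H w dB0).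
pose D := Num.min dl dl'; have D0 : 0 < D by rewrite lt_min dl0.
pose I := `]- D, D[%classic : set R.
have IP t : I t -> [/\ `|t *: w + e - e| < r, b (cinv b (t *: w + e)) = t *: w + e &
    cdom b (cinv b (t *: w + e))].
  rewrite /I /= in_itv /= -ltr_norml lt_min => /andP[t1 t2].
  have := dlP t; rewrite subr0 => /(_ t1); rewrite lt_min => /andP[tr tr1].
  by split=> //; [exact: bK|apply: dBP; apply: dl'P; rewrite subr0].
have cst1 : forall s t, I s -> I t -> f (s *: w + e) = f (t *: w + e).
  apply: (@countable_connected_cst_in R R I (fun t => f (t *: w + e))).
  - apply/connected_intervalP; exact: interval_is_interval.
  - apply: continuous_in_subspaceT => t /set_mem It; have [tr _ _] := IP t It.
    have E : (fun t : R => f (t *: w + e)) = (fun t : R => f (e + t *: w)).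
      by apply/funext => s; rewrite addrC.
    have df : differentiable f (e + t *: w).
      by apply: smooth_at_differentiable; apply: sf; rewrite (addrC e).
    rewrite E; apply: differentiable_continuous; apply/derivable1_diffP.
    exact: (ex_derive (is_derive := is_derive_line df)).
  - apply: sub_countable cB.
    have sub : (fun t => f (t *: w + e) - f e) @` I `<=` phi @` B.
      move=> _ [t It <-]; have [tr tK tc] := IP t It.
      by exists (cinv b (t *: w + e)); [split; rewrite // tK|rewrite /phi tK].
    apply: card_le_trans (subset_card_le sub).
    have -> : (fun t => f (t *: w + e)) @` I = (fun y => y + f e) @` ((fun t => f (t *: w + e) - f e) @` I).
      by rewrite image_comp; congr (_ @` _); apply/funext => t /=; rewrite subrK.
    exact: card_image_le.
have I0 : I 0 by rewrite /I /= in_itv /= oppr_lt0 D0.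
apply/matrixP => i j; rewrite !ord1 [RHS]mxE -lamE -Df.
have sfe : smooth_at f e by apply: sf; rewrite subrr normr0.
have df : is_derive e w f ('D_w f e).
  by apply: DeriveDef => //; exact/diff_derivable/smooth_at_differentiable.
have /is_derive_line0 df0 := df; rewrite -(derive_val (is_derive := df0)).
apply: etrans (derive_near (g := cst (f e)) _ _) _; last exact: derive_cstE.
apply: (ball_near D0) => t; rewrite subr0 => tD.
have It : I t by rewrite /I /= in_itv /= -ltr_norml.
by have := cst1 _ _ It I0; rewrite scale0r add0r addrC.
Qed.
End invariant_functional.

(** * Paths, homotopies and their lifts *)

Section clamp.
Context {R : realType}.

(** The projection onto the unit interval. Composing with it makes maps continuous on the interval
    or the square continuous everywhere. *)
Definition clamp (t : R) : R := (1 + `|t| - `|t - 1|) / 2.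

Lemma clamp_continuous : continuous clamp.
Proof.
move=> t; have c1 : {for t, continuous (fun t : R => 1 + `|t|)}.
  by apply: cvgD; [exact: cvg_cst|exact: norm_continuous].
have c2 : {for t, continuous (fun t : R => `|t - 1|)}.
  by apply: cvg_norm; apply: cvgB; [exact: cvg_id|exact: cvg_cst].
have c3 : {for t, continuous (fun t : R => 2^-1 : R)} by exact: cvg_cst.
exact: (cvgM (cvgB c1 c2) c3).
Qed.

Lemma clamp_itv t : 0 <= clamp t <= 1.
Proof.
rewrite /clamp; have [t0|t0] := lerP 0 t; have [t1|t1] := lerP 0 (t - 1);
  rewrite ?(ger0_norm t0) ?(ltr0_norm t0) ?(ger0_norm t1) ?(ltr0_norm t1);
  apply/andP; split; lra.
Qed.

Lemma clamp_id t : 0 <= t <= 1 -> clamp t = t.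
Proof.
move=> /andP[t0 t1]; rewrite /clamp (ger0_norm t0).
by have -> : `|t - 1| = 1 - t; [rewrite ler0_norm ?subr_le0 // opprB|lra].
Qed.

Lemma within_continuous_comp (T U V : topologicalType) (A : set U) (f : T -> U) (g : U -> V) :
  {within A, continuous g} -> continuous f -> (forall x, A (f x)) ->
  continuous (fun x => g (f x)).
Proof.
move=> /subspace_continuousP cg cf Af x N nN.
have nfx : \forall y \near x, A (f y) -> N (g (f y)) by exact: cf x _ (cg _ (Af x) N nN).
have : \forall y \near x, N (g (f y)) by apply: filterS nfx => y; apply.
by [].
Qed.

Lemma real_line_connected : connected [set: R].
Proof. by apply/connected_intervalP => ? ? _ _ ? _. Qed.
End clamp.

Section group_valued_paths.
Context {R : realType} (n : nat) (G : lieGroupType R n).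

Lemma continuous_mulg (T : topologicalType) (f g : T -> G) :
  continuous f -> continuous g -> continuous (fun x => (f x * g x)%g).
Proof.
move=> cf cg x; have [cm _] := @smul2 R n G.
by apply: (continuous_comp (f := fun x => (f x, g x)) (g := fun p : G * G => (p.1 * p.2)%g));
  [apply: cvg_pair; [exact: cf|exact: cg]|exact: cm].
Qed.

Lemma continuous_invg (T : topologicalType) (f : T -> G) :
  continuous f -> continuous (fun x => (f x)^-1%g).
Proof. by move=> cf x; apply: continuous_comp; [exact: cf|exact: invg_continuous]. Qed.

Fixpoint gprod (u : nat -> G) k : G := if k is k'.+1 then (gprod u k' * u k')%g else 1%g.

Lemma gprod_telescope (x : nat -> G) k :
  gprod (fun i => (x i)^-1 * x i.+1)%g k = ((x 0%N)^-1 * x k)%g.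
Proof. by elim: k => [|k /= ->]; rewrite ?mulVg // mulgA mulgK. Qed.

Lemma gprod_continuous (T : topologicalType) (u : T -> nat -> G) k :
  (forall i, (i < k)%N -> continuous (u ^~ i)) -> continuous (fun x => gprod (u x) k).
Proof.
elim: k => [|k IHk] cu; first by move=> x; exact: cvg_cst.
by apply: continuous_mulg; [apply: IHk => i /ltnW; exact: cu|exact: cu].
Qed.

Lemma eq_gprod u v k : (forall i, (i < k)%N -> u i = v i) -> gprod u k = gprod v k.
Proof.
by elim: k => //= k IHk uv; rewrite uv // IHk // => i /ltnW; exact: uv.
Qed.

(** Compactness of the unit square: one mesh serves for all [s] and [t]. *)
Lemma uniform_increments (q : R * R -> G) (W : set G) : continuous q ->
  (\forall x \near 1%g, W x) ->
  \forall k \near \oo, forall s t t', 0 <= s <= 1 -> 0 <= t <= 1 ->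
    `|t' - t| <= k.+1%:R^-1 -> W ((q (s, t))^-1 * q (s, t'))%g.
Proof.
move=> cq nW; pose Q (k : nat) (x : R * R) := forall t', `|t' - x.2| <= k.+1%:R^-1 ->
  W ((q x)^-1 * q (x.1, t'))%g.
have cK : compact (`[0, 1]%classic `*` `[0, 1]%classic : set (R * R)).
  by apply: compact_setX; exact: segment_compact.
have /compact_near_coveringP/(_ _ \oo Q _) covK := cK.
have : \forall k \near \oo, `[0, 1]%classic `*` `[0, 1]%classic `<=` Q k.
  apply: covK => -[s0 t0] _.
  have cM : continuous (fun z : (R * R) * R => ((q z.1)^-1 * q (z.1.1, z.2))%g).
    apply: continuous_mulg.
      apply: continuous_invg => z; apply: (continuous_comp (f := fst) (g := q)); first exact: cvg_fst.
      exact: cq.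
    move=> z; apply: (continuous_comp (f := fun z : (R * R) * R => (z.1.1, z.2)) (g := q)); last exact: cq.
    have c1 : {for z, continuous (fun z : (R * R) * R => z.1.1)}.
      by apply: (continuous_comp (f := fst) (g := fst)); exact: cvg_fst.
    have c2 : {for z, continuous (fun z : (R * R) * R => z.2)} by exact: cvg_snd.
    exact: (cvg_pair c1 c2).
  have := cM ((s0, t0), t0) W; rewrite /= mulVg => /(_ nW)[[A B] /= [nA nB] AB].
  have [eps /= eps0 epsB] := near_ball nB.
  have nA' : \forall x \near (s0, t0), A x /\ `|x.2 - t0| < eps / 2.
    apply: filterI => //.
    have b2 : \forall y \near (t0 : R), `|y - t0| < eps / 2.
      by apply: (@ball_near R R t0 (eps / 2)) => //; exact: divr_gt0.
    exists (setT, [set y : R | `|y - t0| < eps / 2]); last by move=> x [].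
    by split; [exact: filterT|exact: b2].
  have nk : \forall k \near \oo, k.+1%:R^-1 < eps / 2 :> R.
    have e2 : 0 < eps / 2 by exact: divr_gt0.
    by have := near_infty_natSinv_lt (PosNum e2); apply: filterS.
  exists ([set x | A x /\ `|x.2 - t0| < eps / 2], [set k | k.+1%:R^-1 < eps / 2 :> R]) => //.
  move=> [[s t] k] /= [[Ast tt0] keps] t' tt'.
  apply: (AB ((s, t), t')); split=> //=; apply: epsB.
  have -> : t' - t0 = (t' - t) + (t - t0) by rewrite addrA subrK.
  apply: le_lt_trans (ler_normD _ _) _; rewrite [ltRHS](splitr eps).
  by apply: ltrD => //; exact: le_lt_trans keps.
apply: filterS => k Qk s t t' s01 t01 tt'.
by apply: (Qk (s, t)) => //; split; rewrite /= in_itv.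
Qed.
End group_valued_paths.

Section covering.
Context {R : realType} (d n : nat) (H : lieGroupType R d) (S : lieGroupType R n).
Variables (c : chart R n S) (theta : H -> S).
Local Notation b := (chart1 H).
Local Notation e := (b 1%g).
Let bb : based b := chart1_based H.
Hypotheses (bc : based c) (cext : central_extension theta).
Hypothesis theta_open1 : forall A : set H, (\forall h \near 1%g, A h) ->
  \forall s \near 1%g, exists2 h, A h & theta h = s.
Hypothesis tmx_injective : forall w : 'cV[R]_d, tmx b c theta *m w = 0 -> w = 0.
Let mth : lie_morphism theta. Proof. by case: cext. Qed.

Lemma theta_locally_injective : exists U : set H,
  [/\ open U, U 1%g & forall x y, U x -> U y -> theta x = theta y -> x = y].
Proof.
have [B BT] : exists B, B *m tmx b c theta = 1%:M.
  have /row_freeP[X XE] : row_free (tmx b c theta)^T.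
    apply: inj_row_free => v vT; apply: trmx_inj; rewrite trmx0.
    by apply: tmx_injective; rewrite -[LHS]trmxK trmx_mul trmxK vT trmx0.
  by exists X^T; apply: trmx_inj; rewrite trmx_mul trmxK XE trmx1.
have [r r0 rP] : exists2 r : R, 0 < r & forall x y : 'cV[R]_d, `|x - e| < r ->
    `|y - e| < r -> c (theta (cinv b x)) = c (theta (cinv b y)) -> x = y.
  apply: (local_injection (B := B) (theta_smooth bb bc mth)) => w.
  by rewrite -[X in B *m X]/(tmap b c theta w) -(tmxE bb bc mth) mulmxA BT mul1mx.
have nU : \forall h \near 1%g, cdom b h /\ `|b h - e| < r.
  apply: filterI; first exact: cdom_near bb.2.
  exact: (cfun_continuous bb.2 (ball_near r0 (P := fun y => `|y - e| < r) _)).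
exists (interior [set h | cdom b h /\ `|b h - e| < r]); split.
- exact: open_interior.
- exact: nU.
move=> x y /interior_subset[cx xr] /interior_subset[cy yr] xy; rewrite -(cfunK cx) -(cfunK cy).
by congr (cinv b _); apply: rP => //; rewrite !cfunK // xy.
Qed.

(** The elements joined to 1 by a path form a subgroup with open image, hence mapping onto [S]. The
    kernel being central, commutators in [H] depend only on images under [theta]; they all lie in
    this subgroup, and perfectness concludes. *)
Lemma path_subgroup : perfect H -> connected [set: S] -> forall x : H,
  exists g : R -> H, [/\ continuous g, g 0 = 1%g & g 1 = x].
Proof.
move=> perfH connS.
pose K := [set x : H | exists g : R -> H, [/\ continuous g, g 0 = 1%g & g 1 = x]].
have sK : is_subgroup K.
  split.
  - by exists (cst 1%g); split=> // t; exact: cvg_cst.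
  - move=> x y [g [cg g0 g1]] [g' [cg' g'0 g'1]]; exists (fun t => g t * g' t)%g.
    by rewrite g0 g'0 g1 g'1 mulg1; split=> //; exact: continuous_mulg.
  - move=> x [g [cg g0 g1]]; exists (fun t => (g t)^-1)%g.
    by rewrite g0 g1 invg1; split=> //; exact: continuous_invg.
have nK : \forall x \near 1%g, K x.
  have nb : \forall y \near e, ccod b y.
    by apply: open_nbhs_nbhs; split; [exact: ccod_open|exact: cfun_cod bb.2].
  have [r r0 rP] := near_ball nb.
  have nr : \forall h \near 1%g, `|b h - e| < r.
    exact: (cfun_continuous bb.2 (ball_near r0 (P := fun y => `|y - e| < r) _)).
  apply: filterS (filterI nr (cdom_near bb.2)) => x [xr cx].
  pose l t := clamp t *: (b x - e) + e.
  have cl : continuous l.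
    move=> t; apply: cvgD; last exact: cvg_cst.
    apply: (continuous_comp (f := clamp) (g := fun s : R => s *: (b x - e))).
      exact: clamp_continuous.
    exact: scalel_continuous.
  exists (fun t => cinv b (l t)); split.
  - move=> t; apply: (continuous_comp (f := l) (g := cinv b)); first exact: cl.
    apply: cinv_continuous; apply: rP; rewrite /l addrK normrZ.
    have /andP[t0 t1] := clamp_itv t; rewrite (ger0_norm t0).
    by apply: le_lt_trans xr; rewrite ler_piMl.
  - by rewrite /l clamp_id ?lexx ?ler01 // scale0r add0r (cinv_base bb).
  - by rewrite /l clamp_id ?lexx ?ler01 // scale1r subrK cfunK.
have [K1 KM KV] := sK.
have thK s : exists2 h, K h & theta h = s.
  apply: (subgroup_near1_full (K := [set s | exists2 h, K h & theta h = s]) connS).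
    split.
    - by exists 1%g; rewrite ?(lie_morphism1 mth).
    - by move=> _ _ [h Kh <-] [k Kk <-]; exists (h * k)%g; [exact: KM|exact: (lie_morphismM mth)].
    - by move=> _ [h Kh <-]; exists (h^-1)%g; [exact: KV|exact: (lie_morphismV mth)].
  exact: theta_open1.
have comm_l x x' y : theta x = theta x' -> [~ x, y]%g = [~ x', y]%g.
  move=> xx'; pose z := (x'^-1 * x)%g.
  have zC w : (z * w = w * z)%g.
    case: (cext) => _ _; apply; rewrite /hom_kernel /= /z.
    by rewrite (lie_morphismM mth) (lie_morphismV mth) xx' mulVg.
  have xE : x = (x' * z)%g by rewrite /z mulgA mulgV mul1g.
  apply: (mulgI (y * x)%g); apply: etrans (esym (commgC x y)) _.
  rewrite xE -[LHS]mulgA zC mulgA (commgC x' y) -[LHS]mulgA.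
  by rewrite -(zC [~ x', y]%g) !mulgA.
have comm_r x y y' : theta y = theta y' -> [~ x, y]%g = [~ x, y']%g.
  have commV (a a' : H) : [~ a, a']%g = ([~ a', a]^-1)%g.
    by rewrite /commg /conjg !invgM !invgK !mulgA.
  by move=> yy'; rewrite commV (comm_l _ _ _ yy') -commV.
suff KT : K = [set: H] by move=> x; have : [set: H] x by []; rewrite -KT.
apply: perfH => // x y; have [k Kk kx] := thK (theta x); have [l Kl ly] := thK (theta y).
rewrite (comm_l x k _ (esym kx)) (comm_r k y l (esym ly)) /commg /conjg.
by apply: (KM); [exact: KV|apply: (KM); [exact: KV|apply: (KM)]].
Qed.

Lemma theta_gprod (u : nat -> H) k : theta (gprod u k) = gprod (fun i => theta (u i)) k.
Proof.
by elim: k => [|k /= <-]; [exact: (lie_morphism1 mth)|exact: (lie_morphismM mth)].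
Qed.

(* A path from [1] to a kernel element [z] maps to a loop; along a null homotopy
   of this loop the products of local lifts of small increments stay in the
   discrete kernel, hence do not move: they start at [z] and end at [1]. *)
Lemma covering_trivial : perfect H -> simply_connected R S ->
  hom_kernel theta = [set 1%g].
Proof.
move=> perfH [pathS loopS].
have th1 : theta 1%g = 1%g := lie_morphism1 mth.
apply/seteqP; split=> [z z1|_ ->]; last exact: th1.
have connS : connected [set: S] by exact: path_connected_connected (pathS 1%g).
have [gt [cgt gt0 gt1]] := path_subgroup perfH connS z.
have [U [oU U1 UI]] := theta_locally_injective.
pose W := [set s : S | exists2 k, U k & theta k = s].
have nU : \forall h \near 1%g, U h by exact: open_nbhs_nbhs.
have nW : \forall s \near 1%g, W s by exact: theta_open1.
(* A section of [theta] over [W] with values in [U], where [theta] is injective; its values outside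
   [W] are arbitrary. *)
have /choice[sig sigP] : forall s : S, exists h, W s -> U h /\ theta h = s.
  move=> s; have [[h Uh hs]|nWs] := pselect (W s); first by exists h.
  by exists 1%g.
have sigth h : U h -> sig (theta h) = h.
  move=> Uh; have [|Us ths] := sigP (theta h); first by exists h.
  exact: UI.
have sig1 : sig 1%g = 1%g by rewrite -th1; exact: sigth.
have sigc s : W s -> {for s, continuous sig}.
  move=> Ws N nN; have [Us ths] := sigP s Ws.
  have nNU : \forall k \near 1%g, N (sig s * k)%g /\ U (sig s * k)%g.
    apply: (@mulgl_continuous _ _ H (sig s) 1%g (fun x => N x /\ U x)).
    rewrite mulg1; apply: filterI; first exact: nN.
    exact: open_nbhs_nbhs.
  have : \forall s' \near s, N (sig s').
    apply: filterS (near1_mull s (theta_open1 nNU)) => s' [k [Nk Uk] ks].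
    have -> : s' = theta (sig s * k)%g by rewrite (lie_morphismM mth) ths ks mulgA mulgV mul1g.
    by rewrite sigth.
  by [].
have ctgt : continuous (fun t => theta (gt t)).
  by move=> t; apply: (continuous_comp (f := gt) (g := theta)); [exact: cgt|exact: mth.2.1].
have [||h [ch h0 h1 hs]] := loopS (fun t => theta (gt t)).
- exact: continuous_subspaceT.
- by rewrite gt0 gt1 th1.
rewrite gt0 th1 in h1 hs.
have clamp0 : clamp (0 : R) = 0 by rewrite clamp_id ?lexx ?ler01.
have clamp1 : clamp (1 : R) = 1 by rewrite clamp_id ?lexx ?ler01.
have clI (t : R) : clamp t \in `[0, 1] by rewrite in_itv /=; exact: clamp_itv.
pose q (x : R * R) := h (clamp x.1, clamp x.2).
have cq : continuous q.
  apply: (within_continuous_comp (f := fun x => (clamp x.1, clamp x.2)) ch).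
  - move=> x; have c1 : {for x, continuous (fun x : R * R => clamp x.1)}.
      by apply: (continuous_comp (f := fst) (g := clamp)); [exact: cvg_fst|exact: clamp_continuous].
    have c2 : {for x, continuous (fun x : R * R => clamp x.2)}.
      by apply: (continuous_comp (f := snd) (g := clamp)); [exact: cvg_snd|exact: clamp_continuous].
    exact: (cvg_pair c1 c2).
  - by move=> x; split; exact: clI.
have cqt : continuous (fun x : R * R => gt x.2).
  by move=> x; apply: (continuous_comp (f := snd) (g := gt)); [exact: cvg_snd|exact: cgt].
(* One subdivision serves both the homotopy, whose increments must lie in [W], and the path in [H],
   whose increments must lie in [U]. *)
have [k [kW kU]] := filter_ex (filterI (uniform_increments cq nW) (uniform_increments cqt nU)).
pose ti i : R := i%:R / k.+1%:R.
have k0 : 0 < k.+1%:R :> R by rewrite ltr0n.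
have ti01 i : (i <= k.+1)%N -> 0 <= ti i <= 1.
  by move=> ik; rewrite /ti divr_ge0 ?ler0n //= ler_pdivrMr // mul1r ler_nat.
have tiS i : `|ti i.+1 - ti i| <= k.+1%:R^-1.
  by rewrite /ti -mulrBl -natrB // subSnn mul1r ger0_norm // invr_ge0 ltW.
have ti0 : ti 0%N = 0 by rewrite /ti mul0r.
have tik : ti k.+1 = 1 by rewrite /ti divff // gt_eqF.
have qW s i : (i < k.+1)%N -> W ((q (s, ti i))^-1 * q (s, ti i.+1))%g.
  move=> ik; have E t : q (s, t) = q (clamp s, t) by rewrite /q /= (clamp_id (clamp_itv s)).
  by rewrite !E; apply: kW; [exact: clamp_itv|apply: ti01; exact: ltnW|exact: tiS].
pose P s := gprod (fun i => sig ((q (s, ti i))^-1 * q (s, ti i.+1))%g) k.+1.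
have thP s : theta (P s) = 1%g.
  rewrite /P theta_gprod.
  rewrite (eq_gprod (v := fun i => ((q (s, ti i))^-1 * q (s, ti i.+1))%g)); last first.
    by move=> i ik; have [] := sigP _ (qW s i ik).
  rewrite (gprod_telescope (fun i => q (s, ti i))) ti0 tik /q /=.
  rewrite clamp0 clamp1; have [-> ->] := hs _ (clI s).
  by rewrite mulVg.
have cP : continuous P.
  apply: gprod_continuous => i ik s.
  have cs t : continuous (fun s => q (s, t)).
    move=> s'; apply: (continuous_comp (f := fun s : R => (s, t)) (g := q)); last exact: cq.
    have cst_t : {for s', continuous (fun=> t : R)} by exact: cvg_cst.
    have cid_s : {for s', continuous (fun s : R => s)} by exact: cvg_id.
    exact: (cvg_pair cid_s cst_t).
  apply: (continuous_comp (f := fun s => ((q (s, ti i))^-1 * q (s, ti i.+1))%g) (g := sig)).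
    by apply: continuous_mulg; [apply: continuous_invg; exact: cs|exact: cs].
  by apply: sigc; exact: qW.
have Pl s : \forall s' \near s, P s' = P s.
  have : \forall s' \near s, U ((P s)^-1 * P s')%g by exact: cP (near1_mull (P s) nU).
  apply: filterS => s' Us; apply: (mulgI (P s)^-1%g); rewrite mulVg.
  apply: UI => //; rewrite (lie_morphismM mth) (lie_morphismV mth) !thP th1.
  by rewrite mulVg.
have P01 := locally_constant_connected (@real_line_connected R) Pl 0 1.
have P1 : P 1 = 1%g.
  rewrite /P (eq_gprod (v := fun i => ((1 : H)^-1 * 1)%g)).
    by rewrite (gprod_telescope (fun=> 1%g : H)) mulVg.
  move=> i ik; rewrite /q /= clamp1.
  by rewrite !h1 // !mulVg.
(* At [s = 0] the lifted increments are those of the path [gt], since these lie in [U], and they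
   telescope to its endpoint. *)
have P0 : P 0 = z.
  rewrite /P (eq_gprod (v := fun i => ((gt (ti i))^-1 * gt (ti i.+1))%g)).
    by rewrite (gprod_telescope (fun i => gt (ti i))) ti0 tik gt0 gt1 invg1 mul1g.
  move=> i ik; rewrite /q /= clamp0.
  rewrite !h0 // (clamp_id (ti01 i (ltnW ik))) (clamp_id (ti01 i.+1 ik)).
  rewrite -(lie_morphismV mth) -(lie_morphismM mth) sigth //.
  by apply: (kU 0 (ti i) (ti i.+1)) => //; [rewrite lexx ler01|apply: ti01; exact: ltnW].
by rewrite /= -P0 P01.
Qed.
End covering.

Theorem proposition5p6 (R : realType) (n N : nat) (G : lieGroupType R n)
    (rho : sl_rep N G)
    (G_connected : connected [set: G])
    (G_semisimple : semisimple G)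
    (G_rank : (2 <= real_rank G)%N)
    (G_no_compact : no_compact_factors G)
    (G_center : finite_set (group_center G))
    (rho_nontrivial : no_trivial_constituent rho)
    (Grho_simply_connected : simply_connected R (semidirect rho)) :
  (exists (d : nat) (H : lieGroupType R d) (theta : H -> semidirect rho),
     perfect_central_extension theta /\ hom_kernel theta <> [set 1%g])
  <-> symplectic_contribution rho.
Proof.
split=> [[d [H [theta [[cext perfH] kernel_nt]]]]|]; last first.
  exact: symplectic_extension (semisimple_perfect G_connected G_semisimple) rho_nontrivial.
apply: contrapT => no_form; apply: kernel_nt.
have connS : connected [set: semidirect rho].
  exact: path_connected_connected (Grho_simply_connected.1 1%g).
have bc := sd_chart_based rho.
have Sfree := sd_Ad_functional (rho := rho) G_semisimple rho_nontrivial.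
apply: (covering_trivial bc cext (theta_open bc cext connS Sfree)) => // w Tw.
apply: contrapT => w0.
have [//|[p [pw0 p_br]]] :=
  kernel_dichotomy G_semisimple rho_nontrivial G_connected cext connS Tw w0.
exact: pw0 (perfect_no_functional bc cext connS Sfree p_br w perfH).
Qed.
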